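(* Let $k$ be a field, $Q$ a connected Dynkin quiver, and $C$ a set of vertices of $\mathbb{Z}Q$ which is an admissible configuration (as defined in the context). (a) We have $\mathrm{Ext}^p_{\mathcal{S}_C}(I,M)=0$ for all $p\geq 2$, for each finitely cogenerated injective $\mathcal{S}_C$-module $I$ and each pointwise finite-dimensional right bounded $\mathcal{S}_C$-module $M$. (b) We have $\mathrm{Ext}^p_{\mathcal{S}_C}(M,P)=0$ for all $p\geq 2$, for each finitely generated projective $\mathcal{S}_C$-module $P$ and each pointwise finite-dimensional left bounded $\mathcal{S}_C$-module $M$.
   Context: A connected Dynkin quiver is a quiver whose underlying graph is an ADE Dynkin diagram. $D=\mathrm{Hom}_k(?,k)$. Repetition quiver: $\mathbb{Z}Q$ has vertices $(i,p)$, $i\in Q_0$, $p\in\mathbb{Z}$, and for each arrow $\alpha:i\to j$ and $p\in\mathbb{Z}$ arrows $(\alpha,p):(i,p)\to(j,p)$ and $\sigma(\alpha,p):(j,p-1)\to(i,p)$. Put $\tau(i,p)=(i,p-1)$, and for an arrow $\beta$ put $\sigma(\beta)=\sigma(\alpha,p)$ if $\beta=(\alpha,p)$ and $\sigma(\beta)=(\alpha,p-1)$ if $\beta=\sigma(\alpha,p)$. The mesh relator $r_x$ is the sum over all arrows $\beta:y\to x$ of the paths $\tau(x)\xrightarrow{\sigma(\beta)}y\xrightarrow{\beta}x$. Nakajima categories: $\tilde{Q}$ is obtained from $Q$ by adding for each $i\in Q_0$ a new vertex $i'$ and an arrow $i\to i'$. The vertices $(i',p)$ of $\mathbb{Z}\tilde{Q}$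 are frozen, the $(i,p)$, $i\in Q_0$, non frozen. For non frozen $x=(i,p)$ put $\sigma(x)=(i',p-1)$ and $\sigma^{-1}(x)=(i',p)$ (so there are arrows $\sigma(x)\to x\to\sigma^{-1}(x)$). $\mathcal{R}$ has objects the vertices of $\mathbb{Z}\tilde{Q}$ and morphisms linear combinations of paths modulo the ideal generated by the $r_x$ for non frozen $x$ only. Configurations: for $C\subset\mathbb{Z}Q_0$, $\mathcal{R}_C$ is the quotient of $\mathcal{R}$ by the ideal generated by the identities of the frozen vertices not in $\sigma^{-1}(C)$, and $\mathcal{S}_C$ is the full subcategory of $\mathcal{R}_C$ on the vertices in $\sigma^{-1}(C)$. $C$ is admissible if for each non frozen vertex $x$ the sequences $$0\to\mathcal{R}_C(?,x)\to\bigoplus_{x\to y}\mathcal{R}_C(?,y)\quad\text{and}\quad 0\to\mathcal{R}_C(x,?)\to\bigoplus_{y\to x}\mathcal{R}_C(y,?)$$ are exact, the sums ranging over all arrows of $\mathbb{Z}\tilde{Q}$ with source (resp. target) $x$. An $\mathcal{S}_C$-module is a $k$-linear functor $M:\mathcal{S}_C^{op}\to\mathrm{Mod}\,k$. It is finitely generated if it is a quotient of a finite direct sum of modules $\mathcal{S}_C(?,u)$, finitely cogenerated if it is a submodule of a finite direct sum of modules $D\mathcal{S}_C(u,?)$, pointwise finite-dimensional if all $M(u)$ are finite-dimensional, right (resp. left) bounded if $M(i',p)=0$ for all $p\gg 0$ (resp. $p\ll 0$) and all $i\in Q_0$ with $(i',p)\in\sigma^{-1}(C)$. *)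

(* Defs.v *)
From HB Require Import structures.
From mathcomp Require Import all_boot all_order all_algebra.
From mathcomp Require Import generic_quotient ring_quotient.
From mathcomp Require Import finmap boolp classical_sets functions.
From mathcomp Require Import monalg.

Set Implicit Arguments.
Unset Strict Implicit.
Unset Printing Implicit Defensive.

Import GRing.Theory.
Local Open Scope ring_scope.
Local Open Scope classical_set_scope.

Section LinearAlgebra.
Variable k : fieldType.

Record submodule (V : lmodType k) := Submodule {
  smem :> V -> Prop;
  smem0 : smem 0;
  smemD : forall v w, smem v -> smem w -> smem (v + w);
  smemZ : forall (a : k) v, smem v -> smem (a *: v) }.

Section Quotient.
Variables (V : lmodType k) (U : submodule V).

Definition smemb : {pred V} := fun v => `[< U v >].

Lemma smemb_zmod_closed : zmod_closed smemb.
Proof.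
split=> [|v w /asboolP vU /asboolP wU]; apply/asboolP; first exact: smem0.
by rewrite -scaleN1r; apply/smemD/smemZ.
Qed.
HB.instance Definition _ := GRing.isZmodClosed.Build V smemb smemb_zmod_closed.

Local Notation zquot := (Quotient.quot (smemb : zmodClosed V)).
Definition lquot : Type := zquot.
HB.instance Definition _ := GRing.Zmodule.copy lquot zquot.

Definition qpi (v : V) : lquot := \pi_(zquot)%qT v.
Definition qrepr (x : lquot) : V := repr (x : zquot).

Lemma qpiP v w : reflect (qpi v = qpi w) `[< U (v - w) >].
Proof.
have := Quotient.idealrBE (smemb : zmodClosed V) v w; rewrite unfold_in => ->.
exact: eqP.
Qed.

Lemma qpiK (x : lquot) : qpi (qrepr x) = x. Proof. exact: (@reprK _ zquot). Qed.

Lemma qpiD v w : qpi (v + w) = qpi v + qpi w.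
Proof. exact: (raddfD (\pi_(zquot)%qT : {additive V -> zquot})). Qed.

Definition lquot_scale (a : k) (x : lquot) : lquot := qpi (a *: qrepr x).

Lemma lquot_scaleE a v : lquot_scale a (qpi v) = qpi (a *: v).
Proof.
apply/qpiP/asboolP; rewrite -scalerBr; apply: smemZ.
by apply/asboolP/qpiP; rewrite qpiK.
Qed.

Lemma lquot_scaleA a b x :
  lquot_scale a (lquot_scale b x) = lquot_scale (a * b) x.
Proof. by rewrite -(qpiK x) !lquot_scaleE scalerA. Qed.
Lemma lquot_scale1 : left_id 1 lquot_scale.
Proof. by move=> x; rewrite -(qpiK x) lquot_scaleE scale1r. Qed.
Lemma lquot_scaleDr : right_distributive lquot_scale +%R.
Proof.
move=> a x y; rewrite -(qpiK x) -(qpiK y) -qpiD !lquot_scaleE -qpiD.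
by rewrite scalerDr.
Qed.
Lemma lquot_scaleDl x :
  {morph lquot_scale^~ x : a b / a + b}.
Proof.
by move=> a b; rewrite -(qpiK x) !lquot_scaleE scalerDl qpiD.
Qed.
HB.instance Definition _ := GRing.Zmodule_isLmodule.Build k lquot
  lquot_scaleA lquot_scale1 lquot_scaleDr lquot_scaleDl.

Lemma qpi_linear : linear qpi.
Proof. by move=> a v w; rewrite qpiD -lquot_scaleE. Qed.
HB.instance Definition _ := GRing.isLinear.Build k V lquot *:%R qpi qpi_linear.

End Quotient.

Section Product.
Variables (I : Type) (V : I -> lmodType k).

Definition lprod : Type := forall i, V i.
HB.instance Definition _ := gen_eqMixin lprod.
HB.instance Definition _ := gen_choiceMixin lprod.

Let add (f g : lprod) : lprod := fun i => f i + g i.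
Let opp (f : lprod) : lprod := fun i => - f i.
Let scale (a : k) (f : lprod) : lprod := fun i => a *: f i.

Fact lprod_addA : associative add.
Proof. by move=> f g h; apply: functional_extensionality_dep => i; apply: addrA. Qed.
Fact lprod_addC : commutative add.
Proof. by move=> f g; apply: functional_extensionality_dep => i; apply: addrC. Qed.
Fact lprod_add0 : left_id (fun i => 0) add.
Proof. by move=> f; apply: functional_extensionality_dep => i; apply: add0r. Qed.
Fact lprod_addN : left_inverse (fun i => 0) opp add.
Proof. by move=> f; apply: functional_extensionality_dep => i; apply: addNr. Qed.
HB.instance Definition _ :=
  GRing.isZmodule.Build lprod lprod_addA lprod_addC lprod_add0 lprod_addN.

Fact lprod_scaleA a b f : scale a (scale b f) = scale (a * b) f.
Proof. by apply: functional_extensionality_dep => i; apply: scalerA. Qed.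
Fact lprod_scale1 : left_id 1 scale.
Proof. by move=> f; apply: functional_extensionality_dep => i; apply: scale1r. Qed.
Fact lprod_scaleDr : right_distributive scale +%R.
Proof. by move=> a f g; apply: functional_extensionality_dep => i; apply: scalerDr. Qed.
Fact lprod_scaleDl f : {morph scale^~ f : a b / a + b}.
Proof. by move=> a b; apply: functional_extensionality_dep => i; apply: scalerDl. Qed.
HB.instance Definition _ := GRing.Zmodule_isLmodule.Build k lprod
  lprod_scaleA lprod_scale1 lprod_scaleDr lprod_scaleDl.

End Product.

Section Dual.
Variable V : lmodType k.

Definition dual_pred : {pred (V -> k^o)} := fun f => `[< linear f >].

Fact dual_submod_closed : submod_closed dual_pred.
Proof.
split=> [|a f g /asboolP fl /asboolP gl]; apply/asboolP => b v w.
  by rewrite /GRing.zero /= scaler0 addr0.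
have E x : (a *: f + g) x = a *: f x + g x by [].
by rewrite !E fl gl !scalerDr !scalerA mulrC -!addrA; congr (_ + _); rewrite addrCA.
Qed.
HB.instance Definition _ := GRing.isSubmodClosed.Build k (V -> k^o) dual_pred
  dual_submod_closed.

Record dual := Dual { dual_fun :> V -> k^o; _ : dual_fun \in dual_pred }.
HB.instance Definition _ := [isSub for dual_fun].
HB.instance Definition _ := [Choice of dual by <:].
HB.instance Definition _ := [SubChoice_isSubLmodule of dual by <:].

Lemma dualP (f : dual) : linear f.
Proof. by case: f => f /= /asboolP. Qed.

End Dual.

Lemma dual_pre_subproof (V W : lmodType k) (h : V -> W) (hl : linear h)
  (f : dual W) : (fun v => f (h v)) \in @dual_pred V.
Proof. by apply/asboolP => a v w; rewrite hl dualP. Qed.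
Definition dual_pre (V W : lmodType k) (h : V -> W) (hl : linear h)
  (f : dual W) : dual V := Dual (dual_pre_subproof hl f).

Definition finite_dim (V : lmodType k) : Prop :=
  exists (n : nat) (e : 'I_n -> V),
    forall v, exists c : 'I_n -> k, v = \sum_(i < n) c i *: e i.

Section LinearExtension.
Variables (K : choiceType) (V : lmodType k).

Definition mlift (h : K -> V) (g : {malg k[K]}) : V :=
  \sum_(x <- msupp g) g@_x *: h x.

Lemma mliftw (h : K -> V) (g : {malg k[K]}) (d : {fset K}) :
  (msupp g `<=` d)%fset -> mlift h g = \sum_(x <- d) g@_x *: h x.
Proof.
move=> gd; rewrite /mlift (big_fset_incl _ gd) // => x _ xg.
by rewrite mcoeff_outdom // scale0r.
Qed.

Lemma mlift_linear (h : K -> V) : linear (mlift h).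
Proof.
move=> a f g; pose d := (msupp (a *: f + g) `|` (msupp f `|` msupp g))%fset.
rewrite (@mliftw _ _ d) ?fsubsetUl // (@mliftw _ f d); last first.
  by apply: (fsubset_trans (fsubsetUl _ (msupp g))); rewrite fsubsetUr.
rewrite (@mliftw _ g d); last first.
  by apply: (fsubset_trans (fsubsetUr (msupp f) _)); rewrite fsubsetUr.
rewrite scaler_sumr -big_split /=; apply: eq_bigr => x _.
by rewrite mcoeffD mcoeffZ scalerDl scalerA.
Qed.

Lemma mliftU (h : K -> V) x : mlift h << x >> = h x.
Proof.
rewrite (@mliftw _ _ [fset x]%fset) ?msuppU_le //.
by rewrite big_seq_fset1 mcoeffUU scale1r.
Qed.

Lemma mlift_unique (h h' : {malg k[K]} -> V) :
  linear h -> linear h' -> (forall x, h << x >> = h' << x >>) -> h =1 h'.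
Proof.
move=> hl hl' e g.
pose H := GRing.isLinear.Build k _ _ *:%R h hl.
pose H' := GRing.isLinear.Build k _ _ *:%R h' hl'.
pose F : {linear {malg k[K]} -> V} := HB.pack h H.
pose F' : {linear {malg k[K]} -> V} := HB.pack h' H'.
change (F g = F' g); rewrite (monalgE g) !linear_sum.
apply: eq_bigr => x _.
have -> : << g@_x *g x >> = g@_x *: << x >>.
  by apply/malgP => y; rewrite mcoeffZ !mcoeffU mulrnAr mulr1.
by rewrite !linearZ /= e.
Qed.

End LinearExtension.
End LinearAlgebra.

Section LinearCategories.
Variable k : fieldType.

Record lincat := Lincat {
  ob :> Type;
  hom : ob -> ob -> lmodType k;
  idm : forall x, hom x x;
  hcomp : forall x y z, hom y z -> hom x y -> hom x z;
  comp_linearl : forall x y z (f : hom x y), linear (fun g : hom y z => hcomp g f);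
  comp_linearr : forall x y z (g : hom y z), linear (hcomp g : hom x y -> hom x z);
  compA : forall w x y z (h : hom y z) (g : hom x y) (f : hom w x),
    hcomp h (hcomp g f) = hcomp (hcomp h g) f;
  comp1m : forall x y (f : hom x y), hcomp (idm y) f = f;
  compm1 : forall x y (f : hom x y), hcomp f (idm x) = f }.

Section Ideal.
Variables (A : lincat) (G : forall x y : A, hom x y -> Prop).

Inductive ideal : forall x y : A, hom x y -> Prop :=
| ideal_gen x y (f : hom x y) : G f -> ideal f
| ideal0 x y : ideal (0 : hom x y)
| idealD x y (f g : hom x y) : ideal f -> ideal g -> ideal (f + g)
| idealZ x y (a : k) (f : hom x y) : ideal f -> ideal (a *: f)
| ideal_compl x y z (g : hom y z) (f : hom x y) : ideal f -> ideal (hcomp g f)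
| ideal_compr x y z (g : hom y z) (f : hom x y) : ideal g -> ideal (hcomp g f).

Definition ideal_sub (x y : A) : submodule (hom x y) :=
  Submodule (ideal0 x y) (@idealD x y) (@idealZ x y).

Definition qhom (x y : A) : lmodType k := lquot (ideal_sub x y).
Definition qclass (x y : A) (f : hom x y) : qhom x y := qpi (ideal_sub x y) f.
Definition qcomp (x y z : A) (g : qhom y z) (f : qhom x y) : qhom x z :=
  qclass (hcomp (qrepr g) (qrepr f)).

Lemma qclassP (x y : A) (f g : hom x y) : ideal (f - g) -> qclass f = qclass g.
Proof. by move=> fg; apply/qpiP/asboolP. Qed.

Lemma qclass_repr (x y : A) (f : hom x y) : ideal (qrepr (qclass f) - f).
Proof. by have /qpiP/asboolP := qpiK (qclass f). Qed.

Lemma qclassK (x y : A) (f : qhom x y) : qclass (qrepr f) = f.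
Proof. exact: qpiK. Qed.

Lemma qclass_linear (x y : A) : linear (@qclass x y).
Proof. exact: qpi_linear. Qed.

Lemma linB (U V : lmodType k) (h : U -> V) : linear h ->
  forall u v, h (u - v) = h u - h v.
Proof. by move=> hl u v; rewrite addrC -scaleN1r hl scaleN1r addrC. Qed.

Lemma qcompE (x y z : A) (g : hom y z) (f : hom x y) :
  qcomp (qclass g) (qclass f) = qclass (hcomp g f).
Proof.
apply: qclassP; set g' := qrepr _; set f' := qrepr (qclass f).
rewrite -[hcomp g' f'](subrK (hcomp g' f)) -addrA; apply: idealD.
  rewrite -(linB (@comp_linearr A x y z g')).
  exact/ideal_compl/qclass_repr.
rewrite -(linB (@comp_linearl A x y z f)).
exact/ideal_compr/qclass_repr.
Qed.

Lemma qcomp_linearl (x y z : A) (f : qhom x y) :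
  linear (fun g : qhom y z => qcomp g f).
Proof.
move=> a g h; rewrite -(qclassK f) -(qclassK g) -(qclassK h).
by rewrite -qclass_linear !qcompE comp_linearl qclass_linear.
Qed.
Lemma qcomp_linearr (x y z : A) (g : qhom y z) :
  linear (qcomp g : qhom x y -> qhom x z).
Proof.
move=> a f h; rewrite -(qclassK f) -(qclassK g) -(qclassK h).
by rewrite -qclass_linear !qcompE comp_linearr qclass_linear.
Qed.
Lemma qcompA (w x y z : A) (h : qhom y z) (g : qhom x y) (f : qhom w x) :
  qcomp h (qcomp g f) = qcomp (qcomp h g) f.
Proof.
by rewrite -(qclassK f) -(qclassK g) -(qclassK h) !qcompE compA.
Qed.
Lemma qcomp1m (x y : A) (f : qhom x y) : qcomp (qclass (idm y)) f = f.
Proof. by rewrite -(qclassK f) qcompE comp1m. Qed.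
Lemma qcompm1 (x y : A) (f : qhom x y) : qcomp f (qclass (idm x)) = f.
Proof. by rewrite -(qclassK f) qcompE compm1. Qed.

Definition qcat : lincat :=
  Lincat qcomp_linearl qcomp_linearr qcompA qcomp1m qcompm1.

End Ideal.

Section FullSubcategory.
Variables (A : lincat) (P : set A).

Definition fullsub : lincat :=
  @Lincat {x : A | P x} (fun x y => hom (sval x) (sval y))
    (fun x => idm (sval x)) (fun x y z g f => hcomp g f)
    (fun x y z => @comp_linearl A (sval x) (sval y) (sval z))
    (fun x y z => @comp_linearr A (sval x) (sval y) (sval z))
    (fun w x y z => @compA A (sval w) (sval x) (sval y) (sval z))
    (fun x y => @comp1m A (sval x) (sval y))
    (fun x y => @compm1 A (sval x) (sval y)).

End FullSubcategory.

Section Modules.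
Variable A : lincat.

(* k-linear functors from the opposite of A to vector spaces *)
Record rmod := Rmod {
  mob :> A -> lmodType k;
  mact : forall u v, hom u v -> mob v -> mob u;
  mact_linearl : forall u v (m : mob v), linear (fun f : hom u v => mact f m);
  mact_linearr : forall u v (f : hom u v), linear (mact f);
  mact1 : forall u (m : mob u), mact (idm u) m = m;
  mactM : forall u v w (g : hom v w) (f : hom u v) (m : mob w),
    mact (hcomp g f) m = mact f (mact g m) }.

Record mhom (M N : rmod) := Mhom {
  mfun :> forall u, M u -> N u;
  mfun_linear : forall u, linear (@mfun u);
  mfun_nat : forall u v (f : hom u v) (m : M v),
    mfun (mact f m) = mact f (mfun m) }.
Arguments mfun {M N} _ u _.

Definition msurj M N (f : mhom M N) : Prop := forall u n, exists m, f u m = n.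
Definition minj M N (f : mhom M N) : Prop := forall u, injective (f u).

Definition projective (P : rmod) : Prop :=
  forall (M N : rmod) (g : mhom M N) (f : mhom P N), msurj g ->
    exists h : mhom P M, forall u x, g u (h u x) = f u x.

Definition injective_module (I : rmod) : Prop :=
  forall (M N : rmod) (g : mhom M N) (f : mhom M I), minj g ->
    exists h : mhom N I, forall u x, h u (g u x) = f u x.

Record proj_resolution (M : rmod) := ProjResolution {
  pterm : nat -> rmod;
  pdiff : forall n, mhom (pterm n.+1) (pterm n);
  paug : mhom (pterm 0) M;
  pterm_proj : forall n, projective (pterm n);
  paug_surj : msurj paug;
  pexact0 : forall u x, paug u x = 0 <-> exists y, pdiff 0 u y = x;
  pexact : forall n u x, pdiff n u x = 0 <-> exists y, pdiff n.+1 u y = x }.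

Section Ext.
Variables (M N : rmod) (P : proj_resolution M).

Definition cocycle n (f : mhom (pterm P n) N) : Prop :=
  forall u x, f u (pdiff P n u x) = 0.

Definition coboundary n : mhom (pterm P n) N -> Prop :=
  match n with
  | 0 => fun f => forall u x, f u x = 0
  | n'.+1 => fun f => exists g : mhom (pterm P n') N,
      forall u x, f u x = g u (pdiff P n' u x)
  end.

End Ext.

(* Ext^n(M, N) = H^n(Hom(P, N)) = 0. The group does not depend on the
   projective resolution P of M; one exists by proj_resolution_exists below. *)
Definition Ext_vanishes (n : nat) (M N : rmod) : Prop :=
  forall (P : proj_resolution M) (f : mhom (pterm P n) N),
    cocycle f -> coboundary f.

Definition rep (u : A) : rmod :=
  @Rmod (fun v => hom v u) (fun v w f g => hcomp g f)
    (fun v w => @comp_linearr A v w u) (fun v w => @comp_linearl A v w u)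
    (fun v g => compm1 g) (fun v w x g f h => compA h g f).

Definition corep_ob (u v : A) : lmodType k := dual (hom u v).
Definition corep_act (u v w : A) (f : hom v w) : corep_ob u w -> corep_ob u v :=
  dual_pre (@comp_linearr A u v w f).

Lemma corep_linearl (u v w : A) (m : corep_ob u w) :
  linear (fun f : hom v w => corep_act f m).
Proof.
move=> a f g; apply: val_inj; apply/funext => h /=.
by rewrite comp_linearl dualP.
Qed.
Lemma corep_linearr (u v w : A) (f : hom v w) : linear (corep_act f : corep_ob u w -> corep_ob u v).
Proof. by move=> a m n; apply: val_inj; apply/funext => h. Qed.
Lemma corep1 (u v : A) (m : corep_ob u v) : corep_act (idm v) m = m.
Proof. by apply: val_inj; apply/funext => h /=; rewrite comp1m. Qed.
Lemma corepM (u v w x : A) (g : hom w x) (f : hom v w) (m : corep_ob u x) :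
  corep_act (hcomp g f) m = corep_act f (corep_act g m).
Proof. by apply: val_inj; apply/funext => h /=; rewrite compA. Qed.

(* the module D A(u, ?) *)
Definition corep (u : A) : rmod :=
  Rmod (@corep_linearl u) (@corep_linearr u) (@corep1 u) (@corepM u).

Section DirectSum.
Variables (n : nat) (M : 'I_n -> rmod).

Definition dsum_ob (u : A) : lmodType k := lprod (fun i => M i u).
Definition dsum_act (u v : A) (f : hom u v) (m : dsum_ob v) : dsum_ob u :=
  fun i => mact f (m i).

Lemma dsum_linearl (u v : A) (m : dsum_ob v) :
  linear (fun f : hom u v => dsum_act f m).
Proof.
by move=> a f g; apply: functional_extensionality_dep => i; apply: mact_linearl.
Qed.
Lemma dsum_linearr (u v : A) (f : hom u v) : linear (dsum_act f).
Proof.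
by move=> a m p; apply: functional_extensionality_dep => i; apply: mact_linearr.
Qed.
Lemma dsum1 (u : A) (m : dsum_ob u) : dsum_act (idm u) m = m.
Proof. by apply: functional_extensionality_dep => i; apply: mact1. Qed.
Lemma dsumM (u v w : A) (g : hom v w) (f : hom u v) (m : dsum_ob w) :
  dsum_act (hcomp g f) m = dsum_act f (dsum_act g m).
Proof. by apply: functional_extensionality_dep => i; apply: mactM. Qed.

Definition dsum : rmod := Rmod dsum_linearl dsum_linearr dsum1 dsumM.

End DirectSum.

Definition finitely_generated (M : rmod) : Prop :=
  exists (n : nat) (u : 'I_n -> A) (f : mhom (dsum (fun i => rep (u i))) M),
    msurj f.

Definition finitely_cogenerated (M : rmod) : Prop :=
  exists (n : nat) (u : 'I_n -> A) (f : mhom M (dsum (fun i => corep (u i)))),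
    minj f.

Definition pointwise_finite_dim (M : rmod) : Prop := forall u, finite_dim (M u).

Section Resolutions.

Section Kernel.
Variables (M N : rmod) (f : mhom M N).

Definition ker_pred (u : A) : {pred M u} := fun m => `[< f u m = 0 >].

Lemma ker_submod_closed (u : A) : submod_closed (@ker_pred u).
Proof.
have fZ := @mfun_linear _ _ f u.
split=> [|a x y /asboolP fx /asboolP fy]; apply/asboolP.
  by have := linB fZ 0 0; rewrite !subrr.
by rewrite fZ fx fy scaler0 addr0.
Qed.
HB.instance Definition _ (u : A) :=
  GRing.isSubmodClosed.Build k (M u) (@ker_pred u) (ker_submod_closed u).

Record ker_ob (u : A) := Ker { ker_val :> M u; _ : ker_val \in @ker_pred u }.
HB.instance Definition _ (u : A) := [isSub for @ker_val u].
HB.instance Definition _ (u : A) := [Choice of ker_ob u by <:].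
HB.instance Definition _ (u : A) := [SubChoice_isSubLmodule of ker_ob u by <:].

Lemma kerP (u : A) (m : ker_ob u) : f u m = 0.
Proof. by case: m => m /= /asboolP. Qed.

Lemma ker_act_subproof (u v : A) (h : hom u v) (m : ker_ob v) :
  mact h (ker_val m) \in @ker_pred u.
Proof.
apply/asboolP; rewrite mfun_nat kerP.
by have := linB (@mact_linearr N u v h) 0 0; rewrite !subrr.
Qed.
Definition ker_act (u v : A) (h : hom u v) (m : ker_ob v) : ker_ob u :=
  Ker (ker_act_subproof h m).

Lemma ker_linearl (u v : A) (m : ker_ob v) :
  linear (fun h : hom u v => ker_act h m).
Proof. by move=> a g h; apply: val_inj; apply: mact_linearl. Qed.
Lemma ker_linearr (u v : A) (h : hom u v) : linear (ker_act h).
Proof. by move=> a m n; apply: val_inj; apply: mact_linearr. Qed.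
Lemma ker1 (u : A) (m : ker_ob u) : ker_act (idm u) m = m.
Proof. by apply: val_inj; apply: mact1. Qed.
Lemma kerM (u v w : A) (g : hom v w) (h : hom u v) (m : ker_ob w) :
  ker_act (hcomp g h) m = ker_act h (ker_act g m).
Proof. by apply: val_inj; apply: mactM. Qed.

Definition ker_mod : rmod :=
  @Rmod (fun u => ker_ob u : lmodType k) ker_act
    ker_linearl ker_linearr ker1 kerM.

Definition ker_incl : mhom ker_mod M :=
  @Mhom ker_mod M (fun u m => ker_val m) (fun u a m n => erefl)
    (fun u v h m => erefl).

End Kernel.

Section FreeCover.
Variable M : rmod.

Definition free_gen : Type := {u : A & M u}.
Definition free_basis (v : A) : Type := {x : free_gen & hom v (tag x)}.
HB.instance Definition _ v := gen_eqMixin (free_basis v).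
HB.instance Definition _ v := gen_choiceMixin (free_basis v).

Definition basis_elt (v : A) (x : free_gen) (h : hom v (tag x)) :
  {malg k[free_basis v]} := << existT _ x h : free_basis v >>.

Inductive free_rel (v : A) : {malg k[free_basis v]} -> Prop :=
| free_rel0 : free_rel 0
| free_relD g h : free_rel g -> free_rel h -> free_rel (g + h)
| free_relZ (a : k) g : free_rel g -> free_rel (a *: g)
| free_rel_lin x (a : k) (g h : hom v (tag x)) :
    free_rel (basis_elt (a *: g + h) - (a *: basis_elt g + basis_elt h)).

Definition free_ob (v : A) : lmodType k :=
  lquot (Submodule (@free_rel0 v) (@free_relD v) (@free_relZ v)).
Definition free_elt (v : A) (x : free_gen) (h : hom v (tag x)) : free_ob v :=
  qpi _ (basis_elt h).

Lemma free_elt_linear (v : A) (x : free_gen) : linear (@free_elt v x).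
Proof.
move=> a g h; rewrite /free_elt -(@qpi_linear k _ _ a).
apply/qpiP/asboolP; exact: free_rel_lin.
Qed.

Section Extension.
Variables (v : A) (W : lmodType k) (phi : forall x : free_gen, hom v (tag x) -> W).
Hypothesis phi_linear : forall x, linear (phi (x := x)).

Let lift (g : {malg k[free_basis v]}) : W :=
  mlift (fun y : free_basis v => phi (tagged y)) g.

Lemma free_lift_rel g h : free_rel (g - h) -> lift g = lift h.
Proof.
have ll : linear lift := @mlift_linear _ _ _ _.
have l0 : lift 0 = 0 by have := linB ll 0 0; rewrite !subrr.
suff H d : free_rel d -> lift d = 0.
  by move/H; rewrite (linB ll) => /eqP; rewrite subr_eq0 => /eqP.
elim=> [//|{}g {}h _ g0 _ h0|a {}g _ g0|x a {}g {}h].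
- by rewrite -[g]scale1r ll g0 h0 scaler0 addr0.
- by rewrite -[_ *: _]addr0 ll g0 l0 scaler0 addr0.
rewrite (linB ll) ll /lift !mliftU /= phi_linear.
exact: subrr.
Qed.

Definition free_ext (g : free_ob v) : W := lift (qrepr g).

Lemma free_extE x (h : hom v (tag x)) : free_ext (free_elt h) = phi h.
Proof.
rewrite /free_ext (@free_lift_rel _ (basis_elt h)) ?/lift ?mliftU //.
by have /qpiP/asboolP := qpiK (free_elt h).
Qed.

Lemma free_ext_linear : linear free_ext.
Proof.
move=> a g h; rewrite /free_ext -(@mlift_linear k _ _ _ a).
apply: free_lift_rel.
set U := Submodule _ _ _.
have /qpiP/asboolP // : qpi U (qrepr (a *: g + h)) = qpi U (a *: qrepr g + qrepr h).
by rewrite qpi_linear !qpiK.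
Qed.

End Extension.

Lemma free_unique (v : A) (W : lmodType k) (f g : free_ob v -> W) :
  linear f -> linear g ->
  (forall x (h : hom v (tag x)), f (free_elt h) = g (free_elt h)) -> f =1 g.
Proof.
move=> fl gl e m; rewrite -(qpiK m); move: (qrepr m).
apply: (@mlift_unique _ _ _ (fun p => f (qpi _ p)) (fun p => g (qpi _ p)))
  => [a p q|a p q|[x h]].
- by rewrite qpi_linear fl.
- by rewrite qpi_linear gl.
- exact: e.
Qed.

Definition free_act (u v : A) (f : hom u v) : free_ob v -> free_ob u :=
  free_ext (fun x h => free_elt (hcomp h f)).

Lemma free_act_phi (u v : A) (f : hom u v) (x : free_gen) :
  linear (fun h : hom v (tag x) => free_elt (hcomp h f)).
Proof. by move=> a g h; rewrite comp_linearl free_elt_linear. Qed.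

Lemma free_actE (u v : A) (f : hom u v) x (h : hom v (tag x)) :
  free_act f (free_elt h) = free_elt (hcomp h f).
Proof. exact/free_extE/free_act_phi. Qed.

Lemma free_linearr (u v : A) (f : hom u v) : linear (free_act f).
Proof. exact/free_ext_linear/free_act_phi. Qed.

Lemma free_linearl (u v : A) (m : free_ob v) :
  linear (fun f : hom u v => free_act f m).
Proof.
move=> a f g; move: m; apply: free_unique => [|b m n|x h].
- exact: free_linearr.
- rewrite !free_linearr !scalerDr !scalerA [b * a]mulrC -!addrA.
  by congr (_ + _); rewrite addrCA.
- by rewrite !free_actE comp_linearr free_elt_linear.
Qed.

Lemma free1 (u : A) (m : free_ob u) : free_act (idm u) m = m.
Proof.
move: m; apply: free_unique => [||x h]; [exact: free_linearr|by []|].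
by rewrite free_actE compm1.
Qed.

Lemma freeM (u v w : A) (g : hom v w) (f : hom u v) (m : free_ob w) :
  free_act (hcomp g f) m = free_act f (free_act g m).
Proof.
move: m; apply: free_unique => [|a m n|x h]; first exact: free_linearr.
  by rewrite !free_linearr.
by rewrite !free_actE compA.
Qed.

Definition free_mod : rmod := Rmod free_linearl free_linearr free1 freeM.

Section FreeMap.
Variables (N : rmod) (n : forall x : free_gen, N (tag x)).

Definition free_map_fun (u : A) : free_mod u -> N u :=
  free_ext (fun x h => mact h (n x)).
Let phi_linear (u : A) (x : free_gen) :
  linear (fun h : hom u (tag x) => mact h (n x)).
Proof. exact: mact_linearl. Qed.

Lemma free_mapE (u : A) x (h : hom u (tag x)) :
  free_map_fun (free_elt h) = mact h (n x).
Proof. exact/free_extE/phi_linear. Qed.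
Lemma free_map_linear (u : A) : linear (@free_map_fun u).
Proof. exact/free_ext_linear/phi_linear. Qed.
Lemma free_map_nat (u v : A) (f : hom u v) (m : free_mod v) :
  free_map_fun (mact f m) = mact f (free_map_fun m).
Proof.
move: m; apply: free_unique => [a p q|a p q|x h].
- by rewrite mact_linearr free_map_linear.
- by rewrite free_map_linear mact_linearr.
- by rewrite [mact f _]free_actE !free_mapE mactM.
Qed.
Definition free_map : mhom free_mod N := Mhom free_map_linear free_map_nat.
End FreeMap.

Lemma free_projective : projective free_mod.
Proof.
move=> P N g f gs.
pose y (x : free_gen) : P (tag x) := projT1 (cid (gs _ (f _ (free_elt (idm (tag x)))))).
have yE x : g _ (y x) = f _ (free_elt (idm (tag x))).
  by rewrite /y; case: cid.
exists (free_map y) => u; apply: free_unique => [a p q|a p q|x h].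
- by rewrite !mfun_linear.
- by rewrite mfun_linear.
rewrite [free_map y _ _]free_mapE mfun_nat yE -mfun_nat.
by rewrite [mact h _]free_actE comp1m.
Qed.

Definition free_cover : mhom free_mod M := free_map (fun x => tagged x).

Lemma free_cover_surj : msurj free_cover.
Proof.
move=> u m; exists (@free_elt u (existT _ u m) (idm u)).
by rewrite [LHS]free_mapE mact1.
Qed.

End FreeCover.

Definition mcomp (L M N : rmod) (g : mhom M N) (f : mhom L M) : mhom L N.
Proof.
refine (@Mhom L N (fun u x => g u (f u x)) _ _) => [u a x y|u v h x].
  by rewrite !mfun_linear.
by rewrite !mfun_nat.
Defined.

Lemma proj_resolution_exists (M : rmod) : inhabited (proj_resolution M).
Proof.
pose Z := fix Z n := if n is n'.+1 then ker_mod (free_cover (Z n')) else M.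
pose d n : mhom (free_mod (Z n.+1)) (free_mod (Z n)) :=
  mcomp (ker_incl (free_cover (Z n))) (free_cover (Z n.+1)).
have dim n u x : free_cover (Z n) u x = 0 <-> exists y, d n u y = x.
  split=> [e|[y <-]]; last exact: (kerP (free_cover (Z n.+1) u y)).
  have kx : x \in @ker_pred _ _ (free_cover (Z n)) u by apply/asboolP.
  have [y yE] := free_cover_surj (M := Z n.+1) (Ker kx).
  by exists y; rewrite /d /= [X in ker_val X]yE.
split; apply: (@ProjResolution M (fun n => free_mod (Z n)) d (free_cover (Z 0))).
- by move=> n; apply: free_projective.
- exact: free_cover_surj.
- exact: dim.
move=> n u x; rewrite -dim; split=> [e|e].
  exact: (val_inj (e : ker_val _ = ker_val 0)).
by change (ker_val (free_cover (Z n.+1) u x) = 0); rewrite e.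
Qed.

End Resolutions.

End Modules.
End LinearCategories.

Section Quivers.

Record quiver := Quiver {
  vert : choiceType;
  arr : choiceType;
  src : arr -> vert;
  tgt : arr -> vert }.

Record finquiver := FinQuiver {
  Q0 : finType;
  Q1 : finType;
  fsrc : Q1 -> Q0;
  ftgt : Q1 -> Q0 }.

Section Paths.
Variable Q : quiver.

Fixpoint walk (x : vert Q) (s : seq (arr Q)) (y : vert Q) : bool :=
  if s is a :: s' then (src a == x) && walk (tgt a) s' y else x == y.

(* the arrows are listed in the order in which they are traversed *)
Definition qpath (x y : vert Q) := {s : seq (arr Q) | walk x s y}.

Lemma walk_cat x y z s t : walk x s y -> walk y t z -> walk x (s ++ t) z.
Proof.
elim: s x => [x /eqP -> //|a s IH x /=].
by case/andP=> -> sy /(IH _ sy).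
Qed.

Definition pnil x : qpath x x := exist _ [::] (eqxx x).
Definition pcat x y z (p : qpath x y) (q : qpath y z) : qpath x z :=
  exist _ (val p ++ val q) (walk_cat (valP p) (valP q)).

Definition arrow (x y : vert Q) := {a : arr Q | (src a == x) && (tgt a == y)}.

Lemma arrow_walk x y (a : arrow x y) : walk x [:: val a] y.
Proof. exact: (valP a). Qed.
Definition parrow x y (a : arrow x y) : qpath x y := exist _ [:: val a] (arrow_walk a).

End Paths.

Section PathCategory.
Variables (k : fieldType) (Q : quiver).

Definition phom (x y : vert Q) : lmodType k := {malg k[qpath x y]}.
Definition pid (x : vert Q) : phom x x := << pnil x >>.
Definition pcomp (x y z : vert Q) (g : phom y z) (f : phom x y) : phom x z :=
  mlift (fun p => mlift (fun q => << pcat p q >> : phom x z) g) f.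

Lemma pcompU (x y z : vert Q) (p : qpath x y) (q : qpath y z) :
  pcomp << q >> << p >> = << pcat p q >>.
Proof. by rewrite /pcomp !mliftU. Qed.
Lemma pcomp_linearr (x y z : vert Q) (g : phom y z) :
  linear (pcomp g : phom x y -> phom x z).
Proof. exact: mlift_linear. Qed.
Lemma pcomp_linearl (x y z : vert Q) (f : phom x y) :
  linear (fun g : phom y z => pcomp g f).
Proof.
move=> a g h; rewrite /pcomp /mlift scaler_sumr -big_split /=.
apply: eq_bigr => p _; rewrite -/(mlift _ g) -/(mlift _ h) -/(mlift _ (_ + _)).
by rewrite mlift_linear scalerDr !scalerA mulrC.
Qed.
Lemma pcomp1m (x y : vert Q) (f : phom x y) : pcomp (pid y) f = f.
Proof.
move: f; apply: mlift_unique => [||p]; [exact: pcomp_linearr|by []|].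
by rewrite pcompU; congr (<< _ >>); apply: val_inj; rewrite /= cats0.
Qed.
Lemma pcompm1 (x y : vert Q) (f : phom x y) : pcomp f (pid x) = f.
Proof.
move: f; apply: (@mlift_unique _ _ _ (fun f => pcomp f (pid x))) => [||p];
  [exact: pcomp_linearl|by []|].
by rewrite pcompU; congr (<< _ >>); apply: val_inj.
Qed.
Lemma pcompA (w x y z : vert Q) (h : phom y z) (g : phom x y) (f : phom w x) :
  pcomp h (pcomp g f) = pcomp (pcomp h g) f.
Proof.
move: f; apply: mlift_unique; [|exact: pcomp_linearr|] => [a f f'|p].
  by rewrite !pcomp_linearr.
move: g; apply: (@mlift_unique _ _ _ (fun g => pcomp h (pcomp g << p >>))
    (fun g => pcomp (pcomp h g) << p >>)) => [a g g'|a g g'|q].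
- by rewrite pcomp_linearl pcomp_linearr.
- by rewrite pcomp_linearr pcomp_linearl.
move: h; apply: (@mlift_unique _ _ _ (fun h => pcomp h (pcomp << q >> << p >>))
    (fun h => pcomp (pcomp h << q >>) << p >>)) => [|a h h'|r].
- exact: pcomp_linearl.
- by rewrite !pcomp_linearl.
rewrite !pcompU; congr (<< _ >>); apply: val_inj; exact/esym/catA.
Qed.

Definition pathcat : lincat k :=
  Lincat pcomp_linearl pcomp_linearr pcompA pcomp1m pcompm1.

End PathCategory.

(* The vertices of A_n, D_n and E_n are 0, ..., n-1. The vertices 0, ..., n-2
   of D_n and E_n form a chain and n-1 is attached to n-3 (for D_n), 2 (for
   E_n). *)
Variant ADE := TypeA of nat | TypeD of nat | TypeE of nat.

Definition ADE_valid (t : ADE) : bool :=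
  match t with
  | TypeA n => (1 <= n)%N
  | TypeD n => (4 <= n)%N
  | TypeE n => (6 <= n <= 8)%N
  end.

Definition ADE_rank (t : ADE) : nat :=
  match t with TypeA n | TypeD n | TypeE n => n end.

Definition branched_edge (n b i j : nat) : bool :=
  ((j == i.+1) && (j < n.-1)%N) || ((i == b) && (j == n.-1)).

Definition ADE_edge (t : ADE) (i j : nat) : bool :=
  match t with
  | TypeA n => j == i.+1
  | TypeD n => branched_edge n (n - 3) i j
  | TypeE n => branched_edge n 2 i j
  end.

Definition ADE_adj (t : ADE) (i j : nat) : bool :=
  ADE_edge t i j || ADE_edge t j i.

Definition joins (Q : finquiver) (a : Q1 Q) (x y : Q0 Q) : bool :=
  ((fsrc a == x) && (ftgt a == y)) || ((fsrc a == y) && (ftgt a == x)).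

Definition connected_Dynkin (Q : finquiver) : Prop :=
  exists t : ADE, ADE_valid t /\
  exists f : 'I_(ADE_rank t) -> Q0 Q, bijective f /\
    forall i j, #|[set a : Q1 Q | joins a (f i) (f j)]%SET| = ADE_adj t i j :> nat.

Section Repetition.
Variable Q : finquiver.

(* (inl a, p) is the arrow (a, p) and (inr a, p) is the arrow sigma(a, p) *)
Definition rsrc (b : (Q1 Q + Q1 Q) * int) : Q0 Q * int :=
  match b with
  | (inl a, p) => (fsrc a, p)
  | (inr a, p) => (ftgt a, p - 1)
  end.
Definition rtgt (b : (Q1 Q + Q1 Q) * int) : Q0 Q * int :=
  match b with
  | (inl a, p) => (ftgt a, p)
  | (inr a, p) => (fsrc a, p)
  end.

Definition repetition : quiver := Quiver rsrc rtgt.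

Definition tau (x : vert repetition) : vert repetition := (x.1, x.2 - 1).

Definition sigma_arr (b : arr repetition) : arr repetition :=
  match b with
  | (inl a, p) => (inr a, p)
  | (inr a, p) => (inl a, p - 1)
  end.

(* As the target of (e, p) is of the form (j, p), the arrows with target x are
   the (e, x.2) with e in the following finite type. *)
Definition arrows_into (x : vert repetition) :=
  {e : Q1 Q + Q1 Q | rtgt (e, x.2) == x}.

Lemma mesh_walk (x : vert repetition) (e : arrows_into x) :
  walk (tau x) [:: sigma_arr (val e, x.2); (val e, x.2)] x.
Proof. by case: x e => j p [[a|a] /= /eqP [<-]] /=; rewrite !eqxx. Qed.

Definition mesh_path (x : vert repetition) (e : arrows_into x) : qpath (tau x) x :=
  exist _ [:: sigma_arr (val e, x.2); (val e, x.2)] (mesh_walk e).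

Definition mesh_relator (k : fieldType) (x : vert repetition) :
    phom k (tau x) x :=
  \sum_(e : arrows_into x) << mesh_path e >>.

End Repetition.

(* inr i is the added vertex i' in the vertices and the added arrow i -> i' in
   the arrows *)
Definition framed (Q : finquiver) : finquiver :=
  @FinQuiver (Q0 Q + Q0 Q)%type (Q1 Q + Q0 Q)%type
    (fun a => match a with inl a => inl (fsrc a) | inr i => inl i end)
    (fun a => match a with inl a => inl (ftgt a) | inr i => inr i end).

End Quivers.

Section Nakajima.
Variables (k : fieldType) (Q : finquiver).

Local Notation ZQ0 := (vert (repetition Q)).
Local Notation ZQf := (repetition (framed Q)).

Definition nonfrozen (x : ZQ0) : vert ZQf := (inl x.1, x.2).
Definition frozen (x : ZQ0) : vert ZQf := (inr x.1, x.2).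

(* sigma^{-1}(i, p) = (i', p) *)
Definition sigma_inv (x : ZQ0) : vert ZQf := frozen x.

Variant mesh_relation : forall x y : pathcat k ZQf, hom x y -> Prop :=
| Mesh (x : ZQ0) :
    @mesh_relation (tau (nonfrozen x)) (nonfrozen x)
      (mesh_relator k (nonfrozen x)).

Definition Rcat : lincat k := qcat mesh_relation.

Variable C : set ZQ0.

Variant killed_identity : forall u v : Rcat, hom u v -> Prop :=
| Killed (y : ZQ0) : ~ (sigma_inv @` C) (frozen y) ->
    @killed_identity (frozen y) (frozen y) (@idm k Rcat (frozen y)).

Definition RC : lincat k := qcat killed_identity.

Definition SC : lincat k := @fullsub k RC (sigma_inv @` C).

Definition RC_arrow (x y : vert ZQf) (a : arrow x y) : @hom k RC x y :=
  qclass killed_identity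
    (qclass mesh_relation (<< parrow a >> : @hom k (pathcat k ZQf) x y)).

(* injectivity, at each vertex z, of the maps RC(z, x) -> sum of the RC(z, y)
   over the arrows x -> y, and RC(x, z) -> sum of the RC(y, z) over the arrows
   y -> x *)
Definition admissible : Prop :=
  forall x : ZQ0,
    (forall (z : RC) (f : @hom k RC z (nonfrozen x)),
      (forall y (a : arrow (nonfrozen x) y), hcomp (RC_arrow a) f = 0) ->
      f = 0) /\
    (forall (z : RC) (f : @hom k RC (nonfrozen x) z),
      (forall y (a : arrow y (nonfrozen x)), hcomp f (RC_arrow a) = 0) ->
      f = 0).

Definition right_bounded (M : rmod SC) : Prop :=
  exists N : int, forall u : SC, (N <= (sval u).2)%R -> forall m : M u, m = 0.

Definition left_bounded (M : rmod SC) : Prop :=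
  exists N : int, forall u : SC, ((sval u).2 <= N)%R -> forall m : M u, m = 0.

End Nakajima.

(* Main.v *)
Require Import Defs.
From HB Require Import structures.
From mathcomp Require Import all_boot all_order all_algebra.
From mathcomp Require Import finmap boolp classical_sets monalg.
From mathcomp Require Import zify.
Import Defs.

(** Notation: R = R_C, S = S_C, D is the duality of vector spaces, and J_x is
    the restriction to S of the right R-module D R(x, ?). If u is an object of
    S, then J_u = D S(u, ?) is injective.

    Why (a) holds. Let x be a non frozen vertex. Dually to the mesh sequences
    of R (exact on the left by admissibility, and elsewhere because the mesh
    relators are the only relations that start or end at a non frozen vertex),
    the sequences
      0 -> J_(tau x) -> sum of the J_y over y -> x -> J_x -> 0
    are exact. The main point is that Ext^i(I, J_x) = 0 for all i >= 1. The
    long exact sequence, with induction on i, shows that the map from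
    Ext^i(I, J_(tau x)) to the sum of the Ext^i(I, J_y) is injective; for i = 1
    this needs that Hom(I, -) of the sequence is exact on the right, which
    follows from Hom(J_u, J_x) = R(u, x). So a nonzero class at a non frozen
    vertex has a nonzero image at some successor, hence along paths of non
    frozen vertices of any length. But Ext^i(I, J_v) = 0 for frozen v, and
    since Q is Dynkin, every long enough path of R is a sum of paths through
    frozen vertices. Therefore the class vanishes. This argument is
    frozen_induction; it gives dualR_full and dualR_acyclic.

    The simple S-module at v has the coresolution 0 -> S_v -> J_v -> J_x -> 0,
    where x is the target of the only arrow that starts at v; so
    Ext^p(I, S_v) = 0 for p >= 2. A right bounded module is the limit of its
    quotients M_n supported at the vertices of rank >= n, for a total order of
    the frozen vertices compatible with the arrows, and M_n differs from
    M_(n+1) by a finite sum of copies of one simple module. As the terms of the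
    resolution of I are projective, the homotopies can be chosen to be
    compatible, and they converge (vanish_step, vanish_bounded).

    Why (b) holds. The hypotheses on R are invariant under passing to the
    opposite category (op_mesh_cat). Since P is pointwise finite dimensional,
    P = D(DP), where DP is a finitely cogenerated injective left module, and
    Ext^p(M, D(DP)) and Ext^p(DP, DM) are both dual to Tor_p(M, DP)
    (ext_balance). So (b) is (a) for the opposite category.

    Why long paths are sums of paths through frozen vertices. Fix a non frozen
    vertex z and let F(w) be R(z, w) modulo the morphisms that factor through
    frozen vertices. Let the height of a vertex increase by 1 along each arrow;
    such a function exists because Q is a tree. The mesh relations make
      F(tau x) -> sum of the F(y) over y -> x -> F(x) -> 0
    exact for x <> z, so that F on the heights t + 1, t + 2 is obtained from F
    on the heights t, t + 1 by reflection functors. As long as these sequences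
    are exact on the left, the endomorphisms of F restricted to two consecutive
    heights remain scalars; if one of them fails to be exact on the left, then a
    simple direct summand splits off, hence F is this summand and dies at the
    next height (scalar_endomorphisms_step, stable_vanish_of_not_mono). If none
    fails, then the dimension of F is a nonnegative additive function on ZQ. A
    Dynkin diagram has positive weights v with 2 v_i >= the sum of the v_j over
    the neighbours j of i, strictly at some vertex; the weighted dimension of F
    is then a concave function of the height, so it is constant from some
    height on, and by strictness and connectedness it is 0
    (additive_eventually_zero). The bound depends only on the class of z modulo
    tau, because the additive function does. *)

Set Implicit Arguments.
Unset Strict Implicit.
Unset Printing Implicit Defensive.

Import GRing.Theory Num.Theory Order.TTheory.
Local Open Scope ring_scope.
Local Open Scope classical_set_scope.

(** * Duals and dimensions of vector spaces *)
Section Linear.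
Variable k : fieldType.
Implicit Types U V W : lmodType k.

Section OneMap.
Variables (U V : lmodType k) (f : U -> V).
Hypothesis fl : linear f.

Let fL : {linear U -> V} := HB.pack f (GRing.isLinear.Build k U V *:%R f fl).

Lemma lin0 : f 0 = 0. Proof. exact: (raddf0 fL). Qed.
Lemma linD u v : f (u + v) = f u + f v. Proof. exact: (raddfD fL). Qed.
Lemma linZ a u : f (a *: u) = a *: f u. Proof. exact: (linearZ_LR fL). Qed.
Lemma lin_sum I (r : seq I) P (F : I -> U) :
  f (\sum_(i <- r | P i) F i) = \sum_(i <- r | P i) f (F i).
Proof. exact: (linear_sum fL). Qed.

End OneMap.

Lemma add_lin U V (f g : U -> V) :
  linear f -> linear g -> linear (fun u => f u + g u).
Proof. by move=> fl gl a u v; rewrite fl gl scalerDr addrACA. Qed.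

Lemma scale_lin U V (c : k) (f : U -> V) : linear f -> linear (fun u => c *: f u).
Proof. by move=> fl a u v; rewrite fl scalerDr !scalerA mulrC. Qed.

Lemma sum_lin U V I (r : seq I) P (f : I -> U -> V) :
  (forall i, linear (f i)) -> linear (fun u => \sum_(i <- r | P i) f i u).
Proof.
move=> fl a u v; rewrite scaler_sumr -big_split /=.
by apply: eq_bigr => i _; rewrite fl.
Qed.

Definition mkdual V (f : V -> k^o) (fl : linear f) : dual V :=
  @Dual k V f (introT (asboolP _) fl).

Lemma dualE V (f g : dual V) : (forall v, f v = g v) -> f = g.
Proof. by move=> e; apply/val_inj/funext. Qed.

Lemma dual_addE V (f g : dual V) v : (f + g) v = f v + g v. Proof. by []. Qed.
Lemma dual_scaleE V a (f : dual V) v : (a *: f) v = a * f v. Proof. by []. Qed.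

Lemma dual_sumE V I (r : seq I) P (f : I -> dual V) v :
  (\sum_(i <- r | P i) f i) v = \sum_(i <- r | P i) f i v.
Proof. by elim/big_ind2: _ => [//|f1 x1 f2 x2 <- <-|]. Qed.

(** Exactness of duality. The spaces may be infinite dimensional, because so may
    be the terms of a projective resolution; hence Zorn's lemma, for the graphs
    of functionals that are defined on a subspace of V containing f(W). *)
Lemma dual_extend W V (f : W -> V) (l : dual W) : linear f ->
  (forall w, f w = 0 -> l w = 0) -> exists m : dual V, forall w, m (f w) = l w.
Proof.
move=> fl fl0.
pose base : set (V * k) := fun x => exists w, x = (f w, l w).
(* the empty graph is admitted, because the union of the empty chain is empty *)
pose P (G : set (V * k)) : Prop :=
  [/\ forall a p q, G p -> G q -> G (a *: p.1 + q.1, a * p.2 + q.2),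
      forall c, G (0, c) -> c = 0 & forall x, G x -> base `<=` G].
have Pbase : P base.
  split=> [a _ _ [w ->] [w' ->]|c [w [e ->]]|? _ ? //].
    by exists (a *: w + w'); rewrite fl dualP.
  exact/fl0/esym.
have [F FP Ftot|G [[Gl G0 Gb] Gmax]] := @Zorn_bigcup _ P.
  split=> [a p q [X FX Xp] [Y FY Yq]|c [X FX Xc]|x [X FX Xx] b bb].
  - have [XY|YX] := Ftot _ _ FX FY.
      by exists Y => //; have [Yl _ _] := FP _ FY; apply: Yl => //; apply: XY.
    by exists X => //; have [Xl _ _] := FP _ FX; apply: Xl => //; apply: YX.
  - by have [_ X0 _] := FP _ FX; apply: X0.
  - by exists X => //; have [_ _ Xb] := FP _ FX; apply: (Xb _ Xx).
have bG : base `<=` G.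
  apply: contrapT => nb; apply: (Gmax base) => //.
  have G_empty x : ~ G x by move=> /Gb.
  split=> [x /G_empty //|/(_ (f 0, l 0)) H]; apply: (G_empty (f 0, l 0)).
  by apply: H; exists 0.
have G00 : G (0, 0) by apply: bG; exists 0; rewrite (lin0 fl) (lin0 (dualP l)).
have Gtot v : exists c, G (v, c).
  apply: contrapT => nv.
  (* extension to the line of v by the value 0 *)
  pose B : set (V * k) := fun p => exists c x, G (x, p.2) /\ p.1 = x + c *: v.
  apply: (Gmax B).
    split=> [[x y] Gxy|BG]; first by exists 0, x; rewrite scale0r addr0.
    apply: nv; exists 0; apply: BG; exists 1, 0.
    by rewrite add0r scale1r.
  split=> [a [_ p] [_ q] [c [x [/= Gx ->]]] [c' [x' [/= Gx' ->]]]|c [c' [x [/= Gx e]]]|].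
  - exists (a * c + c'), (a *: x + x'); split; first exact: (Gl a (x, p) (x', q)).
    by rewrite /= scalerDr scalerDl scalerA addrACA.
  - have [c0|c0] := eqVneq c' 0.
      apply: G0; suff <- : x = 0 by [].
      by rewrite e c0 scale0r addr0.
    case: nv; exists (- c'^-1 * c + 0).
    have := Gl (- c'^-1) (x, c) (0, 0) Gx G00; congr (G (_, _)).
    move: (esym e); move/eqP; rewrite addr_eq0 => /eqP -> /=.
    by rewrite addr0 scalerN scaleNr opprK scalerA mulVf // scale1r.
  - move=> x _ b /bG; case: b => b1 b2 Gb2.
    by exists 0, b1; rewrite scale0r addr0.
have Guniq v c c' : G (v, c) -> G (v, c') -> c = c'.
  move=> Gc Gc'; apply/eqP; rewrite -subr_eq0; apply/eqP/G0.
  by have := Gl (-1) _ _ Gc' Gc; rewrite /= scaleN1r mulN1r addNr addrC.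
pose m v := projT1 (cid (Gtot v)).
have mG v : G (v, m v) by rewrite /m; case: cid.
have ml : linear (m : V -> k^o).
  by move=> a u v; apply: Guniq (mG _) _; apply: (Gl a _ _ (mG u) (mG v)).
exists (mkdual ml) => w; apply: Guniq (mG _) _; apply: bG; by exists w.
Qed.

Lemma dual_separates V (v : V) : (forall l : dual V, l v = 0) -> v = 0.
Proof.
move=> v0; apply: contrapT => /eqP nv.
have fl : linear (fun c : k^o => c *: v).
  by move=> a b c; rewrite scalerDl scalerA.
have il : linear (fun c : k^o => c) by [].
have f0 (w : k^o) : w *: v = 0 -> mkdual il w = 0.
  by move/eqP; rewrite scaler_eq0 (negPf nv) orbF => /eqP.
have [m /(_ 1)] := dual_extend fl f0.
by rewrite scale1r v0 /= => /esym/eqP; rewrite oner_eq0.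
Qed.

(** The index is an arbitrary finite type so that the coordinates of a product
    are indexed by a sigma type. *)
Definition has_coords V (T : finType) : Prop :=
  exists phi : V -> {ffun T -> k^o},
    [/\ linear phi, injective phi & forall c, exists v, phi v = c].

Definition spans V n (e : 'I_n -> V) : Prop :=
  forall v, exists c : 'I_n -> k, v = \sum_(i < n) c i *: e i.

(** A spanning family of minimal size is a basis. *)
Lemma finite_dim_coords V : finite_dim V -> exists n, has_coords V 'I_n.
Proof.
move=> Vfd.
have ex : exists n, `[< exists e : 'I_n -> V, spans e >].
  by case: Vfd => n [e he]; exists n; apply/asboolP; exists e.
case: (ex_minnP ex) => n /asboolP [e espan] nmin.
exists n.
have efree (c : 'I_n -> k) : \sum_(i < n) c i *: e i = 0 -> forall i, c i = 0.
  move=> c0 j; apply: contrapT => /eqP cj.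
  case: n e espan nmin c c0 j cj => [|n] e espan nmin c c0 j cj.
    by case: j cj => [[]].
  have := nmin n; rewrite ltnn => H; suff : false by []; apply: H; apply/asboolP.
  exists (fun i => e (lift j i)) => v; have [d ->] := espan v.
  exists (fun i => d (lift j i) - d j * (c j)^-1 * c (lift j i)).
  move: c0; rewrite !(bigD1_ord j) //= => /eqP; rewrite addr_eq0 => /eqP ej.
  have -> : e j = - ((c j)^-1 *: \sum_(i < n) c (lift j i) *: e (lift j i)).
    by rewrite -scalerN -ej scalerA mulVf // scale1r.
  rewrite scalerN scalerA scaler_sumr -sumrN -big_split /=.
  by apply: eq_bigr => i _; rewrite scalerBl scalerA addrC.
have cex v : exists c : {ffun 'I_n -> k^o}, v = \sum_(i < n) c i *: e i.
  have [c ->] := espan v; exists [ffun i => c i].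
  by apply: eq_bigr => i _; rewrite ffunE.
pose phi v := projT1 (cid (cex v)).
have phiE v : v = \sum_(i < n) phi v i *: e i by rewrite /phi; case: cid.
have uniq (c d : {ffun 'I_n -> k^o}) :
    \sum_(i < n) c i *: e i = \sum_(i < n) d i *: e i -> c = d.
  move=> cd; apply/ffunP => i; apply/eqP; rewrite -subr_eq0; apply/eqP.
  move: i; apply: efree.
  rewrite (eq_bigr (fun i => c i *: e i - d i *: e i)) => [|i _]; last exact: scalerBl.
  by rewrite sumrB cd subrr.
exists phi; split=> [a u v|u v uv|c].
- apply: uniq; rewrite -phiE {1}(phiE u) {1}(phiE v) scaler_sumr -big_split /=.
  by apply: eq_bigr => i _; rewrite !ffunE scalerDl scalerA.
- by rewrite (phiE u) (phiE v) uv.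
- by exists (\sum_(i < n) c i *: e i); apply: uniq; rewrite -phiE.
Qed.

Lemma coords_finite_dim V (T : finType) : has_coords V T -> finite_dim V.
Proof.
move=> [phi [pl pinj psurj]].
pose d (t : T) : {ffun T -> k^o} := [ffun s => (s == t)%:R].
pose e t := projT1 (cid (psurj (d t))).
have eE t : phi (e t) = d t by rewrite /e; case: cid.
exists #|T|, (fun i => e (enum_val i)) => v.
exists (fun i => phi v (enum_val i)).
apply: pinj; rewrite (lin_sum pl); apply/ffunP => s.
rewrite sum_ffunE (bigD1 (enum_rank s)) //= big1 => [|i ne]; last first.
  rewrite (linZ pl) eE !ffunE; case: eqP => [es|]; last by rewrite scaler0.
  by rewrite es enum_valK eqxx in ne.
by rewrite (linZ pl) eE !ffunE enum_rankK eqxx addr0; apply/esym/mulr1.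
Qed.

Lemma finite_dim_image U V (f : U -> V) : linear f ->
  (forall v, exists u, f u = v) -> finite_dim U -> finite_dim V.
Proof.
move=> fl fs [n [e he]]; exists n, (fun i => f (e i)) => v.
have [u <-] := fs v; have [c ->] := he u; exists c.
by rewrite (lin_sum fl); apply: eq_bigr => i _; rewrite (linZ fl).
Qed.

Lemma coords_prod (E : finType) (V : E -> lmodType k) (T : E -> finType) :
  (forall e, has_coords (V e) (T e)) ->
  has_coords (lprod V : lmodType k) {e : E & T e}.
Proof.
move=> h; pose phi e := projT1 (cid (h e)).
have phiP e : [/\ linear (phi e), injective (phi e) &
    forall c, exists v, phi e v = c] by rewrite /phi; case: cid.
exists (fun v => [ffun t => phi (tag t) (v (tag t)) (tagged t)]); split.
- move=> a u v; apply/ffunP => -[e t]; rewrite !ffunE /=.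
  by have [pl _ _] := phiP e; rewrite -[(a *: u + v) e]/(a *: u e + v e) pl !ffunE.
- move=> u v uv; apply: functional_extensionality_dep => e.
  have [_ pinj _] := phiP e; apply: pinj; apply/ffunP => t.
  by move/ffunP: uv => /(_ (Tagged T t)); rewrite !ffunE.
- move=> c; pose c' e : {ffun T e -> k^o} := [ffun t => c (Tagged T t)].
  have ex e : exists v, phi e v = c' e by have [_ _] := phiP e; apply.
  exists (fun e => projT1 (cid (ex e))); apply/ffunP => -[e t]; rewrite ffunE /=.
  by case: cid => v /= ->; rewrite ffunE.
Qed.

Lemma finite_dim_prod (E : finType) (V : E -> lmodType k) :
  (forall e, finite_dim (V e)) -> finite_dim (lprod V : lmodType k).
Proof.
move=> h; have h' e := finite_dim_coords (h e).
pose n e := projT1 (cid (h' e)).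
apply: (@coords_finite_dim _ {e : E & 'I_(n e)}); apply: coords_prod => e.
by rewrite /n; case: cid.
Qed.

(** Dimension is additive on short exact sequences. *)
Lemma exact_card U V W (T1 T2 T3 : finType) (i : U -> V) (p : V -> W) :
  has_coords U T1 -> has_coords V T2 -> has_coords W T3 ->
  linear i -> linear p -> injective i -> (forall w, exists v, p v = w) ->
  (forall v, p v = 0 <-> exists u, i u = v) -> #|T2| = (#|T1| + #|T3|)%N.
Proof.
move=> [a [al ainj asurj]] [b [bl binj bsurj]] [c [RC_class cinj csurj]] il pl iinj psurj ex.
pose a' x := projT1 (cid (asurj x)); have a'E x : a (a' x) = x by rewrite /a'; case: cid.
pose b' x := projT1 (cid (bsurj x)); have b'E x : b (b' x) = x by rewrite /b'; case: cid.
have a'l : linear a' by move=> r x y; apply: ainj; rewrite al !a'E.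
have b'l : linear b' by move=> r x y; apply: binj; rewrite bl !b'E.
have b'K x : b' (b x) = x by apply: binj; rewrite b'E.
pose If x := b (i (a' x)); pose Pf x := c (p (b' x)).
have Il : linear If by rewrite /If; move=> r x y; rewrite a'l il bl.
have Pl : linear Pf by rewrite /Pf; move=> r x y; rewrite b'l pl RC_class.
pose I : {linear {ffun T1 -> k^o} -> {ffun T2 -> k^o}} :=
  HB.pack If (GRing.isLinear.Build k _ _ *:%R If Il).
pose P : {linear {ffun T2 -> k^o} -> {ffun T3 -> k^o}} :=
  HB.pack Pf (GRing.isLinear.Build k _ _ *:%R Pf Pl).
have dT (T : finType) : \dim {: {ffun T -> k^o}} = #|T|.
  by rewrite dimvf /dim /= muln1.
have kI : lker (linfun I) = 0%VS.
  apply/eqP/lker0P => x y; rewrite !lfunE /= => /binj /iinj e.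
  by rewrite -(a'E x) -(a'E y) e.
have sP : limg (linfun P) = fullv.
  apply/vspaceP => y; rewrite memvf.
  have [w wE] := csurj y; have [v vE] := psurj w.
  have -> : y = linfun P (b v) by rewrite lfunE /= /Pf b'K vE.
  by apply: memv_img; rewrite memvf.
have kP : lker (linfun P) = limg (linfun I).
  apply/vspaceP => y; rewrite memv_ker lfunE /= /Pf; apply/eqP/memv_imgP.
    rewrite -[RHS](lin0 RC_class) => /cinj/ex [u uE]; exists (a u); first exact: memvf.
    apply: (etrans _ (esym (lfunE I _))); rewrite /= /If -(b'E y) -uE; congr (b (i _)).
    by apply: ainj; rewrite a'E.
  move=> [x _ ->]; rewrite (lfunE I) /= /If b'K.
  by rewrite (_ : p _ = 0) ?lin0 //; apply/ex; exists (a' x).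
have := limg_ker_dim (linfun P) fullv.
rewrite sP !dT capfv kP; have := limg_ker_dim (linfun I) fullv.
by rewrite kI capv0 dimv0 add0n dT => -> <-.
Qed.

Lemma coords0 V (T : finType) : has_coords V T -> #|T| = 0%N -> forall v : V, v = 0.
Proof.
move=> [phi [pl pinj _]] T0 v; apply: pinj; apply/ffunP => t.
by have := card0_eq T0 t.
Qed.

Lemma finite_dim_reflexive V (L : dual V -> k^o) : finite_dim V -> linear L ->
  exists v, forall l : dual V, L l = l v.
Proof.
move=> /finite_dim_coords [n [phi [pl pinj psurj]]] Ll.
have RC_class i : linear (fun v => phi v i : k^o) by move=> a u v; rewrite pl !ffunE.
pose d (i : 'I_n) : {ffun 'I_n -> k^o} := [ffun s => (s == i)%:R].
pose e i := projT1 (cid (psurj (d i))).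
have eE i : phi (e i) = d i by rewrite /e; case: cid.
have vE v : v = \sum_(i < n) phi v i *: e i.
  apply: pinj; apply/ffunP => s; rewrite (lin_sum pl) sum_ffunE (bigD1 s) //=.
  rewrite big1 => [|i ne]; last first.
    by rewrite (linZ pl) eE !ffunE eq_sym (negPf ne) scaler0.
  by rewrite (linZ pl) eE !ffunE eqxx addr0; apply/esym/mulr1.
exists (\sum_(i < n) (L (mkdual (RC_class i)) : k) *: e i) => l.
have -> : l = \sum_(i < n) (l (e i) : k) *: mkdual (RC_class i).
  apply: dualE => v; rewrite dual_sumE {1}(vE v) (lin_sum (dualP l)).
  by apply: eq_bigr => i _; rewrite (linZ (dualP l)) dual_scaleE /=; apply: mulrC.
rewrite (lin_sum Ll) dual_sumE; apply: eq_bigr => i _.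
rewrite (linZ Ll) dual_scaleE [X in _ = _ * X](lin_sum (RC_class i)) (bigD1 i) //=.
rewrite big1 => [|j ne]; first by rewrite (linZ pl) eE !ffunE eqxx addr0 [_ *: 1]mulr1.
by rewrite (linZ pl) eE !ffunE eq_sym (negPf ne) scaler0.
Qed.

Lemma finite_dim_dual V : finite_dim V -> finite_dim (dual V).
Proof.
move=> /finite_dim_coords [n [phi [pl pinj psurj]]].
have RC_class i : linear (fun v => phi v i : k^o) by move=> a u v; rewrite pl !ffunE.
pose d (i : 'I_n) : {ffun 'I_n -> k^o} := [ffun s => (s == i)%:R].
pose e i := projT1 (cid (psurj (d i))).
have eE i : phi (e i) = d i by rewrite /e; case: cid.
exists n, (fun i => mkdual (RC_class i)) => l; exists (fun i => l (e i)).
apply: dualE => v; rewrite dual_sumE.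
have {1}-> : v = \sum_(i < n) phi v i *: e i.
  apply: pinj; apply/ffunP => s; rewrite (lin_sum pl) sum_ffunE (bigD1 s) //=.
  rewrite big1 => [|i ne]; last first.
    by rewrite (linZ pl) eE !ffunE eq_sym (negPf ne) scaler0.
  by rewrite (linZ pl) eE !ffunE eqxx addr0; apply/esym/mulr1.
rewrite (lin_sum (dualP l)).
by apply: eq_bigr => i _; rewrite (linZ (dualP l)) dual_scaleE /=; apply: mulrC.
Qed.

Section Single.
Variables (E : finType) (V : E -> lmodType k).

(** The inclusion of the factor e into the product of the spaces V e'. *)
Definition lsingle (e : E) (v : V e) : lprod V :=
  fun e' => match @eqP E e e' with ReflectT E => eq_rect e V v e' E | _ => 0 end.

Lemma lsingle_eq e (v : V e) : lsingle v e = v.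
Proof. by rewrite /lsingle; case: eqP => // E'; rewrite (eq_axiomK E'). Qed.

Lemma lsingle_neq e e' (v : V e) : e != e' -> lsingle v e' = 0.
Proof. by rewrite /lsingle; case: eqP. Qed.

Lemma lsingle_linear e : linear (@lsingle e : V e -> (lprod V : lmodType k)).
Proof.
move=> a u v; apply: functional_extensionality_dep => e'.
change (lsingle (a *: u + v) e' = a *: lsingle u e' + lsingle v e').
have [<-|ne] := eqVneq e e'; first by rewrite !lsingle_eq.
by rewrite !lsingle_neq // scaler0 addr0.
Qed.

Lemma lprod_sumE I (r : seq I) P (F : I -> (lprod V : lmodType k)) e :
  (\sum_(i <- r | P i) F i) e = \sum_(i <- r | P i) F i e.
Proof. by elim/big_ind2: _ => [//|f1 x1 f2 x2 <- <-|]. Qed.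

Lemma lsingle_sum (v : lprod V) : v = \sum_e (lsingle (v e) : (lprod V : lmodType k)).
Proof.
apply: functional_extensionality_dep => e; rewrite lprod_sumE (bigD1 e) //=.
rewrite lsingle_eq big1 ?addr0 // => e' ne; exact: lsingle_neq.
Qed.

Lemma sum_lsingle (W : lmodType k) (F : forall e, V e -> W) e (v : V e) :
  (forall e, linear (F e)) -> \sum_e' F e' (lsingle v e') = F e v.
Proof.
move=> Fl; rewrite (bigD1 e) //= lsingle_eq big1 ?addr0 // => e' ne.
by rewrite lsingle_neq 1?eq_sym // (lin0 (Fl e')).
Qed.

End Single.
End Linear.

Arguments mfun {k A M N} _ u _.

(** * Modules over a linear category *)
Section Modules.
Variables (k : fieldType) (A : lincat k).
Implicit Types M N L P : rmod A.

Definition mzero M N : mhom M N.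
Proof.
refine (@Mhom k A M N (fun u x => 0) _ _) => [u a x y|u v h x].
  by rewrite scaler0 addr0.
by rewrite (lin0 (mact_linearr h)).
Defined.

Definition madd M N (f g : mhom M N) : mhom M N.
Proof.
refine (@Mhom k A M N (fun u x => f u x + g u x) _ _) => [u|u v h x].
  by apply: add_lin; apply: mfun_linear.
by rewrite !mfun_nat (linD (mact_linearr h)).
Defined.

Definition mscale M N (a : k) (f : mhom M N) : mhom M N.
Proof.
refine (@Mhom k A M N (fun u x => a *: f u x) _ _) => [u|u v h x].
  by apply: scale_lin; apply: mfun_linear.
by rewrite !mfun_nat (linZ (mact_linearr h)).
Defined.

Definition msub M N (f g : mhom M N) : mhom M N := madd f (mscale (-1) g).

Lemma msubE M N (f g : mhom M N) u x : msub f g u x = f u x - g u x.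
Proof. by rewrite /= scaleN1r. Qed.

Definition msum (E : finType) M N (f : E -> mhom M N) : mhom M N.
Proof.
refine (@Mhom k A M N (fun u x => \sum_e f e u x) _ _) => [u|u v h x].
  by apply: sum_lin => e; apply: mfun_linear.
rewrite (lin_sum (mact_linearr h)); apply: eq_bigr => e _; exact: mfun_nat.
Defined.

Section Product.
Variables (E : finType) (M : E -> rmod A).

Let pob (u : A) : lmodType k := lprod (fun e => M e u).
Let pact (u v : A) (f : hom u v) (m : pob v) : pob u := fun e => mact f (m e).

Definition mprod : rmod A.
Proof.
refine (@Rmod k A pob pact _ _ _ _) => [u v m a f g|u v f a m n|u m|u v w g f m];
  apply: functional_extensionality_dep => e.
- exact: mact_linearl.
- exact: mact_linearr.
- exact: mact1.
- exact: mactM.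
Defined.

Definition mproj e : mhom mprod (M e) :=
  @Mhom k A mprod (M e) (fun u x => x e) (fun u a x y => erefl) (fun u v f x => erefl).

Definition mtuple N (f : forall e, mhom N (M e)) : mhom N mprod.
Proof.
refine (@Mhom k A N mprod (fun u x e => f e u x) _ _) => [u a x y|u v h x];
  apply: functional_extensionality_dep => e.
- exact: mfun_linear.
- exact: mfun_nat.
Defined.

End Product.

Definition dsum_incl n (M : 'I_n -> rmod A) i : mhom (M i) (dsum M).
Proof.
refine (@Mhom k A (M i) (dsum M) (fun u x => lsingle x) _ _) => [u|u v f x].
  exact: lsingle_linear.
apply: functional_extensionality_dep => j; rewrite /= /dsum_act.
have [<-|ij] := eqVneq i j; first by rewrite !lsingle_eq.
by rewrite !lsingle_neq // (lin0 (mact_linearr f)).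
Defined.

Definition dsum_proj n (M : 'I_n -> rmod A) i : mhom (dsum M) (M i) :=
  @Mhom k A (dsum M) (M i) (fun u x => x i) (fun u a x y => erefl) (fun u v f x => erefl).

Definition dsum_tuple n (M : 'I_n -> rmod A) N (f : forall i, mhom N (M i)) :
  mhom N (dsum M).
Proof.
refine (@Mhom k A N (dsum M) (fun u x i => f i u x) _ _) => [u a x y|u v h x];
  apply: functional_extensionality_dep => i.
- exact: mfun_linear.
- exact: mfun_nat.
Defined.

Definition mker_lift M N L (f : mhom M N) (g : mhom L M)
  (fg : forall u x, f u (g u x) = 0) : mhom L (ker_mod f).
Proof.
refine (@Mhom k A L (ker_mod f) (fun u x => @Ker k A M N f u (g u x) (introT (asboolP _) (fg u x))) _ _)
  => [u a x y|u v h x]; apply: val_inj => /=.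
- exact: mfun_linear.
- exact: mfun_nat.
Defined.

(** The lifting property of P, used for M -> ker h, which is surjective. *)
Lemma projective_exact P M N L (g : mhom M N) (h : mhom N L) (f : mhom P N) :
  projective P -> (forall u x, h u (g u x) = 0) ->
  (forall u y, h u y = 0 -> exists x, g u x = y) ->
  (forall u p, h u (f u p) = 0) ->
  exists f' : mhom P M, forall u p, g u (f' u p) = f u p.
Proof.
move=> Pp hg ex hf.
have s : msurj (mker_lift hg).
  move=> u y; have [x xy] := ex _ _ (kerP y).
  by exists x; apply: val_inj.
have [f' f'E] := Pp _ _ (mker_lift hg) (mker_lift hf) s.
by exists f' => u p; have := congr1 (@ker_val k A N L h u) (f'E u p).
Qed.

Lemma projective_lift_sum P (E : finType) (M : E -> rmod A) N
    (q : forall e, mhom (M e) N) (f : mhom P N) :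
  projective P ->
  (forall u n, exists m : forall e, M e u, n = \sum_e q e u (m e)) ->
  exists f' : forall e, mhom P (M e), forall u x, f u x = \sum_e q e u (f' e u x).
Proof.
move=> Pp qs.
pose Q : mhom (mprod M) N := msum (fun e => mcomp (q e) (mproj M e)).
have Qs : msurj Q by move=> u n; have [m ->] := qs u n; exists m.
have [h hE] := Pp _ _ Q f Qs.
by exists (fun e => mcomp (mproj M e) h) => u x; rewrite -hE.
Qed.

(** A factorization through a jointly injective family may be constructed one
    element at a time: uniqueness makes it linear and natural. *)
Lemma mhom_factor_inj L M (E : finType) (N : E -> rmod A) (j : forall e, mhom M (N e))
    (f : forall e, mhom L (N e)) :
  (forall u m, (forall e, j e u m = 0) -> m = 0) ->
  (forall u x, exists m, forall e, j e u m = f e u x) ->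
  exists g : mhom L M, forall e u x, j e u (g u x) = f e u x.
Proof.
move=> jinj ex; pose g u x := projT1 (cid (ex u x)).
have gE e u x : j e u (g u x) = f e u x by rewrite /g; case: cid.
have uniq u m n : (forall e, j e u m = j e u n) -> m = n.
  move=> e; apply/eqP; rewrite -subr_eq0; apply/eqP/jinj => i.
  by rewrite (linB (mfun_linear (j i) (u:=u))) e subrr.
have gl u : linear (g u).
  by move=> a x y; apply: uniq => e; rewrite mfun_linear !gE mfun_linear.
have gn u v (h : hom u v) x : g u (mact h x) = mact h (g v x).
  by apply: uniq => e; rewrite mfun_nat !gE mfun_nat.
by exists (Mhom gl gn) => e u x; rewrite /= gE.
Qed.

Section Sub.
Variables (M : rmod A) (U : forall u, submodule (M u)).
Hypothesis Ustable : forall u v (f : hom u v) m, U v m -> U u (mact f m).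

Definition sub_pred (u : A) : {pred M u} := fun m => `[< U u m >].

Lemma sub_submod_closed (u : A) : submod_closed (@sub_pred u).
Proof.
split=> [|a x y /asboolP Ux /asboolP Uy]; apply/asboolP; first exact: smem0.
exact/smemD/Uy/smemZ.
Qed.
HB.instance Definition _ (u : A) :=
  GRing.isSubmodClosed.Build k (M u) (@sub_pred u) (sub_submod_closed u).

Record sub_ob (u : A) := Sub { sub_val :> M u; _ : sub_val \in @sub_pred u }.
HB.instance Definition _ (u : A) := [isSub for @sub_val u].
HB.instance Definition _ (u : A) := [Choice of sub_ob u by <:].
HB.instance Definition _ (u : A) := [SubChoice_isSubLmodule of sub_ob u by <:].

Lemma subP u (m : sub_ob u) : U u (sub_val m).
Proof. by case: m => m /= /asboolP. Qed.

Definition mksub u (m : M u) (Um : U u m) : sub_ob u := @Sub u m (introT (asboolP _) Um).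

Definition sub_mod : rmod A.
Proof.
refine (@Rmod k A (fun u => sub_ob u : lmodType k)
  (fun u v f m => mksub (Ustable f (subP m))) _ _ _ _)
  => [u v m a f g|u v f a m n|u m|u v w g f m]; apply: val_inj => /=.
- exact: mact_linearl.
- exact: mact_linearr.
- exact: mact1.
- exact: mactM.
Defined.

Definition sub_incl : mhom sub_mod M :=
  @Mhom k A sub_mod M (fun u m => sub_val m) (fun u a m n => erefl) (fun u v h m => erefl).

Definition sub_lift L (f : mhom L M) (fU : forall u x, U u (f u x)) : mhom L sub_mod.
Proof.
refine (@Mhom k A L sub_mod (fun u x => mksub (fU u x)) _ _)
  => [u a x y|u v h x]; apply: val_inj => /=.
- exact: mfun_linear.
- exact: mfun_nat.
Defined.

End Sub.
End Modules.

(** * Duality and the balance of Ext *)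
Section Op.
Variables (k : fieldType) (A : lincat k).

(** The proof fields are terms rather than opaque lemmas, so that taking the
    opposite category commutes by computation with taking a full subcategory. *)
Definition opcat : lincat k :=
  @Lincat k (ob A) (fun x y => hom y x) (fun x => idm x) (fun x y z g f => hcomp f g)
    (fun x y z f => @comp_linearr k A z y x f)
    (fun x y z g => @comp_linearl k A z y x g)
    (fun w x y z h g f => esym (compA f g h))
    (fun x y f => compm1 f) (fun x y f => comp1m f).

(** Left modules over A are right modules over opcat. *)
Definition ldual (B : rmod opcat) : rmod A.
Proof.
refine (@Rmod k A (fun v => dual (B v))
  (fun u v (h : hom u v) => dual_pre (@mact_linearr k opcat B v u h)) _ _ _ _)
  => [u v m a f g|u v f a m n|u m|u v w g f m]; apply: dualE => b /=.
- by rewrite (@mact_linearl k opcat) dualP.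
- by [].
- by rewrite (@mact1 k opcat).
- by rewrite (@mactM k opcat).
Defined.

Definition rdual (M : rmod A) : rmod opcat.
Proof.
refine (@Rmod k opcat (fun v => dual (M v))
  (fun u v (h : @hom k opcat u v) => dual_pre (@mact_linearr k A M v u h)) _ _ _ _)
  => [u v m a f g|u v f a m n|u m|u v w g f m]; apply: dualE => b /=.
- by rewrite mact_linearl dualP.
- by [].
- by rewrite mact1.
- by rewrite mactM.
Defined.

(** Hom(X, DB) and Hom(B, DX) are both the space of balanced bilinear forms on
    X and B; transpose_r and transpose_l are the two directions. *)
Lemma transpose_r_linear (X : rmod A) (B : rmod opcat) (f : mhom X (ldual B)) u (b : B u) :
  linear (fun x : X u => f u x b : k^o).
Proof. by move=> a x y; rewrite mfun_linear. Qed.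

Definition transpose_r (X : rmod A) (B : rmod opcat) (f : mhom X (ldual B)) : mhom B (rdual X).
Proof.
refine (@Mhom k opcat B (rdual X) (fun u b => mkdual (transpose_r_linear f b)) _ _)
  => [u a x y|u v h b]; apply: dualE => x' /=.
- exact: dualP.
- by rewrite mfun_nat.
Defined.

Lemma transpose_l_linear (X : rmod A) (B : rmod opcat) (f : mhom B (rdual X)) u (x : X u) :
  linear (fun b : B u => f u b x : k^o).
Proof. by move=> a b c; rewrite mfun_linear. Qed.

Definition transpose_l (X : rmod A) (B : rmod opcat) (f : mhom B (rdual X)) : mhom X (ldual B).
Proof.
refine (@Mhom k A X (ldual B) (fun u x => mkdual (transpose_l_linear f x)) _ _)
  => [u a x y|u v h x]; apply: dualE => b /=.
- exact: dualP.
- by have -> : f v (mact (h : @hom k opcat v u) b) = mact (h : @hom k opcat v u) (f u b)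
    by apply: (@mfun_nat k opcat).
Defined.

Definition ldual_map (B B' : rmod opcat) (d : mhom B B') : mhom (ldual B') (ldual B).
Proof.
refine (@Mhom k A (ldual B') (ldual B) (fun u => dual_pre (@mfun_linear _ _ _ _ d u)) _ _)
  => [u a x y|u v h x]; apply: dualE => b //=.
by rewrite (@mfun_nat k opcat).
Defined.

Definition rdual_map (M M' : rmod A) (d : mhom M M') : mhom (rdual M') (rdual M).
Proof.
refine (@Mhom k opcat (rdual M') (rdual M) (fun u => dual_pre (@mfun_linear _ _ _ _ d u)) _ _)
  => [u a x y|u v h x]; apply: dualE => b //=.
by rewrite (@mfun_nat k A).
Defined.

(** Bilinear forms on P and Y vanishing on the image of Y' come from Y'', since P
    is projective and duality is exact. *)
Lemma ldual_exact (P : rmod A) (Y' Y Y'' : rmod opcat) (d' : mhom Y' Y) (d : mhom Y Y'')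
    (c : mhom P (ldual Y)) : projective P ->
  (forall u y, d u y = 0 <-> exists y', d' u y' = y) ->
  (forall u x y', c u x (d' u y') = 0) ->
  exists c' : mhom P (ldual Y''), forall u x y, c u x y = c' u x (d u y).
Proof.
move=> Pp ex cd.
have [u l|u l l0|u x|c' c'E] := @projective_exact _ _ P _ _ _ (ldual_map d) (ldual_map d') c Pp.
- apply: dualE => y /=; suff -> : d u (d' u y) = 0 by apply: (lin0 (dualP l)).
  by apply/ex; exists y.
- have [y /ex [y' <-]|m mE] := @dual_extend _ _ _ (d u) l (@mfun_linear _ _ _ _ d u).
    by have := congr1 (fun g : dual _ => g y') l0.
  by exists m; apply: dualE => y /=.
- by apply: dualE => y /=.
by exists c' => u x y; rewrite -c'E.
Qed.

Lemma rdual_exact (P : rmod opcat) (X' X X'' : rmod A) (d' : mhom X' X) (d : mhom X X'')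
    (c : mhom P (rdual X)) : projective P ->
  (forall u y, d u y = 0 <-> exists y', d' u y' = y) ->
  (forall u x y', c u x (d' u y') = 0) ->
  exists c' : mhom P (rdual X''), forall u x y, c u x y = c' u x (d u y).
Proof.
move=> Pp ex cd.
have [u l|u l l0|u x|c' c'E] := @projective_exact _ _ P _ _ _ (rdual_map d) (rdual_map d') c Pp.
- apply: dualE => y /=; suff -> : d u (d' u y) = 0 by apply: (lin0 (dualP l)).
  by apply/ex; exists y.
- have [y /ex [y' <-]|m mE] := @dual_extend _ _ _ (d u) l (@mfun_linear _ _ _ _ d u).
    by have := congr1 (fun g : dual _ => g y') l0.
  by exists m; apply: dualE => y /=.
- by apply: dualE => y /=.
by exists c' => u x y; rewrite -c'E.
Qed.

Lemma rdual_injective (P : rmod A) : projective P -> injective_module (rdual P).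
Proof.
move=> Pp M N g f gi.
have s : msurj (ldual_map g).
  move=> u l; have [x gx|m mE] := @dual_extend _ _ _ (g u) l (@mfun_linear _ _ _ _ g u).
    suff -> : x = 0 by apply: (lin0 (dualP l)).
    by apply: gi; rewrite gx (lin0 (@mfun_linear _ _ _ _ g u)).
  by exists m; apply: dualE => y /=.
have [h hE] := Pp _ _ (ldual_map g) (transpose_l f) s.
exists (transpose_r h) => u x; apply: dualE => y.
exact: (congr1 (fun l : dual _ => l x) (hE u y)).
Qed.

End Op.

Section Augmented.
Variables (k : fieldType) (A : lincat k) (M : rmod A) (X : proj_resolution M).

(** The indices are shifted by one, so that the augmentation is a differential
    like the others. *)
Definition aterm (j : nat) : rmod A := if j is j'.+1 then pterm X j' else M.
Definition adiff (j : nat) : mhom (aterm j.+1) (aterm j) :=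
  match j with 0 => paug X | j'.+1 => pdiff X j' end.

Lemma aterm_proj j : projective (aterm j.+1). Proof. exact: pterm_proj. Qed.
Lemma aexact j u x : adiff j u x = 0 <-> exists y, adiff j.+1 u y = x.
Proof. by case: j x => [|j] x; [apply: pexact0|apply: pexact]. Qed.

End Augmented.

Section Balance.
Variables (k : fieldType) (A : lincat k) (M : rmod A) (B : rmod (opcat A)).
Variables (X : proj_resolution M) (Y : proj_resolution B).

(** Ext(M, DB) and Ext(B, DM) are both the cohomology of the double complex of
    bilinear forms on X_j and Y_l, whose rows and columns are exact except at
    the augmentations M and B. A form c of bidegree (j, l) which is killed by
    the composite of the two differentials should be a sum of a form that
    factors through the differential of X and of one that factors through the
    differential of Y. This property moves along the antidiagonal: for (0, l) it
    is the vanishing of Ext(B, DM), for (j, 0) that of Ext(M, DB). *)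
Let form j l := mhom (aterm X j) (ldual (aterm Y l)).

Let fromX j l : form j l -> Prop :=
  match j with
  | 0 => fun c => forall u x y, c u x y = 0
  | j'.+1 => fun c => exists a : form j' l, forall u x y, c u x y = a u (adiff X j' u x) y
  end.
Let fromY j l : form j l -> Prop :=
  match l with
  | 0 => fun c => forall u x y, c u x y = 0
  | l'.+1 => fun c => exists a : form j l', forall u x y, c u x y = a u x (adiff Y l' u y)
  end.

Let fromY_closed j l (c : form j.+1 l) :
  (forall u x y, c u x (adiff Y l u y) = 0) -> fromY c.
Proof.
case: l c => [|l] c c0.
  by move=> u x y; have [y' <-] := @paug_surj _ _ _ Y _ y; apply: c0.
exact: (ldual_exact (@aterm_proj _ _ _ X j) (@aexact _ _ _ Y l) c0).
Qed.

Let fromX_closed j l (c : form j l.+1) :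
  (forall u x y, c u (adiff X j u x) y = 0) -> fromX c.
Proof.
case: j c => [|j] c c0.
  by move=> u x y; have [x' <-] := @paug_surj _ _ _ X _ x; apply: c0.
have [|c' c'E] := @rdual_exact _ _ _ _ _ _ (adiff X j.+1) (adiff X j) (transpose_r c)
  (@aterm_proj _ _ _ Y l) (@aexact _ _ _ X j).
  by move=> u x y; apply: c0.
by exists (transpose_l c') => u x y; have := c'E u y x.
Qed.

Let splits j l := forall c : form j l,
  (forall u x y, c u (adiff X j u x) (adiff Y l u y) = 0) ->
  exists c1 c2 : form j l, [/\ forall u x y, c u x y = c1 u x y + c2 u x y,
    fromX c1 & fromY c2].

(** Form the restriction of c along Y_(l+1) -> Y_l; it vanishes on X_(j+2), so it
    comes from a form on X_j and Y_(l+1), to which the hypothesis applies. *)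
Let splits_step j l : splits j l.+1 -> splits j.+1 l.
Proof.
move=> H c c0.
pose cd : form j.+1 l.+1 := mcomp (ldual_map (adiff Y l)) c.
have [|a aE] := @fromX_closed _ _ cd; first by move=> u x y; apply: c0.
have [u x y|c1 [c2 [aE' c1X [b c2Y]]]] := H a.
  rewrite -aE /= (_ : adiff Y l u _ = 0) ?(lin0 (dualP _)) //.
  by apply/aexact; exists y.
pose bd : form j.+1 l := mcomp b (adiff X j).
exists bd, (msub c bd); split.
- by move=> u x y; rewrite msubE -[X in _ + X]/(c u x y - bd u x y) addrC subrK.
- by exists b.
apply: fromY_closed => u x y; rewrite msubE.
rewrite -[LHS]/(c u x (adiff Y l u y) - b u (adiff X j u x) (adiff Y l u y)).
rewrite -c2Y; have := aE u x y; rewrite [LHS]/= => ->; rewrite aE'.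
suff -> : c1 u (adiff X j u x) y = 0 by rewrite add0r subrr.
case: (j) c1 c1X {aE' aE bd b c2Y c2 a cd c c0 H} x => [|j'] c1 c1X x; first exact: c1X.
have [b bE] := c1X; rewrite bE (_ : adiff X j' u _ = 0).
  by rewrite (lin0 (mfun_linear b (u:=u))).
by apply/aexact; exists x.
Qed.

(** Both groups are dual to Tor_(n+1)(M, B). *)
Lemma ext_balance n :
  (forall f : mhom (pterm Y n.+1) (rdual M), cocycle f -> coboundary f) ->
  forall f : mhom (pterm X n.+1) (ldual B), cocycle f -> coboundary f.
Proof.
move=> H.
have H0 : splits 0 n.+2.
  move=> c c0; have [|b bE] := H (transpose_r c).
    move=> u y; apply: dualE => x /=; have [x' <-] := @paug_surj _ _ _ X _ x.
    exact: c0.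
  exists (mzero _ _), c; split=> [u x y||]; first by rewrite add0r.
    by [].
  by exists (transpose_l b) => u x y; have := congr1 (fun f : dual _ => f x) (bE u y).
have Hj j l : (j + l = n.+2)%N -> splits j l.
  elim: j l => [|j IH] l; first by rewrite add0n => ->.
  by rewrite addSnnS => /IH/splits_step.
move=> f f0; have [||c1 [c2 [fE [a aE] c20]]] := Hj n.+2 0%N _ f.
- by rewrite addn0.
- by move=> u x y; rewrite [f u _](f0 u x).
by exists a => u x; apply: dualE => y; rewrite fE c20 addr0 aE.
Qed.

End Balance.

(** * Mesh categories *)
Section CompSums.
Variables (k : fieldType) (A : lincat k).

Lemma comp0m (x y z : A) (f : hom x y) : hcomp (0 : hom y z) f = 0.
Proof. exact: (lin0 (comp_linearl f)). Qed.
Lemma compm0 (x y z : A) (g : hom y z) : hcomp g (0 : hom x y) = 0.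
Proof. exact: (lin0 (comp_linearr g)). Qed.
Lemma comp_suml (x y z : A) I (r : seq I) P (g : I -> hom y z) (f : hom x y) :
  hcomp (\sum_(i <- r | P i) g i) f = \sum_(i <- r | P i) hcomp (g i) f.
Proof. exact: (lin_sum (comp_linearl f)). Qed.
Lemma comp_sumr (x y z : A) I (r : seq I) P (g : hom y z) (f : I -> hom x y) :
  hcomp g (\sum_(i <- r | P i) f i) = \sum_(i <- r | P i) hcomp g (f i).
Proof. exact: (lin_sum (comp_linearr g)). Qed.

Lemma sum_comp_linear (E : finType) (x z : A) (y : E -> A) (f : forall e, hom x (y e)) :
  linear (fun g : (lprod (fun e => hom (y e) z) : lmodType k) => \sum_e hcomp (g e) (f e)).
Proof.
move=> a g h; rewrite scaler_sumr -big_split /=; apply: eq_bigr => e _.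
exact: comp_linearl.
Qed.

Variable U : set A.

(** The ideal of the morphisms that factor through objects of U. *)
Inductive through (x : A) : forall y : A, hom x y -> Prop :=
| through0 y : through (0 : hom x y)
| throughD y (f g : hom x y) : through f -> through g -> through (f + g)
| through_comp v y (g : hom v y) (f : hom x v) : U v -> through (hcomp g f).

End CompSums.

(** R_C together with its meshes lft m -> mid e -> rgt m, where e runs through
    midx m; the objects lft m are the non frozen vertices, and so are the
    objects rgt m. The alive objects are the frozen vertices that are not
    killed, that is, the objects of S_C. The function rank orders them totally.
    This structure is used instead of R_C itself because it is self-dual. *)
Record mesh_data (k : fieldType) := MeshData {
  mcat :> lincat k;
  alive : set mcat;
  mesh : Type;
  lft : mesh -> mcat;
  rgt : mesh -> mcat;
  midx : mesh -> finType;
  mid : forall m, midx m -> mcat;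
  mb : forall m (e : midx m), hom (lft m) (mid e);
  ma : forall m (e : midx m), hom (mid e) (rgt m);
  height : mcat -> int;
  rank : mcat -> int }.

Arguments mid {k m0 m} _ : rename.
Arguments mb {k m0 m} _ : rename.
Arguments ma {k m0 m} _ : rename.

Definition op_data k (D : mesh_data k) : mesh_data k :=
  @MeshData k (opcat D) (@alive k D) (mesh D) (@rgt k D) (@lft k D) (@midx k D)
    (fun m e => mid e) (fun m e => ma e) (fun m e => mb e)
    (fun x => - height x) (fun x => - rank x).

(** One half of the hypotheses; the other half is mesh_left of op_data. The first
    three fields say that
      0 -> R(w, lft m) -> sum of the R(w, mid e) -> R(w, rgt m)
    is exact, and exact on the right unless w = rgt m. By ml_frozen, an alive
    object has a single outgoing arrow c, which is subject to no relation. *)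
Record mesh_left k (D : mesh_data k) : Prop := {
  ml_inj : forall (m : mesh D) w (f : hom w (lft m)),
    (forall e : midx m, hcomp (mb e) f = 0) -> f = 0;
  ml_mid : forall (m : mesh D) w (f : forall e : midx m, hom w (mid e)),
    \sum_e hcomp (ma e) (f e) = 0 -> exists g, forall e, f e = hcomp (mb e) g;
  ml_surj : forall (m : mesh D) w (f : hom w (rgt m)), w <> rgt m ->
    exists f' : forall e : midx m, hom w (mid e), f = \sum_e hcomp (ma e) (f' e);
  ml_ob : forall y : D, [\/ alive y, idm y = 0 | exists m, y = lft m];
  ml_frozen : forall v : D, alive v -> exists (m : mesh D) (c : hom v (rgt m)),
    [/\ forall w (g : hom (rgt m) w), hcomp g c = 0 -> g = 0,
        forall w (f : hom v w), w <> v -> exists g, f = hcomp g c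
      & forall g : hom (rgt m) v, g = 0];
  ml_alive : forall m : mesh D, ~ alive (lft m);
  ml_ht : forall (m : mesh D) (e : midx m), (height (lft m) < height (mid e))%R }.

Record mesh_cat k (D : mesh_data k) : Prop := {
  mc_left : mesh_left D;
  mc_right : mesh_left (op_data D);
  mc_mesh : forall m : mesh D, \sum_(e : midx m) hcomp (ma e) (mb e) = 0;
  mc_fd : forall x y : D, finite_dim (hom x y);
  mc_end : forall (v : D) (f : hom v v), alive v -> exists a : k, f = a *: idm v;
  mc_rank_inj : forall u v : D, alive u -> alive v -> rank u = rank v -> u = v;
  mc_rank : forall (u v : D) (f : hom u v), alive u -> alive v ->
    (rank v < rank u)%R -> f = 0;
  mc_nilpotent : exists N : nat, forall (z w : D) (f : hom z w),
    (height z + N%:Z <= height w)%R -> through (@alive k D) f }.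

Lemma through_op k (A : lincat k) (U : set A) (x y : A) (f : hom x y) :
  through U f -> @through k (opcat A) U y x f.
Proof.
elim=> [y'|y' g h _ IHg _ IHh|v y' g h Uv].
- exact: through0.
- exact: throughD.
- exact: (@through_comp k (opcat A)).
Qed.

Lemma op_mesh_cat k (D : mesh_data k) : mesh_cat D -> mesh_cat (op_data D).
Proof.
move=> H; split.
- exact: mc_right.
- case: (mc_left H) => *; split=> // m e; rewrite /=.
  by rewrite !opprK.
- exact: (mc_mesh H).
- by move=> x y; apply: (mc_fd H).
- by move=> v f; apply: (mc_end H).
- by move=> u v uA vA /= /oppr_inj; apply: (mc_rank_inj H).
- by move=> u v f uA vA /=; rewrite ltrN2; apply: (mc_rank H).
- have [N NP] := mc_nilpotent H; exists N => z w f /= hN.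
  by apply/through_op/NP; move: hN; lia.
Qed.

Section MeshCategory.
Variables (k : fieldType) (D : mesh_data k).
Hypothesis H : mesh_cat D.

Let L := mc_left H.
Let R := mc_right H.

Lemma mr_inj (m : mesh D) w (g : hom (rgt m) w) :
  (forall e : midx m, hcomp g (ma e) = 0) -> g = 0.
Proof. exact: (ml_inj R). Qed.
Lemma mr_mid (m : mesh D) w (g : forall e : midx m, hom (mid e) w) :
  \sum_e hcomp (g e) (mb e) = 0 -> exists h, forall e, g e = hcomp h (ma e).
Proof. exact: (@ml_mid _ _ R m w g). Qed.
Lemma mr_surj (m : mesh D) w (g : hom (lft m) w) : w <> lft m ->
  exists g' : forall e : midx m, hom (mid e) w, g = \sum_e hcomp (g' e) (mb e).
Proof. exact: (@ml_surj _ _ R m w g). Qed.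
Lemma mr_alive (m : mesh D) : ~ alive (rgt m).
Proof. exact: (@ml_alive _ _ R m). Qed.

(** The use of the Dynkin hypothesis: a property of the morphisms starting at z
    that holds at the frozen vertices and is detected on the successors of each
    non frozen vertex holds everywhere. Indeed it holds for all morphisms to
    vertices of large height, since these factor through frozen vertices, and
    then by descending induction on the height. *)
Lemma frozen_induction (z : D) (Pr : forall x, hom z x -> Prop) :
  (forall x, Pr x 0) ->
  (forall x f g, Pr x f -> Pr x g -> Pr x (f + g)) ->
  (forall x y (g : hom x y) f, Pr x f -> Pr y (hcomp g f)) ->
  (forall x f, alive x -> Pr x f) ->
  (forall (m : mesh D) (f : hom z (lft m)),
    (forall e : midx m, Pr _ (hcomp (mb e) f)) -> Pr _ f) ->
  forall x f, Pr x f.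
Proof.
move=> P0 PD Pc Pa Pm; have [N NP] := mc_nilpotent H.
have T x f : through (@alive k D) f -> Pr x f.
  by elim=> [y|y g h _ Pg _ Ph|v y g h Uv]; [apply: P0|apply: PD|apply/Pc/Pa].
have S (n : nat) x f : (height z + N%:Z <= height x + n%:Z)%R -> Pr x f.
  elim: n x f => [|n IH] x f hx; first by apply/T/NP; move: hx; lia.
  have [xA|x0|[m xm]] := ml_ob L x; first exact: Pa.
    by rewrite -[f]comp1m x0 comp0m; apply: P0.
  move: xm f hx => -> f hx; apply: Pm => e; apply: IH.
  by have := ml_ht L e; move: hx; lia.
move=> x f; apply: (S (absz (height z + N%:Z - height x)%R) x f); lia.
Qed.

(** * The modules dual to R(x, ?) *)

Local Notation S := (@fullsub k D (@alive k D)).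

(** The module J_x; it is defined for all objects x of R, not only for those
    of S. *)
Definition dualR (x : D) : rmod S.
Proof.
refine (@Rmod k S (fun v => dual (hom x (sval v)))
  (fun u v h => dual_pre (@comp_linearr k D x (sval u) (sval v) h)) _ _ _ _)
  => [u v m a f g|u v f a m n|u m|u v w g f m]; apply: dualE => b /=.
- by rewrite comp_linearl dualP.
- by [].
- by rewrite comp1m.
- by rewrite compA.
Defined.

Definition dualR_map (x y : D) (f : hom x y) : mhom (dualR x) (dualR y).
Proof.
refine (@Mhom k S (dualR x) (dualR y)
   (fun v => dual_pre (@comp_linearl k D x y (sval v) f)) _ _)
  => [u a m n|u v h m]; apply: dualE => b //=.
by rewrite compA.
Defined.

Lemma dualR_mapE (x y : D) (f : hom x y) v l g : dualR_map f v l g = l (hcomp g f).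
Proof. by []. Qed.

Lemma dualR_mapM (x y z : D) (g : hom y z) (f : hom x y) v l :
  dualR_map (hcomp g f) v l = dualR_map g v (dualR_map f v l).
Proof. by apply: dualE => h; rewrite !dualR_mapE compA. Qed.

Lemma dualR_map_sum (x y : D) (E : finType) (f : E -> hom x y) v l :
  dualR_map (\sum_e f e) v l = \sum_e dualR_map (f e) v l.
Proof.
by apply: dualE => g; rewrite dual_sumE dualR_mapE comp_sumr (lin_sum (dualP l)).
Qed.

Lemma dualR_map0 (x y : D) v l : dualR_map (0 : hom x y) v l = 0.
Proof. by apply: dualE => g; rewrite dualR_mapE compm0 (lin0 (dualP l)). Qed.

Lemma dualR_mapD (x y : D) (f g : hom x y) v l : dualR_map (f + g) v l = dualR_map f v l + dualR_map g v l.
Proof.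
by apply: dualE => h; rewrite dual_addE !dualR_mapE (linD (comp_linearr h)) (linD (dualP l)).
Qed.

Lemma alive_neq_lft (w : S) m : sval w <> lft m.
Proof. by move=> e; apply: (ml_alive L (m := m)); rewrite -e; apply: (svalP w). Qed.
Lemma alive_neq_rgt (w : S) m : sval w <> rgt m.
Proof. by move=> e; apply: (mr_alive (m := m)); rewrite -e; apply: (svalP w). Qed.

(** This lemma and the next two: the sequence
    0 -> J_(lft m) -> sum of the J_(mid e) -> J_(rgt m) -> 0 is exact. The
    sequences R(rgt m, w) -> sum of the R(mid e, w) -> R(lft m, w) are exact on
    both sides for w alive, as such w differs from lft m. *)
Lemma dualR_mesh_inj (m : mesh D) (w : S) (l : dualR (lft m) w) :
  (forall e : midx m, dualR_map (mb e) w l = 0) -> l = 0.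
Proof.
move=> l0; apply: dualE => g.
have [g' ->] := mr_surj g (@alive_neq_lft w m).
rewrite (lin_sum (dualP l)) big1 // => e _.
by rewrite -[l _]/(dualR_map (mb e) w l (g' e)) l0.
Qed.

Lemma dualR_mesh_exact (m : mesh D) (w : S) (l : forall e : midx m, dualR (mid e) w) :
  \sum_e dualR_map (ma e) w (l e) = 0 -> exists l', forall e, l e = dualR_map (mb e) w l'.
Proof.
move=> l0; pose W : lmodType k := lprod (fun e : midx m => hom (mid e) (sval w)).
pose f (g : W) := \sum_e hcomp (g e) (mb e).
have fl : linear f by apply: sum_comp_linear.
pose l1 (g : W) : k^o := \sum_e l e (g e).
have l1l : linear l1.
  move=> a x y; rewrite /l1 scaler_sumr -big_split /=; apply: eq_bigr => e _.
  exact: dualP.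
have [g /mr_mid [h gh]|l' l'E] := @dual_extend _ _ _ f (mkdual l1l) fl.
  have e0 := congr1 (fun x : dual _ => x h) l0; apply: (etrans _ e0).
  by rewrite dual_sumE; apply: eq_bigr => e _; rewrite gh.
exists l' => e; apply: dualE => g; rewrite dualR_mapE.
have := l'E (lsingle g : W); rewrite /f /= /l1.
rewrite (sum_lsingle (F := fun e' g => hcomp g (mb e'))); last by move=> ?; apply: comp_linearl.
by rewrite (sum_lsingle (F := fun e' g => l e' g)) // => ?; apply: dualP.
Qed.

Lemma dualR_mesh_surj (m : mesh D) (w : S) (l : dualR (rgt m) w) :
  exists l' : forall e : midx m, dualR (mid e) w, l = \sum_e dualR_map (ma e) w (l' e).
Proof.
pose W : lmodType k := lprod (fun e : midx m => hom (mid e) (sval w)).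
pose f (g : hom (rgt m) (sval w)) : W := fun e => hcomp g (ma e).
have fl : linear f.
  move=> a x y; apply: functional_extensionality_dep => e; exact: comp_linearl.
have [g fg|M ME] := @dual_extend _ _ _ f l fl.
  rewrite (_ : g = 0) ?(lin0 (dualP l)) //; apply: mr_inj => e.
  by have := congr1 (fun x : W => x e) fg.
have Ml e : linear (fun g : hom (mid e) (sval w) => M (lsingle g) : k^o).
  by move=> a x y; rewrite lsingle_linear dualP.
exists (fun e => mkdual (Ml e)); apply: dualE => g.
rewrite dual_sumE -ME {1}(lsingle_sum (f g)) (lin_sum (dualP M)).
by apply: eq_bigr.
Qed.

(** The functor x |-> J_x is faithful on Hom(u, x) for u in S: a morphism h
    which becomes 0 after composition with all morphisms to alive vertices
    is 0. *)
Lemma dualR_faithful (u : S) (x : D) (h : hom (sval u) x) :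
  (forall w l, dualR_map h w l = 0) -> h = 0.
Proof.
move=> h0.
have z (w : D) (g : hom x w) : alive w -> hcomp g h = 0.
  move=> wA; apply: dual_separates => l.
  exact: (congr1 (fun l : dual _ => l g) (h0 (exist _ w wA) l)).
rewrite -[h]comp1m; move: (idm x).
have := @frozen_induction x (fun y f => hcomp f h = 0); apply.
- by move=> y; apply: comp0m.
- by move=> y f g fh gh; rewrite (linD (comp_linearl h)) fh gh addr0.
- by move=> y y' g f fh; rewrite -compA fh compm0.
- by move=> y f; apply: z.
- by move=> m f fm; apply: (ml_inj L) => e; rewrite compA.
Qed.

Lemma dualR_full_alive (u v : S) (phi : mhom (dualR (sval u)) (dualR (sval v))) :
  exists h : hom (sval u) (sval v), forall w l, phi w l = dualR_map h w l.
Proof.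
pose L1 (l : dualR (sval u) v) : k^o := phi v l (idm (sval v)).
have L1l : linear L1 by move=> a x y; rewrite /L1 mfun_linear.
have [h hE] := finite_dim_reflexive (mc_fd H _ _) L1l.
exists h => w l; apply: dualE => g; rewrite dualR_mapE.
pose g' : @hom k S v w := g.
have -> : l (hcomp g h) = (mact g' l : dualR (sval u) v) h by [].
rewrite -hE /L1 mfun_nat /=.
by rewrite compm1.
Qed.

(** Hom(J_u, J_x) = R(u, x). For alive x this is the Yoneda lemma and the
    reflexivity of R(u, x). In general, apply frozen_induction to the morphisms
    f out of x such that J_f o phi is induced by a morphism of R: if all the
    composites with the arrows lft m -> mid e are induced by some h e, then
    the sum of the ma e o h e is 0 by faithfulness, so that the h e come from a
    common morphism to lft m. *)
Lemma dualR_full (u : S) (x : D) (phi : mhom (dualR (sval u)) (dualR x)) :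
  exists h : hom (sval u) x, forall w l, phi w l = dualR_map h w l.
Proof.
suff P y (f : hom x y) :
    exists h : hom (sval u) y, forall w l, dualR_map f w (phi w l) = dualR_map h w l.
  have [h hE] := P x (idm x); exists h => w l; rewrite -hE.
  by apply: dualE => g; rewrite dualR_mapE compm1.
move: y f; apply: frozen_induction => [y|y f g [h1 h1E] [h2 h2E]|y y' g f [h hE]|y f yA|m f fm].
- by exists 0 => w l; rewrite !dualR_map0.
- by exists (h1 + h2) => w l; rewrite !dualR_mapD h1E h2E.
- by exists (hcomp g h) => w l; rewrite !dualR_mapM hE.
- exact: (dualR_full_alive (v := exist _ y yA) (mcomp (dualR_map f) phi)).
pose h e := projT1 (cid (fm e)).
have hE e w l : dualR_map (hcomp (mb e) f) w (phi w l) = dualR_map (h e) w l.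
  by rewrite /h; case: cid.
have h0 : \sum_e hcomp (ma e) (h e) = 0.
  apply: dualR_faithful => w l; rewrite dualR_map_sum.
  under eq_bigr => e _ do rewrite dualR_mapM -hE -dualR_mapM compA dualR_mapM.
  by rewrite -dualR_map_sum mc_mesh // dualR_map0.
have [g gE] := ml_mid L h0; exists g => w l; apply/eqP; rewrite -subr_eq0; apply/eqP.
apply: dualR_mesh_inj => e; rewrite (linB (mfun_linear (dualR_map (mb e)) (u:=w))).
by rewrite -!dualR_mapM hE gE subrr.
Qed.

(** The morphism N -> D S(v, ?) which corresponds to a functional on N(v). *)
Lemma coind_linear (N : rmod S) (v : S) (l : dual (N v)) u (x : N u) :
  linear (fun h : hom (sval v) (sval u) => l (mact (h : @hom k S v u) x) : k^o).
Proof. by move=> a h h'; rewrite (@mact_linearl k S) dualP. Qed.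

Definition coind (N : rmod S) (v : S) (l : dual (N v)) : mhom N (dualR (sval v)).
Proof.
refine (@Mhom k S N (dualR (sval v)) (fun u x => mkdual (coind_linear l x)) _ _)
  => [u a x y|u w f x]; apply: dualE => h /=.
- by rewrite mact_linearr dualP.
- by rewrite -mactM.
Defined.

(** Coinduction: Hom(N, J_v) is the dual of N(v), naturally in N, and duality of
    vector spaces is exact. *)
Lemma dualR_alive_injective (v : S) (X' X X'' : rmod S) (d' : mhom X' X) (d : mhom X X'')
    (c : mhom X (dualR (sval v))) :
  (forall u y, d u y = 0 <-> exists y', d' u y' = y) ->
  (forall u x, c u (d' u x) = 0) ->
  exists g : mhom X'' (dualR (sval v)), forall u x, c u x = g u (d u x).
Proof.
move=> ex cd.
have ll : linear (fun x : X v => c v x (idm (sval v)) : k^o).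
  by move=> a x y; rewrite mfun_linear.
have [x /ex [y <-]|l lE] := @dual_extend _ _ _ (d v) (mkdual ll) (@mfun_linear _ _ _ _ d v).
  by rewrite /= cd.
exists (coind l) => u x; apply: dualE => h /=.
rewrite -mfun_nat lE /= mfun_nat /=.
by rewrite compm1.
Qed.

(** Hom(Z, -) preserves the surjectivity of the sum of the J_(mid e) -> J_(rgt m).
    This holds for projective Z, but also for finitely cogenerated injective Z,
    and therefore for all terms of the augmented complex of a resolution of such
    a module. *)
Definition mesh_lifts (Z : rmod S) := forall (m : mesh D) (f : mhom Z (dualR (rgt m))),
  exists f' : forall e : midx m, mhom Z (dualR (mid e)),
    forall u x, f u x = \sum_e dualR_map (ma e) u (f' e u x).

Lemma projective_mesh_lifts Z : projective Z -> mesh_lifts Z.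
Proof. by move=> Zp m f; apply: projective_lift_sum => // u n; apply: dualR_mesh_surj. Qed.

Definition corep_to_dualR (u : S) : mhom (corep u) (dualR (sval u)) :=
  @Mhom k S (corep u) (dualR (sval u)) (fun v x => x) (fun v a x y => erefl)
    (fun v w f x => erefl).
Definition dualR_to_corep (u : S) : mhom (dualR (sval u)) (corep u) :=
  @Mhom k S (dualR (sval u)) (corep u) (fun v x => x) (fun v a x y => erefl)
    (fun v w f x => erefl).

(** I is a retract of a finite sum of modules J_u, and for these the lifting
    amounts to the surjectivity of the sum of the R(u, mid e) -> R(u, rgt m). *)
Lemma cogenerated_mesh_lifts (I : rmod S) :
  finitely_cogenerated I -> injective_module I -> mesh_lifts I.
Proof.
move=> [n [u [s sinj]]] Iinj m phi.
pose idI : mhom I I := @Mhom k S I I (fun u x => x) (fun u a x y => erefl)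
  (fun u v f x => erefl).
have [r rs] := Iinj _ _ s idI sinj.
pose psi i : mhom (dualR (sval (u i))) (dualR (rgt m)) :=
  mcomp phi (mcomp r (mcomp (dsum_incl _ i) (dualR_to_corep (u i)))).
pose h i := projT1 (cid (dualR_full (psi i))).
have hE i w l : psi i w l = dualR_map (h i) w l by rewrite /h; case: cid.
pose h' i := projT1 (cid (ml_surj L (h i) (@alive_neq_rgt (u i) m))).
have h'E i : h i = \sum_e hcomp (ma e) (h' i e) by rewrite /h'; case: cid.
exists (fun e => msum (fun i => mcomp (dualR_map (h' i e))
  (mcomp (corep_to_dualR (u i)) (mcomp (dsum_proj (fun i => corep (u i)) i) s)))) => w x.
rewrite -[x in LHS]/(idI w x) -rs.
rewrite [s w x in LHS](lsingle_sum (s w x)).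
rewrite (lin_sum (mfun_linear r (u:=w))) (lin_sum (mfun_linear phi (u:=w))).
transitivity (\sum_(e : midx m) \sum_i dualR_map (ma e) w (dualR_map (h' i e) w (s w x i)));
  last first.
  by apply: eq_bigr => e _; rewrite [RHS](lin_sum (mfun_linear (dualR_map (ma e)) (u:=w))).
rewrite exchange_big /=; apply: eq_bigr => i _.
rewrite -[LHS]/(psi i w (s w x i)) hE h'E dualR_map_sum.
by apply: eq_bigr => e _; rewrite dualR_mapM.
Qed.

End MeshCategory.

(** * Vanishing of Ext *)
Lemma sval_inj T (P : T -> Prop) (x y : {x | P x}) : sval x = sval y -> x = y.
Proof. by case: x y => x px [y py] /= e; apply: eq_exist. Qed.

Section ExtVanishing.
Variables (k : fieldType) (D : mesh_data k).
Hypothesis H : mesh_cat D.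
Local Notation S := (@fullsub k D (@alive k D)).

Section Resolution.
Variables (I : rmod S) (X : proj_resolution I).
Hypothesis Ilift : mesh_lifts I.
Local Notation X' := (aterm X).
Local Notation d := (adiff X).

Lemma aterm_mesh_lifts i : mesh_lifts (X' i).
Proof. by case: i => // i; apply/projective_mesh_lifts/pterm_proj. Qed.

Lemma adiff_adiff i u x : d i u (d i.+1 u x) = 0.
Proof. by apply/aexact; exists x. Qed.

(** Left exactness of Hom(-, N). *)
Lemma augmentation_factor N (c : mhom (X' 1) N) : (forall u x, c u (d 1 u x) = 0) ->
  exists g : mhom (X' 0) N, forall u x, c u x = g u (d 0 u x).
Proof.
move=> c0; pose pre u y := projT1 (cid (@paug_surj _ _ _ X u y)).
have preE u y : d 0 u (pre u y) = y by rewrite /pre; case: cid.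
have cE u x y : d 0 u x = d 0 u y -> c u x = c u y.
  move=> e; apply/eqP; rewrite -subr_eq0 -(linB (mfun_linear c (u:=u))).
  have [z <-] : exists z, d 1 u z = x - y.
    by apply/aexact; rewrite (linB (mfun_linear (d 0) (u:=u))) e subrr.
  by rewrite c0.
pose g u y := c u (pre u y).
have gl u : linear (g u).
  by move=> a x y; rewrite /g -mfun_linear; apply: cE; rewrite mfun_linear !preE.
have gn u v (h : hom u v) x : g u (mact h x) = mact h (g v x).
  by rewrite /g -mfun_nat; apply: cE; rewrite mfun_nat !preE.
by exists (Mhom gl gn) => u x; apply: cE; rewrite preE.
Qed.

(** Ext^i(I, J_y) = 0 for i >= 1; the case i = 0 of the statement is left
    exactness of Hom(-, J_y), which serves as the start of the induction. *)
Lemma dualR_acyclic i (y : D) (c : mhom (X' i.+1) (dualR y)) :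
  (forall u x, c u (d i.+1 u x) = 0) ->
  exists g : mhom (X' i) (dualR y), forall u x, c u x = g u (d i u x).
Proof.
elim: i y c => [|i IH] y c c0; first exact: augmentation_factor.
pose Pr z (f : hom y z) := exists g : mhom (X' i.+1) (dualR z),
  forall u x, dualR_map f u (c u x) = g u (d i.+1 u x).
suff [g gE] : @Pr y (idm y).
  by exists g => u x; rewrite -gE; apply: dualE => h; rewrite dualR_mapE compm1.
apply: (frozen_induction H) => [z|z f1 f2 [g1 E1] [g2 E2]|z z' h f [g gE]|v f vA|m f fm].
- by exists (mzero _ _) => u x; rewrite dualR_map0.
- by exists (madd g1 g2) => u x; rewrite dualR_mapD E1 E2.
- by exists (mcomp (dualR_map h) g) => u x; rewrite dualR_mapM gE.
- apply: (dualR_alive_injective (v := exist _ v vA) (d' := d i.+2) (d := d i.+1) (c := mcomp (dualR_map f) c)).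
    exact: aexact.
  move=> u x; change (dualR_map f u (c u (d i.+2 u x)) = 0).
  by rewrite c0 (lin0 (mfun_linear (dualR_map f) (u:=u))).
pose g e := projT1 (cid (fm e)).
have gE e u x : dualR_map (hcomp (mb e) f) u (c u x) = g e u (d i.+1 u x).
  by rewrite /g; case: cid.
(* a cocycle of degree one less, with values in J_(rgt m) *)
pose G : mhom (X' i.+1) (dualR (rgt m)) := msum (fun e : midx m => mcomp (dualR_map (ma e)) (g e)).
have [u x|K KE] := IH (rgt m) G.
  transitivity (\sum_(e : midx m) dualR_map (ma e) u (dualR_map (hcomp (mb e) f) u (c u x))).
    by apply: eq_bigr => e _; rewrite gE.
  under eq_bigr => e _ do rewrite -dualR_mapM compA dualR_mapM.
  by rewrite -dualR_map_sum (mc_mesh H) dualR_map0.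
have [K' K'E] := aterm_mesh_lifts K.
(* corrected homotopies, which come from J_(lft m) *)
pose g' e : mhom (X' i.+1) (dualR (mid e)) := msub (g e) (mcomp (K' e) (d i)).
have g'0 u x : \sum_e dualR_map (ma e) u (g' e u x) = 0.
  transitivity (G u x - K u (d i u x)); last by rewrite KE subrr.
  rewrite K'E -sumrB; apply: eq_bigr => e _.
  by rewrite msubE (linB (mfun_linear (dualR_map (ma e)) (u:=u))).
have [u l l0|u x|h hE] := @mhom_factor_inj _ _ (X' i.+1) (dualR (lft m)) (midx m) _
    (fun e => dualR_map (mb e)) g'.
- exact: (dualR_mesh_inj H l0).
- have [l lE] := dualR_mesh_exact H (g'0 u x); by exists l => e; rewrite lE.
exists h => u x; apply/eqP; rewrite -subr_eq0; apply/eqP/(dualR_mesh_inj H) => e.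
rewrite (linB (mfun_linear (dualR_map (mb e)) (u:=u))) -dualR_mapM gE hE msubE /=.
by rewrite adiff_adiff (lin0 (mfun_linear (K' e) (u:=u))) subr0 subrr.
Qed.

Section Simple.
Variables (v : S) (m : mesh D) (c : hom (sval v) (rgt m)).
Hypothesis c_inj : forall w (g : hom (rgt m) w), hcomp g c = 0 -> g = 0.

(** A functional on R(v, w) which vanishes on the morphisms factoring through
    the unique arrow c out of v is 0 unless w = v: the kernel is the simple
    module at v. *)
Definition simple : rmod S := ker_mod (dualR_map c).

(** By 0 -> S_v -> J_v -> J_(rgt m) -> 0, Ext^p(I, S_v) is a quotient of
    Ext^(p-1)(I, J_(rgt m)), which is 0 for p >= 2. *)
Lemma simple_acyclic i (f : mhom (X' i.+3) simple) :
  (forall u x, f u (d i.+3 u x) = 0) ->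
  exists g : mhom (X' i.+2) simple, forall u x, f u x = g u (d i.+2 u x).
Proof.
move=> f0.
have [||g gE] := @dualR_alive_injective _ _ v _ _ _ (d i.+3) (d i.+2) (mcomp (ker_incl (dualR_map c)) f).
- exact: aexact.
- by move=> u x; rewrite /= f0.
have [|K KE] := @dualR_acyclic i.+1 (rgt m) (mcomp (dualR_map c) g).
  move=> u x; change (dualR_map c u (g u (d i.+2 u x)) = 0); rewrite -gE.
  exact: (kerP (f u x)).
have cs : msurj (dualR_map c).
  move=> u l; have [h hc|l' l'E] := dual_extend (V := hom (sval v) (sval u)) (l := l) (comp_linearl c).
    by rewrite (c_inj hc) (lin0 (dualP l)).
  by exists l'; apply: dualE => h; rewrite dualR_mapE.
have [K' K'E] := @aterm_proj _ _ _ X i _ _ (dualR_map c) K cs.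
pose g' := msub g (mcomp K' (d i.+1)).
have g'0 u x : dualR_map c u (g' u x) = 0.
  rewrite msubE (linB (mfun_linear (dualR_map c) (u:=u))).
  by rewrite -[X in X - _]/(mcomp (dualR_map c) g u x) KE -K'E subrr.
exists (mker_lift g'0) => u x; apply: val_inj.
change (mcomp (ker_incl (dualR_map c)) f u x = g' u (d i.+2 u x)).
by rewrite gE msubE /= adiff_adiff (lin0 (mfun_linear K' (u:=u))) subr0.
Qed.

End Simple.

Section Truncation.
Variables (M : rmod S) (n : int).

Definition trunc_sub (u : S) : submodule (M u).
Proof.
refine (@Submodule k (M u) (fun m => (n <= rank (sval u))%R -> m = 0) _ _ _) => //.
- by move=> v w v0 w0 hn; rewrite v0 ?w0 ?addr0.
- by move=> a v v0 hn; rewrite v0 ?scaler0.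
Defined.

Lemma trunc_stable u v (f : hom u v) m : trunc_sub v m -> trunc_sub u (mact f m).
Proof.
move=> m0 hn; have [hv|hv] := leP n (rank (sval v)).
  by rewrite m0 // (lin0 (mact_linearr f)).
have -> : f = 0.
  exact: (@mc_rank _ _ H _ _ f (svalP u) (svalP v) (lt_le_trans hv hn)).
exact: (lin0 (mact_linearl m)).
Qed.

Definition trunc : rmod S := sub_mod trunc_stable.
End Truncation.

(** If f vanishes at the vertices of rank >= n, then f takes its values in
    trunc M n. At most one vertex w has rank n - 1, and trunc M n maps onto
    dim M(w) copies of the simple module at w. There f becomes a coboundary, and
    the homotopy lifts to trunc M n because the terms of the resolution are
    projective. *)
Lemma vanish_step i (M : rmod S) (n : int) (f : mhom (X' i.+3) M) :
  pointwise_finite_dim M ->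
  (forall u x, f u (d i.+3 u x) = 0) ->
  (forall u x, (n <= rank (sval u))%R -> f u x = 0) ->
  exists g : mhom (X' i.+2) M,
    (forall u x, (n <= rank (sval u))%R -> g u x = 0) /\
    forall u x, (n - 1 <= rank (sval u))%R -> g u (d i.+2 u x) = f u x.
Proof.
move=> Mfd f0 fn.
have [[w wn]|no] := pselect (exists w : S, rank (sval w) = n - 1); last first.
  exists (mzero _ _); split=> // u x; rewrite le_eqVlt => /orP[/eqP e|hu].
    by case: no; exists u.
  by rewrite fn //; move: hu; lia.
have [r [phi [pl pinj psurj]]] := finite_dim_coords (Mfd w).
have [m [c [c_inj c_surj c_back]]] := ml_frozen (mc_left H) (svalP w).
pose T := trunc M n.
have RC_class j : linear (fun y : M w => phi y j : k^o) by move=> a x y; rewrite pl !ffunE.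
pose q0 (j : 'I_r) : mhom T (dualR (sval w)) :=
  mcomp (coind (mkdual (RC_class j))) (sub_incl (@trunc_stable M n)).
have qk j u x : dualR_map c u (q0 j u x) = 0.
  apply: dualE => g; rewrite dualR_mapE /=.
  suff -> : mact (hcomp g c : @hom k S w u) (sub_val x) = 0 by rewrite (lin0 pl) ffunE.
  have [hu|hu] := leP n (rank (sval u)).
    by rewrite (subP x hu) (lin0 (mact_linearr _)).
  suff -> : hcomp g c = 0 by rewrite (lin0 (@mact_linearl k S M w u _)).
  have [e|ne] := pselect (sval u = sval w).
    by move: e g {hu x} => -> g; rewrite (c_back g) comp0m.
  have ne' : rank (sval u) <> rank (sval w) by move=> /(mc_rank_inj H (svalP u) (svalP w)).
  have hw : (rank (sval u) < rank (sval w))%R by move: ne'; rewrite wn; move: hu; lia.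
  exact: (mc_rank H (hcomp g c) (svalP w) (svalP u) hw).
pose Q j := mker_lift (qk j).
(* the projection of trunc M n onto its top at w *)
pose QQ : mhom T (mprod (fun _ : 'I_r => simple c)) := mtuple Q.
have QQs : msurj QQ.
  move=> u s; have [e|ne] := pselect (w = u).
    move: e s => <- s.
    have [y yE] := psurj [ffun j => ker_val (s j) (idm (sval w))].
    have yU : trunc_sub M n w y by rewrite /= wn; lia.
    exists (mksub yU : T w); apply: functional_extensionality_dep => j; apply: val_inj.
    apply: dualE => h /=.
    have [a ->] := mc_end H h (svalP w).
    rewrite (linZ (@mact_linearl k S M w w _)) (linZ pl) (@mact1 k S) yE !ffunE.
    exact/esym/(linZ (dualP _)).
  exists 0; rewrite (lin0 (mfun_linear QQ (u:=u))).
  apply: functional_extensionality_dep => j; apply: val_inj; apply: dualE => h /=.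
  have [|g ->] := c_surj _ h.
    by move=> e; apply: ne; apply: sval_inj.
  exact: (esym (congr1 (fun l : dual _ => l g) (kerP (s j)))).
pose f1 : mhom (X' i.+3) T := @sub_lift _ _ _ _ (@trunc_stable M n) _ f fn.
have K j : exists g : mhom (X' i.+2) (simple c),
    forall u x, mcomp (Q j) f1 u x = g u (d i.+2 u x).
  apply: simple_acyclic => // u x.
  have e : f1 u (d i.+3 u x) = 0 by apply: val_inj; rewrite /= f0.
  exact: (etrans (congr1 (Q j u) e) (lin0 (mfun_linear (Q j) (u:=u)))).
pose G j := projT1 (cid (K j)).
have GE j u x : Q j u (f1 u x) = G j u (d i.+2 u x).
  by rewrite -[LHS]/(mcomp (Q j) f1 u x) /G; case: cid.
have [g gE] := @aterm_proj _ _ _ X i.+1 _ _ QQ (mtuple G) QQs.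
exists (mcomp (sub_incl (@trunc_stable M n)) g); split=> [u x hu|u x hu].
  exact: (subP (g u x) hu).
rewrite /=; have [hu'|hu'] := leP n (rank (sval u)).
  by rewrite (fn _ _ hu') (subP (g u (d i.+2 u x)) hu').
have e : w = u.
  by apply: sval_inj; apply: (mc_rank_inj H (svalP w) (svalP u)); rewrite wn; lia.
move: e x => <- x; apply: pinj; apply/ffunP => j.
have E y : phi (sub_val y) j = ker_val (Q j w y) (idm (sval w)).
  by rewrite /= (@mact1 k S).
have -> : f w x = sub_val (f1 w x) by [].
rewrite !E GE.
by rewrite -[G j w _](congr1 (fun s : mprod (fun _ : 'I_r => simple c) w => s j)
  (gE w (d i.+2 w x))).
Qed.

(** The homotopies for the vertices of rank >= N - n are constructed by recursion
    on n; as each extends the previous one, they have a limit. *)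
Lemma vanish_bounded i (M : rmod S) (N : int) (f : mhom (X' i.+3) M) :
  pointwise_finite_dim M ->
  (forall u : S, (N <= rank (sval u))%R -> forall x : M u, x = 0) ->
  (forall u x, f u (d i.+3 u x) = 0) ->
  exists g : mhom (X' i.+2) M, forall u x, f u x = g u (d i.+2 u x).
Proof.
move=> Mfd MN f0.
pose good (n : nat) (g : mhom (X' i.+2) M) :=
  forall u x, (N - n%:Z <= rank (sval u))%R -> g u (d i.+2 u x) = f u x.
have step n g : good n g -> exists g', good n.+1 g' /\
    forall u x, (N - n%:Z <= rank (sval u))%R -> g' u x = g u x.
  move=> gn.
  have [||h [h0 hE]] := @vanish_step i M (N - n%:Z) (msub f (mcomp g (d i.+2))) Mfd.
  - by move=> u x; rewrite msubE /= adiff_adiff f0 (lin0 (mfun_linear g (u:=u))) subrr.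
  - by move=> u x hu; rewrite msubE /= gn // subrr.
  exists (madd g h); split=> [u x hu|u x hu]; last by rewrite /= h0 ?addr0.
  by rewrite /= hE ?msubE /= 1?addrC ?subrK //; move: hu; lia.
have good0 : good 0%N (mzero _ _).
  by move=> u x hu; rewrite (MN u _ (f u x)) //; move: hu; lia.
pose s := fix s n : {g | good n g} :=
  match n with
  | 0 => exist _ _ good0
  | n'.+1 => let: exist g gn := s n' in
      exist _ (projT1 (cid (step n' g gn))) (proj1 (projT2 (cid (step n' g gn))))
  end.
pose t n := sval (s n).
have tS n u x : (N - n%:Z <= rank (sval u))%R -> t n.+1 u x = t n u x.
  by rewrite /t /=; case: (s n) => g gn /=; case: cid => g' /= [_]; apply.
have tm n j u x : (N - n%:Z <= rank (sval u))%R -> t (n + j)%N u x = t n u x.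
  by move=> hu; elim: j => [|j IH]; rewrite ?addn0 // addnS tS // -?IH; move: hu; lia.
pose b (u : S) := absz (N - rank (sval u))%R.
have bP u : (N - (b u)%:Z <= rank (sval u))%R by rewrite /b; lia.
have tb n u x : (b u <= n)%N -> t n u x = t (b u) u x.
  by move=> /subnKC <-; apply/tm/bP.
pose g u := t (b u) u.
have gl u : linear (g u) by apply: mfun_linear.
have gn u v (h : hom u v) x : g u (mact h x) = mact h (g v x).
  rewrite /g -(@tb (b u + b v)%N) ?leq_addr // -(@tb (b u + b v)%N) ?leq_addl //.
  exact: mfun_nat.
exists (Mhom gl gn) => u x; rewrite /= /g /t.
by case: (s (b u)) => g' /= ->.
Qed.

End Resolution.

Lemma ext_cogenerated (I M : rmod S) :
  finitely_cogenerated I -> injective_module I -> pointwise_finite_dim M ->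
  (exists N : int, forall u : S, (N <= rank (sval u))%R -> forall x : M u, x = 0) ->
  forall p, (2 <= p)%N -> Ext_vanishes p I M.
Proof.
move=> Icog Iinj Mfd [N MN] [|[|p]] // _ X f f0.
exact: (@vanish_bounded I X (cogenerated_mesh_lifts H Icog Iinj) p M N f).
Qed.

End ExtVanishing.

Section Generated.
Variables (k : fieldType) (D : mesh_data k).
Hypothesis H : mesh_cat D.
Local Notation S := (@fullsub k D (@alive k D)).

Lemma rdual_cogenerated (A : lincat k) (P : rmod A) :
  finitely_generated P -> finitely_cogenerated (rdual P).
Proof.
move=> [n [u [s ss]]].
pose c i : mhom (rdual (rep (u i))) (@corep k (opcat A) (u i)) :=
  @Mhom k (opcat A) (rdual (rep (u i))) (@corep k (opcat A) (u i)) (fun v x => x)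
    (fun v a x y => erefl) (fun v w f x => erefl).
pose j i := mcomp (c i) (mcomp (rdual_map (dsum_incl (fun i => rep (u i)) i)) (rdual_map s)).
exists n, u, (dsum_tuple j) => v l l' e.
apply: dualE => x; have [y <-] := ss _ x.
rewrite (lsingle_sum y) (lin_sum (mfun_linear s (u:=v))) (lin_sum (dualP l)) (lin_sum (dualP l')).
apply: eq_bigr => i _.
exact: (congr1 (fun t : dsum (fun i => @corep k (opcat A) (u i)) v =>
  (t i : dual (@hom k A v (u i))) (y i)) e).
Qed.

(** Evaluation, obtained as the transpose of the identity of rdual P. *)
Definition bidual (A : lincat k) (P : rmod A) : mhom P (ldual (rdual P)).
Proof.
refine (@transpose_l k A P (rdual P) (@Mhom k (opcat A) (rdual P) (rdual P) (fun v x => x)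
    (fun v a x y => erefl) (fun v w f x => erefl))).
Defined.

Lemma bidual_inj (A : lincat k) (P : rmod A) : minj (bidual P).
Proof.
move=> u x y e; apply/eqP; rewrite -subr_eq0; apply/eqP/dual_separates => l.
rewrite (linB (dualP l)).
by have := congr1 (fun L : dual (dual (P u)) => L l) e => /= ->; rewrite subrr.
Qed.

Lemma bidual_surj (A : lincat k) (P : rmod A) : pointwise_finite_dim P -> msurj (bidual P).
Proof.
move=> Pfd u L; have [x xE] := finite_dim_reflexive (Pfd u) (dualP (L : dual (dual (P u)))).
by exists x; apply: dualE => l; rewrite (xE l).
Qed.

Lemma ext_generated (M P : rmod S) :
  finitely_generated P -> projective P -> pointwise_finite_dim M ->
  (exists N : int, forall u : S, (rank (sval u) <= N)%R -> forall x : M u, x = 0) ->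
  forall p, (2 <= p)%N -> Ext_vanishes p M P.
Proof.
move=> Pg Pp Mfd [N MN] p p2 X f f0.
have Pfd : pointwise_finite_dim P.
  move=> v; have [n [u [s ss]]] := Pg.
  apply: (finite_dim_image (mfun_linear s (u:=v)) (ss v)).
  by apply: finite_dim_prod => i; apply: (mc_fd H).
have E : forall p, (2 <= p)%N -> Ext_vanishes p (rdual P) (rdual M).
  apply: (@ext_cogenerated k _ (op_mesh_cat H) (rdual P) (rdual M)).
  - exact (@rdual_cogenerated S P Pg).
  - exact (@rdual_injective k S P Pp).
  - by move=> u; apply: finite_dim_dual.
  exists (- N) => u hu l; apply: dualE => x.
  by rewrite (MN u _ x) ?(lin0 (dualP l)) //; move: hu; rewrite /= lerN2.
have [Y] := proj_resolution_exists (rdual P).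
case: p p2 f f0 => [|[|p]] // p2 f f0.
have [|g gE] := @ext_balance k S M (rdual P) X Y p.+1 (E p.+2 p2 Y) (mcomp (bidual P) f).
  by move=> u x; rewrite /= f0; apply: dualE => l; apply: (lin0 (dualP l)).
have [g' g'E] := @pterm_proj _ _ _ X p.+1 _ _ (bidual P) g (bidual_surj Pfd).
by exists g' => u x; apply: bidual_inj; rewrite g'E -gE.
Qed.

End Generated.

(** * Ideals of free categories *)

Section Scalar.
Variables (k : fieldType) (A : lincat k) (s : A).

(** The multiple c of the identity of s, seen as a morphism s -> v; 0 if v is
    different from s. This avoids a case distinction in the decompositions. *)
Definition scalar_at (v : A) (c : k) : hom s v :=
  match pselect (s = v) with
  | left e => eq_rect s (fun v => hom s v) (c *: idm s) v e
  | right _ => 0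
  end.

Lemma scalar_at_id c : scalar_at s c = c *: idm s.
Proof.
rewrite /scalar_at; case: pselect => // e.
by rewrite (Prop_irrelevance e erefl).
Qed.

Lemma scalar_at_neq v c : s <> v -> scalar_at v c = 0.
Proof. by rewrite /scalar_at; case: pselect. Qed.

Lemma scalar_at_linear v : linear (scalar_at v : k^o -> hom s v).
Proof.
move=> a b c; have [<-|ne] := pselect (s = v).
  by rewrite !scalar_at_id scalerDl scalerA.
by rewrite !scalar_at_neq // scaler0 addr0.
Qed.

End Scalar.

Section FirstArrow.
Variables (k : fieldType) (A : lincat k).

Section Splits.
Variables (s : A) (E : finType) (y : E -> A) (al : forall e, hom s (y e)).

Definition splits_first v (f : hom s v) := exists (h : forall e, hom (y e) v) c,
  f = \sum_e hcomp (h e) (al e) + scalar_at s v c.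

Lemma splits_first0 v : splits_first (0 : hom s v).
Proof.
exists (fun e => 0), 0; rewrite big1 => [|e _]; last exact: comp0m.
by rewrite add0r (lin0 (@scalar_at_linear k A s v)).
Qed.

Lemma splits_firstD v (f g : hom s v) : splits_first f -> splits_first g ->
  splits_first (f + g).
Proof.
move=> [h [c ->]] [h' [c' ->]]; exists (fun e => h e + h' e), (c + c').
rewrite (linD (@scalar_at_linear k A s v)) addrACA -big_split; congr (_ + _).
by apply: eq_bigr => e _; rewrite (linD (comp_linearl _)).
Qed.

Lemma splits_firstZ v a (f : hom s v) : splits_first f -> splits_first (a *: f).
Proof.
move=> [h [c ->]]; exists (fun e => a *: h e), (a *: (c : k^o)).
rewrite (linZ (@scalar_at_linear k A s v)) scalerDr scaler_sumr; congr (_ + _).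
by apply: eq_bigr => e _; rewrite (linZ (comp_linearl _)).
Qed.

Lemma splits_first_id : splits_first (idm s).
Proof.
exists (fun e => 0), 1; rewrite big1 => [|e _]; last exact: comp0m.
by rewrite add0r scalar_at_id scale1r.
Qed.

Lemma splits_first_comp v e (h : hom (y e) v) : splits_first (hcomp h (al e)).
Proof.
exists (lsingle (V := fun e => hom (y e) v) h), 0.
rewrite (lin0 (@scalar_at_linear k A s v)) addr0.
by rewrite (sum_lsingle (F := fun e h => hcomp h (al e))) // => e'; apply: comp_linearl.
Qed.

End Splits.

(** Freeness at s: the morphisms out of s which are not multiples of the identity
    start with the arrows fa_arr e, and these arrows are linearly independent. *)
Record first_arrow (s : A) := FirstArrow {
  fa_ix : finType;
  fa_mid : fa_ix -> A;
  fa_arr : forall e, hom s (fa_mid e);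
  fa_split : forall v (f : hom s v), exists (h : forall e, hom (fa_mid e) v) c,
    f = \sum_e hcomp (h e) (fa_arr e) + scalar_at s v c;
  fa_uniq : forall v (h : forall e, hom (fa_mid e) v),
    \sum_e hcomp (h e) (fa_arr e) = 0 -> forall e, h e = 0 }.

Arguments fa_mid {s} _ _.
Arguments fa_arr {s} _ _.

Definition fa_sum s (d : first_arrow s) w (h : forall e, hom (fa_mid d e) w) :=
  \sum_e hcomp (h e) (fa_arr d e).


End FirstArrow.
Arguments fa_mid {k A s} _ _.
Arguments fa_arr {k A s} _ _.

Section FirstArrowIdeal.
Variables (k : fieldType) (A : lincat k) (G : forall x y : A, hom x y -> Prop).

(** Q is a property of families of coefficients; the fields are what is needed to
    propagate it from the generators of an ideal to the whole ideal. *)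
Record good_family (s : A) (d : first_arrow s)
    (Q : forall w, (forall e, hom (fa_mid d e) w) -> Prop) : Prop := {
  gf_D : forall w h h', Q w h -> Q w h' -> Q w (fun e => h e + h' e);
  gf_Z : forall w (a : k) h, Q w h -> Q w (fun e => a *: h e);
  gf_comp : forall w w' (g : hom w w') h, Q w h -> Q w' (fun e => hcomp g (h e));
  gf_ideal : forall w h, (forall e, ideal G (h e)) -> Q w h;
  gf_gen : forall w (f : hom s w), G f -> exists2 h, f = fa_sum h & Q w h }.

(** The relations that start at s determine all relations between morphisms
    starting at s. The only generators which contribute are those that start at
    s; in a composite g o f with g in the ideal, f splits into a part starting
    with an arrow, whose coefficients are composed with g and so lie in the
    ideal, and a multiple of the identity, to which induction applies. *)
Lemma ideal_first_arrow x w (f : hom x w) : ideal G f ->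
  forall (d : first_arrow x) Q, @good_family x d Q -> exists2 h, f = fa_sum h & Q w h.
Proof.
elim=> {x w f}.
- by move=> x y f Gf d Q gQ; apply: gf_gen gQ _ _ Gf.
- move=> x y d Q gQ; exists (fun e => 0).
    by rewrite /fa_sum big1 // => e _; rewrite comp0m.
  by apply: (gf_ideal gQ) => e; apply: ideal0.
- move=> x y f g _ IHf _ IHg d Q gQ.
  have [h -> Qh] := IHf d Q gQ; have [h' -> Qh'] := IHg d Q gQ.
  exists (fun e => h e + h' e); last exact: (gf_D gQ).
  rewrite /fa_sum -big_split; apply: eq_bigr => e _ /=.
  by rewrite (linD (comp_linearl _)).
- move=> x y a f _ IHf d Q gQ; have [h -> Qh] := IHf d Q gQ.
  exists (fun e => a *: h e); last exact: (gf_Z gQ).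
  rewrite /fa_sum scaler_sumr; apply: eq_bigr => e _ /=.
  by rewrite (linZ (comp_linearl _)).
- move=> x y z g f _ IHf d Q gQ; have [h -> Qh] := IHf d Q gQ.
  exists (fun e => hcomp g (h e)); last exact: (gf_comp gQ).
  by rewrite /fa_sum comp_sumr; apply: eq_bigr => e _ /=; rewrite compA.
move=> x y z g f gI IHg d Q gQ; have [h [c ->]] := fa_split d f.
have e1 : hcomp g (\sum_e hcomp (h e) (fa_arr d e)) = fa_sum (fun e => hcomp g (h e)).
  by rewrite comp_sumr; apply: eq_bigr => e _; rewrite compA.
have Q1 : Q z (fun e => hcomp g (h e)).
  by apply: (gf_ideal gQ) => e; apply: ideal_compr.
rewrite (linD (comp_linearr g)) e1.
have [exy|nxy] := pselect (x = y); last first.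
  by exists (fun e => hcomp g (h e)); rewrite // scalar_at_neq // compm0 addr0.
move: exy g h f gI IHg e1 Q1 => <- g h f gI IHg e1 Q1.
have [h' gE Qh'] := IHg d Q gQ.
exists (fun e => hcomp g (h e) + c *: h' e); last first.
  by apply: (gf_D gQ) => //; apply: (gf_Z gQ).
rewrite scalar_at_id (linZ (comp_linearr g)) compm1 {2}gE /fa_sum scaler_sumr -big_split.
by apply: eq_bigr => e _ /=; rewrite (linD (comp_linearl _)) (linZ (comp_linearl _)).
Qed.

(** The quotient category by ideal G, up to isomorphism. *)
Record quotient_functor (R : lincat k) (F : A -> R)
    (RC_class : forall x y : A, hom x y -> hom (F x) (F y)) : Prop := {
  qf_linear : forall x y, linear (@RC_class x y);
  qf_full : forall x y (g : hom (F x) (F y)), exists f, RC_class x y f = g;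
  qf_comp : forall x y z (g : hom y z) (f : hom x y),
    RC_class x z (hcomp g f) = hcomp (RC_class y z g) (RC_class x y f);
  qf_id : forall x, RC_class x x (idm x) = idm (F x);
  qf_ker : forall x y (f : hom x y), RC_class x y f = 0 <-> ideal G f }.

Variables (R : lincat k) (F : A -> R) (RC_class : forall x y : A, hom x y -> hom (F x) (F y)).
Hypothesis qf : quotient_functor RC_class.
Variables (s : A) (d : first_arrow s).

Lemma qf_split v (f : hom (F s) (F v)) : exists (h : forall e, hom (F (fa_mid d e)) (F v)) c,
  f = \sum_e hcomp (h e) (RC_class (fa_arr d e)) + RC_class (scalar_at s v c).
Proof.
have [f' <-] := qf_full qf f; have [h [c ->]] := fa_split d f'.
exists (fun e => RC_class (h e)), c; rewrite (linD (qf_linear qf (y:=v))).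
by rewrite (lin_sum (qf_linear qf (y:=v))); under eq_bigr do rewrite (qf_comp qf).
Qed.

Lemma qf_surj v (f : hom (F s) (F v)) : v <> s ->
  exists h : forall e, hom (F (fa_mid d e)) (F v), f = \sum_e hcomp (h e) (RC_class (fa_arr d e)).
Proof.
move=> vs; have [h [c ->]] := qf_split f; exists h.
by rewrite scalar_at_neq ?(lin0 (qf_linear qf (y:=v))) ?addr0 // => e; apply: vs.
Qed.

(** Middle exactness: if Q describes the relations starting at s, then a relation
    between the arrows out of s in the quotient is given by a family in Q. *)
Lemma qf_exact Q v (g : forall e, hom (F (fa_mid d e)) (F v)) :
  good_family Q -> \sum_e hcomp (g e) (RC_class (fa_arr d e)) = 0 ->
  exists2 h : forall e, hom (fa_mid d e) v, Q v h & forall e, RC_class (h e) = g e.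
Proof.
move=> gQ g0.
pose g' e := projT1 (cid (qf_full qf (g e))).
have g'E e : RC_class (g' e) = g e by rewrite /g'; case: cid.
have : ideal G (fa_sum g').
  apply/(qf_ker qf); rewrite (lin_sum (qf_linear qf (y:=v))) -[RHS]g0.
  by apply: eq_bigr => e _; rewrite (qf_comp qf) g'E.
move=> /ideal_first_arrow/(_ _ _ gQ) [h hE Qh]; exists h => // e.
suff -> : h e = g' e by [].
apply/eqP; rewrite -subr_eq0; apply/eqP; move: e.
apply: (@fa_uniq _ _ _ d v (fun e => h e - g' e)).
under eq_bigr do rewrite (linB (comp_linearl _)).
by rewrite sumrB -/(fa_sum h) -/(fa_sum g') hE subrr.
Qed.

End FirstArrowIdeal.

Lemma ideal_op k (A : lincat k) (G : forall x y : A, hom x y -> Prop)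
    (x y : A) (f : hom x y) :
  ideal G f -> @ideal k (opcat A) (fun x y f => G y x f) y x f.
Proof.
elim=> {x y f}.
- by move=> x y f Gf; apply: ideal_gen.
- by move=> x y; apply: ideal0.
- by move=> x y f g _ If _ Ig; apply: idealD.
- by move=> x y a f _ If; apply: idealZ.
- by move=> x y z g f _ If; apply: (@ideal_compr k (opcat A)).
- by move=> x y z g f _ If; apply: (@ideal_compl k (opcat A)).
Qed.

Lemma ideal_op_inv k (A : lincat k) (G : forall x y : A, hom x y -> Prop)
    (x y : A) (f : hom x y) :
  @ideal k (opcat A) (fun x y f => G y x f) y x f -> ideal G f.
Proof.
elim=> {x y f}.
- by move=> x y f Gf; apply: ideal_gen.
- by move=> x y; apply: ideal0.
- by move=> x y f g _ If _ Ig; apply: idealD.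
- by move=> x y a f _ If; apply: idealZ.
- by move=> x y z g f _ If; apply: (@ideal_compr k A).
- by move=> x y z g f _ If; apply: (@ideal_compl k A).
Qed.

Lemma op_quotient_functor k (A : lincat k) (G : forall x y : A, hom x y -> Prop)
    (R : lincat k) (F : A -> R) (RC_class : forall x y : A, hom x y -> hom (F x) (F y)) :
  quotient_functor G RC_class ->
  @quotient_functor k (opcat A) (fun x y f => G y x f) (opcat R) F (fun x y f => RC_class y x f).
Proof.
move=> H; split.
- by move=> x y; apply: (qf_linear H).
- by move=> x y g; apply: (qf_full H).
- by move=> x y z g f; apply: (qf_comp H).
- by move=> x; apply: (qf_id H).
- move=> x y f; split=> [/(qf_ker H)/ideal_op//|If].
  by apply/(qf_ker H)/ideal_op_inv.
Qed.

Lemma ideal_mono k (A : lincat k) (G G' : forall x y : A, hom x y -> Prop) :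
  (forall x y (f : hom x y), G x y f -> G' x y f) ->
  forall x y (f : hom x y), ideal G f -> ideal G' f.
Proof.
move=> GG' x y f; elim=> {x y f}.
- by move=> x y f /GG'; apply: ideal_gen.
- by move=> x y; apply: ideal0.
- by move=> x y f g _ If _ Ig; apply: idealD.
- by move=> x y a f _ If; apply: idealZ.
- by move=> x y z g f _; apply: ideal_compl.
- by move=> x y z g f _; apply: ideal_compr.
Qed.

(** R_C is a quotient of R, which is a quotient of the path category; both ideals
    are combined into one, so that qf_exact applies to the path category. *)
Section TwoSteps.
Variables (k : fieldType) (A : lincat k) (G1 : forall x y : A, hom x y -> Prop).
Variable G2 : forall x y : qcat G1, hom x y -> Prop.
Variable G : forall x y : A, hom x y -> Prop.
Hypothesis G1G : forall x y (f : hom x y), G1 f -> G f.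
Hypothesis G2G : forall x y (f : hom x y), G2 (qclass G1 f) -> ideal G f.
Hypothesis GG : forall x y (f : hom x y), G f -> G1 f \/ G2 (qclass G1 f).

Definition qclass2 (x y : A) (f : hom x y) : @hom k (qcat G2) x y :=
  qclass G2 (qclass G1 f).

Let qclass_eq x y (f g : hom x y) : qclass G1 f = qclass G1 g -> ideal G g -> ideal G f.
Proof.
move=> /qpiP/asboolP fg gG; rewrite -[f](subrK g); apply: idealD => //.
exact: (ideal_mono G1G).
Qed.

Lemma ideal_two_steps x y (f : hom x y) : ideal G2 (qclass G1 f) -> ideal G f.
Proof.
move e : (qclass G1 f) => fb If.
elim: If f e => {x y fb}.
- by move=> x y fb Gf f e; apply: G2G; rewrite e.
- move=> x y f e; apply: (qclass_eq (g := 0)); last exact: ideal0.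
  by rewrite e (lin0 (@qclass_linear k A G1 x y)).
- move=> x y fb gb _ IHf _ IHg f e.
  apply: (qclass_eq (g := qrepr fb + qrepr gb)).
    by rewrite (linD (@qclass_linear k A G1 x y)) !qclassK.
  by apply: idealD; [apply: IHf|apply: IHg]; apply: qclassK.
- move=> x y a fb _ IHf f e; apply: (qclass_eq (g := a *: qrepr fb)).
    by rewrite (linZ (@qclass_linear k A G1 x y)) !qclassK.
  by apply/idealZ/IHf/qclassK.
- move=> x y z gb fb _ IHf f e; apply: (qclass_eq (g := hcomp (qrepr gb) (qrepr fb))).
    by rewrite -qcompE !qclassK.
  by apply/ideal_compl/IHf/qclassK.
move=> x y z gb fb _ IHf f e; apply: (qclass_eq (g := hcomp (qrepr gb) (qrepr fb))).
  by rewrite -qcompE !qclassK.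
by apply/ideal_compr/IHf/qclassK.
Qed.

Lemma ideal_two_steps_inv x y (f : hom x y) : ideal G f -> ideal G2 (qclass G1 f).
Proof.
elim=> {x y f}.
- move=> x y f /GG [G1f|G2f]; last exact: ideal_gen.
  have -> : qclass G1 f = 0.
    rewrite -(lin0 (@qclass_linear k A G1 x y)); apply: qclassP.
    by rewrite subr0; apply: ideal_gen.
  exact: ideal0.
- by move=> x y; rewrite (lin0 (@qclass_linear k A G1 x y)); apply: ideal0.
- by move=> x y f g _ If _ Ig; rewrite (linD (@qclass_linear k A G1 x y)); apply: idealD.
- by move=> x y a f _ If; rewrite (linZ (@qclass_linear k A G1 x y)); apply: idealZ.
- move=> x y z g f _ If; rewrite -qcompE; exact: (@ideal_compl k (qcat G1)).
- move=> x y z g f _ If; rewrite -qcompE; exact: (@ideal_compr k (qcat G1)).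
Qed.

Lemma qclass2_functor : @quotient_functor k A G (qcat G2) (fun x => x) qclass2.
Proof.
split.
- by move=> x y a f g; rewrite /qclass2 !qclass_linear.
- move=> x y g; exists (qrepr (qrepr g)); rewrite /qclass2.
  rewrite -[RHS](qclassK g); congr (qclass G2 _); exact: qclassK.
- by move=> x y z g f; rewrite /qclass2 -qcompE -[in LHS](@qcompE _ (qcat G1)).
- by [].
move=> x y f; split=> [e|If].
  apply: ideal_two_steps.
  have /qpiP/asboolP : qpi (ideal_sub G2 x y) (qclass G1 f) = qpi (ideal_sub G2 x y) 0.
    by rewrite [LHS]e (lin0 (@qpi_linear k _ _)).
  by rewrite subr0.
rewrite /qclass2 -(lin0 (@qclass_linear k _ G2 x y)); apply: qclassP.
by rewrite subr0; apply: ideal_two_steps_inv.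
Qed.

End TwoSteps.

(** * First and last arrows of paths *)

Section Malg.
Variables (k : fieldType).

Lemma malg_ind (K : choiceType) (P : {malg k[K]} -> Prop) :
  P 0 -> (forall f g, P f -> P g -> P (f + g)) -> (forall (a : k) f, P f -> P (a *: f)) ->
  (forall p, P << p >>) -> forall f, P f.
Proof.
move=> P0 PD PZ Pb f; rewrite (monalgE f); elim/big_ind: _ => // p _.
have -> : << f@_p *g p >> = f@_p *: << p >>.
  by apply/malgP => q; rewrite mcoeffZ !mcoeffU mulrnAr mulr1.
exact: PZ.
Qed.

Lemma malg0 (K : choiceType) : (K -> False) -> forall f : {malg k[K]}, f = 0.
Proof. by move=> no f; apply/malgP => p; case: (no p). Qed.

Lemma mcoeff_mlift (K K' : choiceType) (j : K -> K') (f : {malg k[K]}) q :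
  (mlift (fun p => << j p >> : {malg k[K']}) f)@_q = \sum_(p <- msupp f) f@_p * (j p == q)%:R.
Proof.
rewrite /mlift raddf_sum /=; apply: eq_bigr => p _.
by rewrite mcoeffZ mcoeffU.
Qed.

Lemma mcoeff_mlift_inj (K K' : choiceType) (j : K -> K') (f : {malg k[K]}) p :
  injective j -> (mlift (fun p => << j p >> : {malg k[K']}) f)@_(j p) = f@_p.
Proof.
move=> jinj; rewrite mcoeff_mlift.
have [pf|pf] := boolP (p \in msupp f); last first.
  rewrite (mcoeff_outdom pf) big_seq big1 // => q qf.
  have [/jinj e|] := eqVneq (j q) (j p); last by rewrite mulr0.
  by rewrite -e qf in pf.
rewrite (big_fsetD1 p pf) /= eqxx mulr1 big_seq big1 ?addr0 // => q.
rewrite in_fsetD1 => /andP[qp _]; rewrite (inj_eq jinj) (negPf qp).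
exact: mulr0.
Qed.

Lemma mcoeff_mlift0 (K K' : choiceType) (j : K -> K') (f : {malg k[K]}) q :
  (forall p, j p <> q) -> (mlift (fun p => << j p >> : {malg k[K']}) f)@_q = 0.
Proof.
move=> jq; rewrite mcoeff_mlift big1 // => p _.
by have [/jq|_] := eqVneq (j p) q; rewrite ?mulr0.
Qed.

Lemma mlift_family_inj (E : finType) (K : E -> choiceType) (K' : choiceType)
    (j : forall e, K e -> K') (h : forall e, {malg k[K e]}) :
  (forall e, injective (j e)) ->
  (forall e e' p p', j e p = j e' p' -> e = e') ->
  \sum_e mlift (fun p => << j e p >> : {malg k[K']}) (h e) = 0 ->
  forall e, h e = 0.
Proof.
move=> jinj jE h0 e; apply/malgP => p; rewrite mcoeff0.
have := congr1 (mcoeff (j e p)) h0.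
rewrite raddf_sum mcoeff0 (bigD1 e) //= mcoeff_mlift_inj //.
rewrite big1 ?addr0 // => e' ne; rewrite mcoeff_mlift0 // => q /jE e'e.
by rewrite e'e eqxx in ne.
Qed.

End Malg.

Section Paths.
Variables (k : fieldType) (Q : quiver).
Local Notation PC := (pathcat k Q).

Lemma pcomp_arrowr (x y z : vert Q) (p : qpath x y) (f : phom k y z) :
  pcomp f << p >> = mlift (fun q => << pcat p q >>) f.
Proof. by rewrite /pcomp mliftU. Qed.

Lemma pcomp_arrowl (x y z : vert Q) (p : qpath y z) (f : phom k x y) :
  pcomp << p >> f = mlift (fun q => << pcat q p >>) f.
Proof.
move: f; apply: mlift_unique => [a f g|a f g|q].
- by rewrite pcomp_linearr.
- exact: mlift_linear.
by rewrite pcompU mliftU.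
Qed.

Lemma walk_rcons x s a y :
  @walk Q x (rcons s a) y = walk x s (src a) && (tgt a == y).
Proof.
elim: s x => [|b s IH] x /=; first by rewrite eq_sym.
by rewrite IH andbA.
Qed.

(** Paths of positive length are pairs of a first arrow and a path, so the path
    category is free at s; here al enumerates the arrows that start at s. *)
Section OutArrows.
Variables (s : vert Q) (E : finType) (y : E -> vert Q) (al : forall e, arrow s (y e)).
Hypothesis al_all : forall a : arr Q, src a = s -> exists e, val (al e) = a.
Hypothesis al_inj : forall e e', val (al e) = val (al e') -> e = e'.

Let hal e : @hom k PC s (y e) := << parrow (al e) >>.

Lemma out_split v (f : @hom k PC s v) : splits_first hal f.
Proof.
move: f; apply: malg_ind; [exact (@splits_first0 k PC s E y hal v)|
  exact (@splits_firstD k PC s E y hal v)|exact (@splits_firstZ k PC s E y hal v)|].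
case=> [[|a p] /= pw].
  have sv := eqP pw; subst v.
  have <- : @idm k PC s = << exist _ [::] pw >> by congr (<< _ >>); apply: val_inj.
  exact: (@splits_first_id k PC s E y hal).
have [e ea] : exists e, val (al e) = a by apply: al_all; case/andP: pw => /eqP.
have pw' : walk (y e) p v.
  by case/andP: pw => _; rewrite -ea; case/andP: (valP (al e)) => _ /eqP ->.
have <- : @hcomp k PC _ _ _ (<< exist _ p pw' >> : @hom k PC (y e) v) (hal e) =
    << exist _ (a :: p) pw >>.
  rewrite [LHS]pcompU; congr (<< _ >>); apply: val_inj => /=.
  by rewrite ea.
exact: (@splits_first_comp k PC s E y hal).
Qed.

Lemma out_uniq v (h : forall e, @hom k PC (y e) v) :
  \sum_e hcomp (h e) (hal e) = 0 -> forall e, h e = 0.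
Proof.
move=> h0; apply: (@mlift_family_inj k E (fun e => qpath (y e) v) (qpath s v)
  (fun e p => pcat (parrow (al e)) p) h).
- by move=> e q q' /(congr1 val) /= [qq']; apply: val_inj.
- by move=> e e' p p' /(congr1 val) /= [/al_inj ee' _].
by rewrite -[RHS]h0; apply: eq_bigr => e _; rewrite -pcomp_arrowr.
Qed.

Definition out_first_arrow : @first_arrow k PC s := FirstArrow out_split out_uniq.

End OutArrows.

Section InArrows.
Variables (s : vert Q) (E : finType) (y : E -> vert Q) (al : forall e, arrow (y e) s).
Hypothesis al_all : forall a : arr Q, tgt a = s -> exists e, val (al e) = a.
Hypothesis al_inj : forall e e', val (al e) = val (al e') -> e = e'.

Let hal e : @hom k (opcat PC) s (y e) := << parrow (al e) >>.

Lemma in_split v (f : @hom k (opcat PC) s v) : splits_first hal f.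
Proof.
move: f; apply: malg_ind; [exact (@splits_first0 k (opcat PC) s E y hal v)|
  exact (@splits_firstD k (opcat PC) s E y hal v)|
  exact (@splits_firstZ k (opcat PC) s E y hal v)|].
case=> p pw; case/lastP: p pw => [|p a] pw.
  have sv := eqP pw; subst v.
  have <- : @idm k PC s = << exist _ [::] pw >> by congr (<< _ >>); apply: val_inj.
  exact: (@splits_first_id k (opcat PC) s E y hal).
have [e ea] : exists e, val (al e) = a.
  by apply: al_all; move: pw; rewrite walk_rcons => /andP[_ /eqP].
have pw' : walk v p (y e).
  by move: pw; rewrite walk_rcons -ea => /andP[+ _]; case/andP: (valP (al e)) => /eqP ->.
have <- : @hcomp k (opcat PC) _ _ _ (<< exist _ p pw' >> : @hom k (opcat PC) (y e) v) (hal e) =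
    << exist _ (rcons p a) pw >>.
  rewrite [LHS]pcompU; congr (<< _ >>); apply: val_inj => /=.
  by rewrite ea cats1.
exact: (@splits_first_comp k (opcat PC) s E y hal).
Qed.

Lemma in_uniq v (h : forall e, @hom k (opcat PC) (y e) v) :
  \sum_e hcomp (h e) (hal e) = 0 -> forall e, h e = 0.
Proof.
move=> h0; apply: (@mlift_family_inj k E (fun e => qpath v (y e)) (qpath v s)
  (fun e p => pcat p (parrow (al e))) h).
- move=> e q q' /(congr1 val) /=; rewrite !cats1 => /rcons_inj [qq'].
  exact: val_inj.
- by move=> e e' p p' /(congr1 val) /=; rewrite !cats1 => /rcons_inj [_ /al_inj].
by rewrite -[RHS]h0; apply: eq_bigr => e _; rewrite -pcomp_arrowl.
Qed.

Definition in_first_arrow : @first_arrow k (opcat PC) s := FirstArrow in_split in_uniq.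

End InArrows.
End Paths.

(** * Exactness of the mesh sequences of R_C *)

Section ConfigurationCategory.
Variables (k : fieldType) (Q : finquiver) (C : set (vert (repetition Q))).
Local Notation ZQ0 := (vert (repetition Q)).
Local Notation ZQf := (repetition (framed Q)).
Local Notation PC := (pathcat k ZQf).
Local Notation RCC := (RC k C).

Variant RC_relation : forall x y : PC, hom x y -> Prop :=
| RCMesh x y (f : @hom k PC x y) : mesh_relation f -> RC_relation f
| RCKill (y : ZQ0) : ~ (@sigma_inv Q @` C) (frozen y) -> RC_relation (@idm k PC (frozen y)).

Definition RC_class (x y : vert ZQf) (f : @hom k PC x y) : @hom k RCC x y := qclass2 _ f.

Lemma RC_class_functor : @quotient_functor k PC RC_relation RCC (fun x => x) RC_class.
Proof.
apply: qclass2_functor.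
- by move=> x y f; apply: RCMesh.
- move=> x y f; move e : (qclass _ f) => fb Gf.
  case: Gf f e => z nz f e.
  rewrite -[f](subrK (@idm k PC (frozen z))); apply: idealD; last exact/ideal_gen/RCKill.
  have /qpiP/asboolP : qpi (ideal_sub (@mesh_relation k Q) _ _) f = qpi (ideal_sub _ _ _) (@idm k PC (frozen z)) := e.
  by apply: ideal_mono => x' y' g; apply: RCMesh.
- move=> x y f [x' y' g mg|z nz]; first by left.
  by right; apply: Killed.
Qed.

Let RC_class_linear x y : linear (@RC_class x y). Proof. exact: (qf_linear RC_class_functor (y:=y)). Qed.

(** The mesh that ends at x. Its arrows are indexed by the arrows into x. *)
Definition mesh_rgt (x : ZQ0) : vert ZQf := nonfrozen x.
Definition mesh_lft (x : ZQ0) : vert ZQf := tau (nonfrozen x).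
Definition mesh_mid (x : ZQ0) (e : arrows_into (nonfrozen x)) : vert ZQf := rsrc (val e, x.2).

Lemma in_arrow_proof (x : ZQ0) (e : arrows_into (nonfrozen x)) :
  (@src ZQf (val e, x.2) == mesh_mid e) && (@tgt ZQf (val e, x.2) == mesh_rgt x).
Proof. by rewrite eqxx /=; apply: (valP e). Qed.
Definition in_arrow (x : ZQ0) (e : arrows_into (nonfrozen x)) : arrow (mesh_mid e) (mesh_rgt x) :=
  exist _ (val e, x.2) (in_arrow_proof e).

Lemma out_arrow_proof (x : ZQ0) (e : arrows_into (nonfrozen x)) :
  (@src ZQf (sigma_arr (val e, x.2)) == mesh_lft x) && (@tgt ZQf (sigma_arr (val e, x.2)) == mesh_mid e).
Proof.
rewrite /mesh_mid /mesh_lft; case: x e => i p [[a|a] /= /eqP [e]]; rewrite /tau /= ?e ?eqxx //.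
Qed.
Definition out_arrow (x : ZQ0) (e : arrows_into (nonfrozen x)) : arrow (mesh_lft x) (mesh_mid e) :=
  exist _ (sigma_arr (val e, x.2)) (out_arrow_proof e).

Lemma in_arrow_all (x : ZQ0) (b : arr ZQf) : tgt b = mesh_rgt x -> exists e, val (@in_arrow x e) = b.
Proof.
move=> hb; have e2 : b.2 = x.2 by move: (congr1 snd hb); case: b {hb} => [[a|a] p].
have h : rtgt (b.1, x.2) == nonfrozen x by rewrite -e2 -surjective_pairing; apply/eqP.
by exists (exist _ b.1 h); rewrite /= -e2 -surjective_pairing.
Qed.

Lemma in_arrow_inj (x : ZQ0) (e e' : arrows_into (nonfrozen x)) :
  val (in_arrow e) = val (in_arrow e') -> e = e'.
Proof. by move=> [ee]; apply: val_inj. Qed.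

Lemma out_arrow_all (x : ZQ0) (b : arr ZQf) : src b = mesh_lft x -> exists e, val (@out_arrow x e) = b.
Proof.
case: x => i p; case: b => [[a|a] q] /= [e1 e2].
  have h : @rtgt (framed Q) (inr a, p) == (inl i, p) by rewrite /= e1.
  by exists (exist _ (inr a) h); rewrite /= e2.
have e3 : q = p by rewrite -[q](subrK 1) e2 subrK.
have h : @rtgt (framed Q) (inl a, p) == (inl i, p) by rewrite /= e1.
by exists (exist _ (inl a) h); rewrite /= e3.
Qed.

Lemma out_arrow_inj (x : ZQ0) (e e' : arrows_into (nonfrozen x)) :
  val (out_arrow e) = val (out_arrow e') -> e = e'.
Proof.
by case: e e' => [[a|a] h] [[b|b] h'] //= [ab]; apply: val_inj; rewrite /= ab.
Qed.

Lemma nonfrozen_inj (x y : ZQ0) : tau (nonfrozen x) = tau (nonfrozen y) -> x = y.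
Proof. by case: x y => [i p] [j q] [-> /addIr ->]. Qed.

Definition mesh_in x e : @hom k RCC (@mesh_mid x e) (mesh_rgt x) := RC_arrow k C (in_arrow e).
Definition mesh_out x e : @hom k RCC (mesh_lft x) (@mesh_mid x e) := RC_arrow k C (out_arrow e).

Lemma mesh_relator_out (x : ZQ0) (al : forall e, arrow (mesh_lft x) (@mesh_mid x e)) :
  (forall e, val (al e) = sigma_arr (val e, x.2)) ->
  mesh_relator k (nonfrozen x) =
  \sum_e @hcomp k PC _ _ _ << parrow (in_arrow e) >> << parrow (al e) >>.
Proof.
move=> ale; apply: eq_bigr => e _; rewrite [RHS]pcompU; congr (<< _ >>).
by apply: val_inj; rewrite /= ale.
Qed.

Lemma mesh_relator_in (x : ZQ0) (al : forall e, arrow (@mesh_mid x e) (mesh_rgt x)) :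
  (forall e, val (al e) = (val e, x.2)) ->
  mesh_relator k (nonfrozen x) =
  \sum_e @hcomp k PC _ _ _ << parrow (al e) >> << parrow (out_arrow e) >>.
Proof.
move=> ale; apply: eq_bigr => e _; rewrite [RHS]pcompU; congr (<< _ >>).
by apply: val_inj; rewrite /= ale.
Qed.

(** The vertex s is kept general, with an equation, so that one can reason by
    cases on the relation. A relation that starts at tau x is the mesh relator of
    x; its coefficients are the arrows into x, that is, g is the identity. *)
Lemma RC_relation_out s w (f : @hom k PC s w) : RC_relation f ->
  forall x : ZQ0, s = mesh_lft x -> forall al : forall e, arrow s (@mesh_mid x e),
  (forall e, val (al e) = sigma_arr (val e, x.2)) ->
  exists2 h : forall e, @hom k PC (@mesh_mid x e) w,
    f = \sum_e @hcomp k PC _ _ _ (h e) << parrow (al e) >> &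
    exists g, forall e, RC_class (h e) = hcomp g (mesh_in e).
Proof.
case=> [s' w' f' [y] x /nonfrozen_inj <- al ale|y ny x].
  exists (fun e => << parrow (in_arrow e) >>); first exact: mesh_relator_out.
  by exists (idm _) => e; rewrite comp1m.
by case.
Qed.

Lemma RC_relation_in w s (f : @hom k PC w s) : RC_relation f ->
  forall x : ZQ0, s = mesh_rgt x -> forall al : forall e, arrow (@mesh_mid x e) s,
  (forall e, val (al e) = (val e, x.2)) ->
  exists2 h : forall e, @hom k PC w (@mesh_mid x e),
    f = \sum_e @hcomp k PC _ _ _ << parrow (al e) >> (h e) &
    exists g, forall e, RC_class (h e) = hcomp (mesh_out e) g.
Proof.
case=> [w' s' f' [y] x|y ny x]; last by case.
move=> /(congr1 (@tau _))/nonfrozen_inj <- al ale.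
exists (fun e => << parrow (out_arrow e) >>); first exact: mesh_relator_in.
by exists (idm _) => e; rewrite compm1.
Qed.

Definition out_data (x : ZQ0) : @first_arrow k PC (mesh_lft x) :=
  out_first_arrow k (@out_arrow_all x) (@out_arrow_inj x).
Definition in_data (x : ZQ0) : @first_arrow k (opcat PC) (mesh_rgt x) :=
  in_first_arrow k (@in_arrow_all x) (@in_arrow_inj x).

Let RC_op_relation x y (f : @hom k (opcat PC) x y) := @RC_relation y x f.
Let RC_class_op := @op_quotient_functor k PC RC_relation RCC (fun x => x) RC_class RC_class_functor.

(** Exactness of R_C(x, w) -> sum of the R_C(y, w) -> R_C(tau x, w): a relation
    starting at tau x consists of multiples of the mesh relator. *)
Lemma RC_mid_out (x : ZQ0) w (g : forall e, @hom k RCC (@mesh_mid x e) w) :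
  \sum_e hcomp (g e) (mesh_out e) = 0 -> exists h, forall e, g e = hcomp h (mesh_in e).
Proof.
pose P w (h : forall e, @hom k PC (@mesh_mid x e) w) :=
  exists g : @hom k RCC (mesh_rgt x) w, forall e, RC_class (h e) = hcomp g (mesh_in e).
have gP : @good_family k PC RC_relation (mesh_lft x) (out_data x) P.
  split=> [v h h' [u hu] [u' hu']|v a h [u hu]|v v' t h [u hu]|v h hI|v f Gf].
  - by exists (u + u') => e; rewrite (linD (@RC_class_linear _ _)) hu hu' (linD (comp_linearl _)).
  - by exists (a *: u) => e; rewrite (linZ (@RC_class_linear _ _)) hu (linZ (comp_linearl _)).
  - by exists (hcomp (RC_class t) u) => e; rewrite (qf_comp RC_class_functor) hu compA.
  - exists 0 => e; rewrite comp0m; exact: (proj2 (qf_ker RC_class_functor _) (hI e)).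
  - exact: (RC_relation_out Gf).
move=> g0; have [h [u hu] hg] := @qf_exact k PC RC_relation RCC _ RC_class RC_class_functor _ (out_data x) P w g gP g0.
by exists u => e; rewrite -hg hu.
Qed.

Lemma RC_mid_in (x : ZQ0) w (g : forall e, @hom k RCC w (@mesh_mid x e)) :
  \sum_e hcomp (mesh_in e) (g e) = 0 -> exists h, forall e, g e = hcomp (mesh_out e) h.
Proof.
pose P w (h : forall e, @hom k (opcat PC) (@mesh_mid x e) w) :=
  exists g : @hom k RCC w (mesh_lft x), forall e, @RC_class w (@mesh_mid x e) (h e) = hcomp (mesh_out e) g.
have gP : @good_family k (opcat PC) RC_op_relation (mesh_rgt x) (in_data x) P.
  split=> [v h h' [u hu] [u' hu']|v a h [u hu]|v v' t h [u hu]|v h hI|v f Gf].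
  - by exists (u + u') => e; rewrite (linD (@RC_class_linear _ _)) hu hu' (linD (comp_linearr _)).
  - by exists (a *: u) => e; rewrite (linZ (@RC_class_linear _ _)) hu (linZ (comp_linearr _)).
  - exists (hcomp u (RC_class (t : @hom k PC v' v))) => e.
    by rewrite [LHS](@qf_comp _ _ _ _ _ _ RC_class_functor) hu compA.
  - exists 0 => e; rewrite compm0; apply/(qf_ker RC_class_functor).
    exact: (@ideal_op_inv k PC RC_relation _ _ _ (hI e)).
  - exact: (RC_relation_in Gf).
move=> g0; have [h [u hu] hg] := @qf_exact k (opcat PC) RC_op_relation (opcat RCC) _ _ RC_class_op _ (in_data x) P w g gP g0.
by exists u => e; rewrite -hg hu.
Qed.

Lemma RC_surj_out (x : ZQ0) w (f : @hom k RCC (mesh_lft x) w) : w <> mesh_lft x ->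
  exists g : forall e, @hom k RCC (@mesh_mid x e) w, f = \sum_e hcomp (g e) (mesh_out e).
Proof. exact: (@qf_surj k PC RC_relation RCC _ RC_class RC_class_functor _ (out_data x)). Qed.

Lemma RC_surj_in (x : ZQ0) w (f : @hom k RCC w (mesh_rgt x)) : w <> mesh_rgt x ->
  exists g : forall e, @hom k RCC w (@mesh_mid x e), f = \sum_e hcomp (mesh_in e) (g e).
Proof. exact: (@qf_surj k (opcat PC) RC_op_relation (opcat RCC) _ _ RC_class_op _ (in_data x)). Qed.

Lemma RC_mesh (x : ZQ0) : \sum_e hcomp (@mesh_in x e) (mesh_out e) = 0.
Proof.
transitivity (RC_class (mesh_relator k (nonfrozen x))); last first.
  by apply/(qf_ker RC_class_functor)/ideal_gen/RCMesh/Mesh.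
rewrite (@mesh_relator_out x (@out_arrow x)) // (lin_sum (@RC_class_linear _ _)).
by apply: eq_bigr => e _; rewrite (qf_comp RC_class_functor).
Qed.

Hypothesis adm : admissible k C.

(** Admissibility, for the vertex tau x; the arrows that start at tau x are the
    arrows of the mesh of x. *)
Lemma RC_inj_in (x : ZQ0) w (f : @hom k RCC w (mesh_lft x)) :
  (forall e, hcomp (@mesh_out x e) f = 0) -> f = 0.
Proof.
move=> f0; have [H _] := adm (x.1, x.2 - 1).
apply: (H w f) => y [b hb]; have [e eb] := @out_arrow_all x b (eqP (proj1 (andP hb))).
have ey : y = mesh_mid e.
  have /andP[_ /eqP h1] := valP (out_arrow e); apply: etrans h1; rewrite eb.
  by case/andP: hb => _ /eqP.
subst y; rewrite (_ : exist _ b hb = out_arrow e) ?f0 //.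
by apply: val_inj.
Qed.

Lemma RC_inj_out (x : ZQ0) w (f : @hom k RCC (mesh_rgt x) w) :
  (forall e, hcomp f (@mesh_in x e) = 0) -> f = 0.
Proof.
move=> f0; have [_ H] := adm x.
apply: (H w f) => y [b hb]; have [e eb] := @in_arrow_all x b (eqP (proj2 (andP hb))).
have ey : y = mesh_mid e.
  have /andP[/eqP h1 _] := valP (in_arrow e); apply: etrans h1; rewrite eb.
  by case/andP: hb => /eqP.
subst y; rewrite (_ : exist _ b hb = in_arrow e) ?f0 //.
by apply: val_inj.
Qed.

(** A frozen vertex is the target of one arrow and the source of one arrow, and
    no mesh relator starts or ends there. *)
Section Frozen.
Variable y : ZQ0.
Let v : vert ZQf := frozen y.
Let x : ZQ0 := (y.1, y.2 + 1).

Lemma frozen_out_proof : (@src ZQf (inr (inr y.1), y.2 + 1) == v) && (@tgt ZQf (inr (inr y.1), y.2 + 1) == mesh_rgt x).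
Proof. by rewrite /= addrK !eqxx. Qed.
Definition frozen_out : arrow v (mesh_rgt x) := exist _ (inr (inr y.1), y.2 + 1) frozen_out_proof.
Lemma frozen_in_proof : (@src ZQf (inl (inr y.1), y.2) == nonfrozen y) && (@tgt ZQf (inl (inr y.1), y.2) == v).
Proof. by rewrite /= !eqxx. Qed.
Definition frozen_in : arrow (nonfrozen y) v := exist _ (inl (inr y.1), y.2) frozen_in_proof.

Lemma frozen_out_all (b : arr ZQf) : src b = v -> exists e : unit, val frozen_out = b.
Proof.
case: b => [[[a|j]|[a|j]] q] //= [e1 e2]; exists tt.
by rewrite -e1 -e2 subrK.
Qed.
Lemma frozen_in_all (b : arr ZQf) : tgt b = v -> exists e : unit, val frozen_in = b.
Proof.
case: b => [[[a|j]|[a|j]] q] //= [e1 e2]; exists tt.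
by rewrite -e1 -e2.
Qed.

Definition frozen_out_data : @first_arrow k PC v :=
  @out_first_arrow k ZQf v unit (fun _ => mesh_rgt x) (fun _ => frozen_out) frozen_out_all
    (fun e e' _ => match e, e' with tt, tt => erefl end).
Definition frozen_in_data : @first_arrow k (opcat PC) v :=
  @in_first_arrow k ZQf v unit (fun _ => nonfrozen y) (fun _ => frozen_in) frozen_in_all
    (fun e e' _ => match e, e' with tt, tt => erefl end).

Hypothesis vC : (@sigma_inv Q @` C) v.

Lemma frozen_out_inj w (g : @hom k RCC (mesh_rgt x) w) : hcomp g (RC_arrow k C frozen_out) = 0 -> g = 0.
Proof.
move=> g0.
pose P w (h : forall e : unit, @hom k PC (mesh_rgt x) w) := forall e, RC_class (h e) = 0.
have gP : @good_family k PC RC_relation v frozen_out_data P.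
  split=> [u h h' Ph Ph' e|u a h Ph e|u u' t h Ph e|u h hI e|u f Gf].
  - by rewrite (linD (@RC_class_linear _ _)) Ph Ph' addr0.
  - by rewrite (linZ (@RC_class_linear _ _)) Ph scaler0.
  - by rewrite (qf_comp RC_class_functor) Ph compm0.
  - exact: (proj2 (qf_ker RC_class_functor _) (hI e)).
  - have K s w' (f' : @hom k PC s w') : RC_relation f' -> s <> v.
      by case=> [s' w'' f'' [z]|z nz] // e; apply: nz; rewrite e.
    by case: (K _ _ _ Gf).
have [|h Ph hg] := @qf_exact k PC RC_relation RCC _ RC_class RC_class_functor _ frozen_out_data P w (fun _ => g) gP.
  by rewrite -[RHS]g0 /= (big_pred1 tt) // => -[].
by rewrite -(hg tt).
Qed.

Lemma frozen_in_inj w (g : @hom k RCC w (nonfrozen y)) : hcomp (RC_arrow k C frozen_in) g = 0 -> g = 0.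
Proof.
move=> g0.
pose P w (h : forall e : unit, @hom k (opcat PC) (nonfrozen y) w) := forall e, @RC_class w _ (h e) = 0.
have gP : @good_family k (opcat PC) RC_op_relation v frozen_in_data P.
  split=> [u h h' Ph Ph' e|u a h Ph e|u u' t h Ph e|u h hI e|u f Gf].
  - by rewrite (linD (@RC_class_linear _ _)) Ph Ph' addr0.
  - by rewrite (linZ (@RC_class_linear _ _)) Ph scaler0.
  - by rewrite [LHS](@qf_comp _ _ _ _ _ _ RC_class_functor) Ph comp0m.
  - apply/(qf_ker RC_class_functor); exact: (@ideal_op_inv k PC RC_relation _ _ _ (hI e)).
  - have K s w' (f' : @hom k PC w' s) : RC_relation f' -> s <> v.
      by case=> [s' w'' f'' [z]|z nz] // e; apply: nz; rewrite e.
    by case: (K _ _ _ Gf).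
have [|h Ph hg] := @qf_exact k (opcat PC) RC_op_relation (opcat RCC) _ _ RC_class_op _ frozen_in_data P w (fun _ => g) gP.
  by rewrite -[RHS]g0 /= (big_pred1 tt) // => -[].
by rewrite -(hg tt); apply: Ph.
Qed.

Lemma frozen_out_surj w (f : @hom k RCC v w) : w <> v ->
  exists g, f = hcomp g (RC_arrow k C frozen_out).
Proof.
move=> /(@qf_surj k PC RC_relation RCC _ RC_class RC_class_functor _ frozen_out_data _ f) [h ->].
by exists (h tt); rewrite (big_pred1 tt) // => -[].
Qed.

Lemma frozen_in_surj w (f : @hom k RCC w v) : w <> v ->
  exists g, f = hcomp (RC_arrow k C frozen_in) g.
Proof.
move=> /(@qf_surj k (opcat PC) RC_op_relation (opcat RCC) _ _ RC_class_op _ frozen_in_data _ f) [h ->].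
by exists (h tt); rewrite (big_pred1 tt) // => -[].
Qed.

End Frozen.

End ConfigurationCategory.

(** * Heights and finiteness *)

Section Heights.
Variables (k : fieldType) (Q : finquiver) (C : set (vert (repetition Q))).
Variable l : Q0 Q -> int.
Hypothesis l_arr : forall a : Q1 Q, l (ftgt a) = l (fsrc a) + 1.
Local Notation ZQ0 := (vert (repetition Q)).
Local Notation ZQf := (repetition (framed Q)).
Local Notation PC := (pathcat k ZQf).
Local Notation RCC := (RC k C).

(** The added vertices i' of the framed quiver are the targets of arrows i -> i'. *)
Definition level (v : Q0 (framed Q)) : int :=
  match v with inl i => l i | inr i => l i + 1 end.

(** The factor 2 makes the arrows (j, p - 1) -> (i, p) raise the height by 1,
    as do the arrows (i, p) -> (j, p). *)
Definition vheight (x : vert ZQf) : int := x.2 *+ 2 + level x.1.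

Lemma vheight_arr (b : arr ZQf) : vheight (tgt b) = vheight (src b) + 1.
Proof.
have hl (a : Q1 (framed Q)) : level (ftgt a) = level (fsrc a) + 1.
  by case: a => //= a; apply: l_arr.
case: b => [[a|a] p]; rewrite /vheight /= hl; first by rewrite addrA.
by rewrite mulrnBl; move: (p *+ 2) (level _) => ? ?; lia.
Qed.

Lemma vheight_arrow x y (a : arrow x y) : vheight y = vheight x + 1.
Proof. by case: a => b /andP[/eqP <- /eqP <-]; apply: vheight_arr. Qed.

Lemma vheight_arrow_lt x y (a : arrow x y) : (vheight x < vheight y)%R.
Proof. by rewrite (vheight_arrow a); lia. Qed.

Lemma vheight_walk s x y : @walk ZQf x s y -> vheight y = vheight x + (size s)%:Z.
Proof.
elim: s x => [|b s IH] x /=; first by move=> /eqP ->; rewrite addr0.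
by case/andP=> /eqP <- /IH ->; rewrite vheight_arr -addrA -intS.
Qed.

Lemma vheight_lft (x : ZQ0) : vheight (mesh_lft x) = vheight (mesh_rgt x) - 2.
Proof. by rewrite /vheight /= mulrnBl; move: (x.2 *+ 2) (l _) => ? ?; lia. Qed.

Lemma vheight_mid (x : ZQ0) (e : arrows_into (nonfrozen x)) : vheight (mesh_mid e) = vheight (mesh_lft x) + 1.
Proof. exact: (vheight_arrow (out_arrow e)). Qed.

Let RC_class_linear x y : linear (@RC_class k Q C x y). Proof. exact: (qf_linear (@RC_class_functor k Q C) (y:=y)). Qed.

Lemma RC_hom_neq0 x y (f : @hom k RCC x y) : f <> 0 -> x = y \/ (vheight x < vheight y)%R.
Proof.
move=> fn; apply: contrapT => no; apply: fn.
have [g <-] := qf_full (@RC_class_functor k Q C) f.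
suff -> : g = 0 by apply: (lin0 (@RC_class_linear x y)).
apply: malg0 => -[[|b s] w]; apply: no; first by left; apply/eqP.
by right; rewrite (vheight_walk w) /=; lia.
Qed.

Lemma RC_end x (f : @hom k RCC x x) : exists a : k, f = a *: idm x.
Proof.
have [g <-] := qf_full (@RC_class_functor k Q C) f.
move: g; apply: malg_ind => [|g h [a ga] [b hb]|a g [b gb]|[[|b s] w]].
- by exists 0; rewrite scale0r; apply: (lin0 (@RC_class_linear x x)).
- exists (a + b); rewrite scalerDl -ga -hb; exact: (linD (@RC_class_linear x x)).
- exists (a * b); rewrite -scalerA -gb; exact: (linZ (@RC_class_linear x x)).
- have -> : << exist _ [::] w >> = @idm k PC x by congr (<< _ >>); apply: val_inj.
  by exists 1; rewrite scale1r; apply: (qf_id (@RC_class_functor k Q C)).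
by exfalso; have := vheight_walk w; rewrite /=; lia.
Qed.

Lemma vertexP (x : vert ZQf) : (exists y : ZQ0, x = mesh_lft y) \/ (exists y : ZQ0, x = frozen y).
Proof.
case: x => [[i|i] p]; last by right; exists (i, p).
by left; exists (i, p + 1); rewrite /mesh_lft /tau /= addrK.
Qed.

Lemma RC_fd x y : finite_dim (@hom k RCC x y).
Proof.
have fd0 (a b : vert ZQf) : (forall f : @hom k RCC a b, f = 0) -> finite_dim (@hom k RCC a b).
  move=> z; exists 0%N, (fun i => 0) => v; exists (fun i => 0).
  by rewrite big_ord0; apply: z.
have fd1 a : finite_dim (@hom k RCC a a).
  exists 1%N, (fun i => idm a) => f; have [c ->] := RC_end f.
  by exists (fun i => c); rewrite big_ord1.
have F n : forall x y, (vheight y < vheight x + n%:Z)%R -> finite_dim (@hom k RCC x y).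
  elim: n => [|n IH] {}x {}y hxy.
    apply: fd0 => f; apply: contrapT => /RC_hom_neq0 [e|h]; last by move: h hxy; lia.
    by move: hxy; rewrite e; lia.
  have [<-|ne] := pselect (y = x); first exact: fd1.
  have [[z xz]|[z xz]] := vertexP x; subst x.
  - pose W : lmodType k := lprod (fun e : arrows_into (nonfrozen z) => @hom k RCC (mesh_mid e) y).
    pose j (g : W) := \sum_e hcomp (g e) (mesh_out k C e).
    apply: (@finite_dim_image k W _ j).
    + exact: (@sum_comp_linear k RCC).
    + by move=> f; have [g ->] := RC_surj_out f ne; exists g.
    apply: finite_dim_prod => e; apply: IH.
    by rewrite vheight_mid; move: hxy; lia.
  apply: (@finite_dim_image k _ _ (fun g => hcomp g (RC_arrow k C (frozen_out z)))).
  - exact: (@comp_linearl k RCC _ _ _ (RC_arrow k C (frozen_out z))).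
  - by move=> f; have [g ->] := frozen_out_surj f ne; exists g.
  by apply: IH; rewrite (vheight_arrow (frozen_out z)); move: hxy; lia.
apply: (F (absz (vheight y - vheight x)).+1); lia.
Qed.

Definition index_of (v : Q0 (framed Q)) : Q0 Q := match v with inl i => i | inr i => i end.

(** The lexicographic order by height and by the index of the vertex of Q. *)
Definition vrank (x : vert ZQf) : int :=
  vheight x * (#|Q0 Q|)%:Z + (enum_rank (index_of x.1) : nat)%:Z.

Lemma vrank_lt x y : (vheight x < vheight y)%R -> (vrank x < vrank y)%R.
Proof.
rewrite /vrank => h; have := ltn_ord (enum_rank (index_of x.1)).
set a := nat_of_ord (enum_rank _); set b := nat_of_ord (enum_rank _).
by set n := #|_|; move: (vheight x) (vheight y) a b n h => s t a b n; nia.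
Qed.

Lemma vrank_inj (x y : ZQ0) : vrank (frozen x) = vrank (frozen y) -> x = y.
Proof.
move=> e.
have h : vheight (frozen x) = vheight (frozen y).
  apply/eqP; rewrite eq_le !leNgt; apply/andP; split; apply/negP => /vrank_lt.
    by rewrite e ltxx.
  by rewrite e ltxx.
move: e; rewrite /vrank h => /addrI [] /val_inj/enum_rank_inj /= e1.
move: h; rewrite /vheight /= e1 => /addIr e2.
have dbl (a b : int) : a *+ 2 = b *+ 2 -> a = b by rewrite !mulr2n; lia.
have e3 : x.2 = y.2 := dbl _ _ e2.
by case: x y e1 e3 {e2} => [i p] [j q] /= -> ->.
Qed.

Hypothesis adm : admissible k C.

Definition RC_data : mesh_data k :=
  @MeshData k RCC (@sigma_inv Q @` C) ZQ0 (@mesh_lft Q) (@mesh_rgt Q)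
    (fun x => arrows_into (nonfrozen x)) (@mesh_mid Q) (@mesh_out k Q C) (@mesh_in k Q C) vheight vrank.

Lemma RC_killed (y : ZQ0) : ~ (@sigma_inv Q @` C) (frozen y) -> @idm k RCC (frozen y) = 0.
Proof.
move=> ny; rewrite -(qf_id (@RC_class_functor k Q C)).
by apply/(qf_ker (@RC_class_functor k Q C))/ideal_gen/RCKill.
Qed.

Lemma RC_left : mesh_left RC_data.
Proof.
split.
  + by move=> m w f; apply: RC_inj_in.
  + by move=> m w f; apply: RC_mid_in.
  + by move=> m w f; apply: RC_surj_in.
  + move=> y; have [[x ->]|[x ->]] := vertexP y; first by apply: Or33; exists x.
    have [a|na] := pselect ((@sigma_inv Q @` C) (frozen x)); first exact: Or31.
    exact/Or32/RC_killed.
  + move=> _ [x Cx <-]; exists (x.1, x.2 + 1), (RC_arrow k C (frozen_out x)); split.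
    * by move=> w g; apply: frozen_out_inj; exists x.
    * by move=> w f; apply: frozen_out_surj.
    * move=> g; apply: contrapT => /RC_hom_neq0 []; first by case.
      by move=> /(lt_trans (vheight_arrow_lt (frozen_out x))); rewrite ltxx.
  + by move=> m [x _]; case.
  + by move=> m e; apply: (vheight_arrow_lt (out_arrow e)).
Qed.

Lemma RC_right : mesh_left (op_data RC_data).
Proof.
split.
  + by move=> m w f; apply: RC_inj_out.
  + by move=> m w f; apply: RC_mid_out.
  + by move=> m w f; apply: RC_surj_out.
  + move=> -[[i|i] p]; first by apply: Or33; exists (i, p).
    have [a|na] := pselect ((@sigma_inv Q @` C) (frozen (i, p))); first exact: Or31.
    exact/Or32/(RC_killed na).
  + move=> _ [x Cx <-]; exists (x.1, x.2 + 1).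
    have e : mesh_lft (x.1, x.2 + 1) = nonfrozen x by rewrite /mesh_lft /tau /= addrK.
    have h : (@src ZQf (inl (inr x.1), x.2) == mesh_lft (x.1, x.2 + 1)) &&
             (@tgt ZQf (inl (inr x.1), x.2) == frozen x) by rewrite e /= !eqxx.
    pose a : arrow (mesh_lft (x.1, x.2 + 1)) (frozen x) := exist _ (inl (inr x.1), x.2) h.
    have P (z : vert ZQf) (ez : z = nonfrozen x) (c : arrow z (frozen x)) :
        val c = (inl (inr x.1), x.2) ->
        [/\ forall w (g : @hom k RCC w z), hcomp (RC_arrow k C c) g = 0 -> g = 0 &
            forall w (f : @hom k RCC w (frozen x)), w <> frozen x ->
              exists g, f = hcomp (RC_arrow k C c) g].
      move: c; rewrite ez => c vc.
      have -> : c = frozen_in x by apply: val_inj.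
      by split; [move=> w g; apply: frozen_in_inj; exists x|apply: frozen_in_surj].
    have [P1 P2] := P _ e a erefl.
    exists (RC_arrow k C a); split=> //.
    move=> g; apply: contrapT => /RC_hom_neq0 []; first by case.
    by move=> /(lt_trans (vheight_arrow_lt a)); rewrite ltxx.
  + by move=> m [x _]; case.
  + by move=> m e; rewrite /= ltrN2; apply: (vheight_arrow_lt (in_arrow e)).
Qed.

Hypothesis nilpotent : exists N : nat, forall (z w : RC_data) (f : hom z w),
  (height z + N%:Z <= height w)%R -> through (@alive k RC_data) f.

Lemma RC_mesh_cat : mesh_cat RC_data.
Proof.
split.
- exact: RC_left.
- exact: RC_right.
- exact: RC_mesh.
- exact: RC_fd.
- by move=> v f _; apply: RC_end.
- by move=> _ _ [x _ <-] [y _ <-] /vrank_inj ->.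
- move=> u v f _ _ h; apply: contrapT => /RC_hom_neq0 [e|/vrank_lt]; move: h => /=.
    by rewrite e ltxx.
  by move=> /lt_trans h /h; rewrite ltxx.
exact: nilpotent.
Qed.

End Heights.

(** * Morphisms modulo those through frozen vertices *)
Section ThroughSub.
Variables (k : fieldType) (A : lincat k) (U : set A).

Lemma throughZ (x y : A) (a : k) (f : hom x y) : through U f -> through U (a *: f).
Proof.
elim=> {y f} [y|y f g _ If _ Ig|v y g f Uv].
- by rewrite scaler0; apply: through0.
- by rewrite scalerDr; apply: throughD.
- by rewrite -(linZ (comp_linearl f)); apply: through_comp.
Qed.

Lemma through_compl (x y z : A) (g : hom y z) (f : hom x y) :
  through U f -> through U (hcomp g f).
Proof.
move=> t; elim: t g => {y f} [y|y f f' _ If _ If'|v y h f Uv] g.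
- by rewrite compm0; apply: through0.
- by rewrite (linD (comp_linearr g)); apply: throughD; [apply: If|apply: If'].
- by rewrite compA; apply: through_comp.
Qed.

Definition through_sub (x y : A) : submodule (hom x y) :=
  Submodule (through0 U x y) (@throughD k A U x y) (@throughZ x y).

End ThroughSub.

(** The part of the hypotheses from which mc_nilpotent will be derived, with
    heights that increase by exactly 1 along the arrows. *)
Record graded_mesh_cat k (D : mesh_data k) : Prop := {
  gm_left : mesh_left D;
  gm_right : mesh_left (op_data D);
  gm_mesh : forall m : mesh D, \sum_(e : midx m) hcomp (ma e) (mb e) = 0;
  gm_fd : forall x y : D, finite_dim (hom x y);
  gm_hom : forall (x y : D) (f : hom x y), f <> 0 -> x = y \/ (height x < height y)%R;
  gm_end : forall (x : D) (f : hom x x), exists a : k, f = a *: idm x;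
  gm_mid : forall (m : mesh D) (e : midx m), height (mid e) = height (lft m) + 1;
  gm_rgt : forall m : mesh D, height (rgt m) = height (lft m) + 2 }.

Section Stable.
Variables (k : fieldType) (D : mesh_data k).
Hypothesis H : graded_mesh_cat D.
Let L := gm_left H.
Let R := gm_right H.
Let mesh0 := gm_mesh H.
Let fd := gm_fd H.
Let hom_ht := gm_hom H.
Let hom_end := gm_end H.
Let ht_mid := gm_mid H.
Let ht_rgt := gm_rgt H.
Variable z : D.
Local Notation T := (height z).

(** The functor F = R(z, ?) modulo the morphisms through alive vertices; it is a
    module over the mesh category of ZQ, generated by the identity of z. *)
Definition stable (w : D) : lmodType k := lquot (through_sub (@alive k D) z w).
Definition stable_class (w : D) (f : hom z w) : stable w := qpi (through_sub (@alive k D) z w) f.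
Definition stable_map (w w' : D) (g : hom w w') (y : stable w) : stable w' := stable_class (hcomp g (qrepr y)).

Lemma stable_class_linear w : linear (@stable_class w). Proof. exact: qpi_linear. Qed.
Lemma stable_class_eq w (f g : hom z w) : stable_class f = stable_class g <-> through (@alive k D) (f - g).
Proof. by split=> [/qpiP/asboolP|h]; last exact/qpiP/asboolP. Qed.
Lemma stable_class0 w (f : hom z w) : stable_class f = 0 <-> through (@alive k D) f.
Proof. by rewrite -(lin0 (@stable_class_linear w)) stable_class_eq subr0. Qed.
Lemma stable_class_surj w (y : stable w) : exists f, stable_class f = y.
Proof. by exists (qrepr y); apply: qpiK. Qed.

Lemma stable_mapE w w' (g : hom w w') (f : hom z w) : stable_map g (stable_class f) = stable_class (hcomp g f).
Proof.
apply/stable_class_eq; rewrite -(linB (comp_linearr g)); apply: through_compl.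
by apply/stable_class_eq; apply: qpiK.
Qed.

Lemma stable_map_linear w w' (g : hom w w') : linear (stable_map g).
Proof.
move=> a x y; have [f <-] := stable_class_surj x; have [h <-] := stable_class_surj y.
by rewrite -stable_class_linear !stable_mapE comp_linearr stable_class_linear.
Qed.

Lemma stable_map_comp w w' w'' (g' : hom w' w'') (g : hom w w') y : stable_map (hcomp g' g) y = stable_map g' (stable_map g y).
Proof. by have [f <-] := stable_class_surj y; rewrite !stable_mapE compA. Qed.

Lemma stable_map_sum (E : finType) w w' (g : E -> hom w w') y : stable_map (\sum_e g e) y = \sum_e stable_map (g e) y.
Proof.
have [f <-] := stable_class_surj y; rewrite stable_mapE comp_suml (lin_sum (@stable_class_linear _)).
by apply: eq_bigr => e _; rewrite stable_mapE.
Qed.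

Lemma stable_map0 w w' y : stable_map (0 : hom w w') y = 0.
Proof. by have [f <-] := stable_class_surj y; rewrite stable_mapE comp0m (lin0 (@stable_class_linear _)). Qed.

Lemma stable_map_scalar w a y : stable_map (a *: idm w) y = a *: y.
Proof.
have [f <-] := stable_class_surj y.
by rewrite stable_mapE (linZ (comp_linearl f)) comp1m (linZ (@stable_class_linear _)).
Qed.

Lemma stable_alive w : alive w -> forall y : stable w, y = 0.
Proof.
move=> wA y; have [f <-] := stable_class_surj y; apply/stable_class0; rewrite -[f]comp1m.
exact: through_comp.
Qed.

Lemma stable_killed w : idm w = 0 -> forall y : stable w, y = 0.
Proof.
move=> w0 y; have [f <-] := stable_class_surj y; rewrite -[f]comp1m w0 comp0m.
exact: (lin0 (@stable_class_linear _)).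
Qed.

Lemma stable_or_lft w : (forall y : stable w, y = 0) \/ exists m, w = lft m.
Proof.
have [wA|w0|h] := ml_ob L w; last by right.
- by left; apply: stable_alive.
- by left; apply: stable_killed.
Qed.
Lemma stable_or_rgt w : (forall y : stable w, y = 0) \/ exists m : mesh D, w = rgt m.
Proof.
have [wA|w0|h] := ml_ob R w; last by right.
- by left; apply: stable_alive.
- by left; apply: stable_killed.
Qed.

Lemma stable_low w : (height w <= T)%R -> w <> z -> forall y : stable w, y = 0.
Proof.
move=> hw wz y; have [f <-] := stable_class_surj y.
suff -> : f = 0 by apply: (lin0 (@stable_class_linear _)).
by apply: contrapT => /hom_ht [e|]; [apply: wz|rewrite ltNge hw].
Qed.

(** Exactness in the middle passes from R to the quotient: a morphism to rgt m
    through alive vertices is a sum of composites of the arrows into rgt m with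
    morphisms through alive vertices. *)
Lemma stable_exact m (g : forall e : midx m, stable (mid e)) :
  \sum_e stable_map (ma e) (g e) = 0 -> exists h : stable (lft m), forall e, g e = stable_map (mb e) h.
Proof.
move=> g0; pose f e := projT1 (cid (stable_class_surj (g e))).
have fE e : stable_class (f e) = g e by rewrite /f; case: cid.
have : through (@alive k D) (\sum_e hcomp (ma e) (f e)).
  apply/stable_class0; rewrite (lin_sum (@stable_class_linear _)) -[RHS]g0.
  by apply: eq_bigr => e _; rewrite -stable_mapE fE.
have thr w (t : hom z w) : through (@alive k D) t -> forall m, w = rgt m ->
    forall (E : w = rgt m), exists t' : forall e : midx m, hom z (mid e),
    (forall e, through (@alive k D) (t' e)) /\
    eq_rect w (fun w => hom z w) t (rgt m) E = \sum_e hcomp (ma e) (t' e).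
  elim=> {w t} [w|w t u _ It _ Iu|v w g' t vA] m' _ E; subst w => /=.
  - exists (fun e => 0); split=> [e|]; first exact: through0.
    by rewrite big1 // => e _; apply: compm0.
  - have [t' [tt' /= ->]] := It m' erefl erefl; have [u' [tu' /= ->]] := Iu m' erefl erefl.
    exists (fun e => t' e + u' e); split=> [e|]; first exact: throughD.
    by rewrite -big_split; apply: eq_bigr => e _; rewrite (linD (comp_linearr _)).
  have [|g'' ->] := ml_surj L g'; first by move=> vE; apply: (ml_alive R (m := m')); rewrite /= -vE.
  exists (fun e => hcomp (g'' e) t); split=> [e|]; first exact: through_comp.
  by rewrite comp_suml; apply: eq_bigr => e _; rewrite compA.
move=> /thr/(_ m erefl erefl) [t [tt /= tE]].
have [|h hE] := @ml_mid _ _ L m _ (fun e => f e - t e).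
  under eq_bigr do rewrite (linB (comp_linearr _)).
  by rewrite sumrB tE subrr.
exists (stable_class h) => e; rewrite stable_mapE -hE -fE; apply/stable_class_eq.
by rewrite opprB addrC subrK.
Qed.

Lemma stable_surj m (y : stable (rgt m)) : rgt m <> z ->
  exists g : forall e : midx m, stable (mid e), y = \sum_e stable_map (ma e) (g e).
Proof.
move=> zm; have [f <-] := stable_class_surj y.
have [|g ->] := ml_surj L f; first by move=> e; apply: zm.
exists (fun e => stable_class (g e)); rewrite (lin_sum (@stable_class_linear _)).
by apply: eq_bigr => e _; rewrite stable_mapE.
Qed.

Lemma stable_mesh m (y : stable (lft m)) : \sum_(e : midx m) stable_map (ma e) (stable_map (mb e) y) = 0.
Proof. by under eq_bigr do rewrite -stable_map_comp; rewrite -stable_map_sum mesh0 stable_map0. Qed.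

Lemma stable_fd w : finite_dim (stable w).
Proof. exact: (finite_dim_image (@stable_class_linear w) (@stable_class_surj w) (fd z w)). Qed.

Definition near (t : int) (w : D) : Prop := (height w = t) \/ (height w = t + 1).

(** The restriction of F to the heights t and t + 1 is a brick. *)
Definition scalar_endomorphisms (t : int) := forall phi : forall w, stable w -> stable w,
  (forall w, linear (phi w)) ->
  (forall w w' (g : hom w w') y, near t w -> near t w' -> phi w' (stable_map g y) = stable_map g (phi w y)) ->
  exists c : k, forall w y, near t w -> phi w y = c *: y.

Definition mono_at (t : int) := forall m : mesh D, height (lft m) = t ->
  forall y : stable (lft m), (forall e : midx m, stable_map (mb e) y = 0) -> y = 0.

Lemma stable_kills m (y : stable (lft m)) : (forall e : midx m, stable_map (mb e) y = 0) ->
  forall w (g : hom (lft m) w), w <> lft m -> stable_map g y = 0.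
Proof.
move=> y0 w g wm; have [g' ->] := @ml_surj _ _ R m w g wm.
rewrite (stable_map_sum (fun e : midx m => hcomp (g' e : @hom k D _ _) (mb e))) big1 // => e _.
by rewrite stable_map_comp y0 (lin0 (stable_map_linear _)).
Qed.

Lemma scalar_endomorphisms_base : scalar_endomorphisms (T - 1).
Proof.
move=> phi phil _; have [f fE] := stable_class_surj (phi z (stable_class (idm z))).
have [a fa] := hom_end f; exists a => w y nw.
have [e|ne] := pselect (w = z).
  subst w; have [h <-] := stable_class_surj y; have [b ->] := hom_end h.
  rewrite (linZ (@stable_class_linear z)) (linZ (phil z)) -fE fa (linZ (@stable_class_linear z)).
  by rewrite !scalerA mulrC.
have hw : (height w <= T)%R by case: nw => ->; lia.
have y0 v : v = 0 :> stable w by apply: stable_low.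
by rewrite (y0 y) (lin0 (phil w)) scaler0.
Qed.

Lemma hom_near t (w w' : D) (g : hom w w') : height w = t -> height w' = t -> g <> 0 -> w = w'.
Proof. by move=> hw hw' /hom_ht [//|]; rewrite hw hw' ltxx. Qed.

Lemma hom_back t (w w' : D) (g : hom w w') : height w = t + 1 -> height w' = t -> g = 0.
Proof.
move=> hw hw'; apply: contrapT => /hom_ht []; first by move=> e; move: hw; rewrite e hw'; lia.
by rewrite hw hw'; lia.
Qed.

(** F(w) at height t embeds into the sum of the F(y) over w -> y, as the kernel
    of the maps to height t + 2. So an endomorphism on the heights t + 1, t + 2
    induces one on the heights t, t + 1; as this one is a scalar, so is the given
    one at height t + 1, and at height t + 2 because F is there a quotient of F
    at height t + 1. *)
Lemma scalar_endomorphisms_step t : (T - 1 <= t)%R -> mono_at t -> scalar_endomorphisms t -> scalar_endomorphisms (t + 1).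
Proof.
move=> ht inj sc phi phil phin.
(* y' is the image of y under the induced endomorphism *)
pose P w (y y' : stable w) := forall w' (g : hom w w'), height w' = t + 1 ->
  stable_map g y' = phi w' (stable_map g y).
have n1 w : height w = t + 1 -> near (t + 1) w by left.
have ex w (y : stable w) : height w = t -> exists y', P w y y'.
  move=> hw; have [w0|[m wm]] := stable_or_lft w.
    by exists 0 => w' g hw'; rewrite (w0 y) !(lin0 (stable_map_linear g)) (lin0 (phil w')).
  subst w.
  have hm e : height (mid (e : midx m)) = t + 1 by rewrite ht_mid hw.
  have hr : height (rgt m) = (t + 1) + 1 by rewrite ht_rgt hw; lia.
  have [|h hE] := @stable_exact m (fun e => phi _ (stable_map (mb e) y)).
    transitivity (phi (rgt m) (\sum_(e : midx m) stable_map (ma e) (stable_map (mb e) y))).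
      rewrite (lin_sum (phil _)); apply: eq_bigr => e _.
      exact: (esym (phin _ _ _ _ (n1 _ (hm e)) (or_intror hr))).
    by rewrite stable_mesh (lin0 (phil _)).
  exists h => w' g hw'.
  have [|g' gE] := @ml_surj _ _ R m w' g; first by move=> /(congr1 (@height k D)); rewrite hw' /= hw; lia.
  have {gE}-> : g = \sum_(e : midx m) hcomp (g' e : @hom k D _ _) (mb e) by [].
  rewrite !(stable_map_sum (fun e : midx m => hcomp (g' e : @hom k D _ _) (mb e))) (lin_sum (phil _)).
  apply: eq_bigr => e _.
  rewrite !stable_map_comp -hE.
  exact: (esym (phin _ _ _ _ (n1 _ (hm e)) (n1 _ hw'))).
have uniq w y y1 y2 : height w = t -> P w y y1 -> P w y y2 -> y1 = y2.
  move=> hw P1 P2; have [w0|[m wm]] := stable_or_lft w; first by rewrite (w0 y1) (w0 y2).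
  subst w; apply/eqP; rewrite -subr_eq0; apply/eqP/(inj m hw) => e.
  have hm : height (mid e) = t + 1 by rewrite ht_mid hw.
  by rewrite (linB (stable_map_linear _)) P1 // P2 // subrr.
pose psi w (y : stable w) : stable w := match pselect (height w = t) with
  | left h => projT1 (cid (ex w y h)) | right _ => phi w y end.
have psiP w y : height w = t -> P w y (psi w y).
  by move=> hw; rewrite /psi; case: pselect => // h; case: cid.
have psi1 w y : height w = t + 1 -> psi w y = phi w y.
  by move=> hw; rewrite /psi; case: pselect => // h; move: hw; rewrite h; lia.
have psil w : linear (psi w).
  have [hw|hw] := pselect (height w = t); last first.
    by move=> a x y; rewrite /psi; case: pselect => // _; apply: phil.
  move=> a x y; apply: (uniq w _ _ _ hw (psiP _ _ hw)) => w' g hw'.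
  by rewrite !stable_map_linear phil !psiP.
have [w w' g y nw nw'|c cE] := sc psi psil.
  case: nw nw' => [hw|hw] [hw'|hw'].
  - have [->|g0] := pselect (g = 0); first by rewrite !stable_map0 (lin0 (psil _)).
    have e := hom_near hw hw' g0; subst w'; have [a ->] := hom_end g.
    by rewrite !stable_map_scalar (linZ (psil _)).
  - by rewrite psi1 // psiP.
  - by rewrite (hom_back g hw hw') !stable_map0 (lin0 (psil _)).
  - by rewrite !psi1 // phin //; apply: n1.
exists c => w y [hw|hw].
  by rewrite -psi1 // cE //; right.
have [w0|[m wm]] := stable_or_rgt w; first by rewrite (w0 y) (lin0 (phil _)) scaler0.
subst w; have [|g ->] := stable_surj y.
  by move=> e; move: hw; rewrite e; move: ht; lia.
rewrite (lin_sum (phil _)) scaler_sumr; apply: eq_bigr => e _.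
have hm : height (mid e) = t + 1 by move: hw; rewrite ht_rgt ht_mid; lia.
rewrite phin; [|exact: n1|by right].
by rewrite -psi1 // cE ?(linZ (stable_map_linear _)) //; right.
Qed.

(** If y0 is a nonzero element at height t which is killed by all arrows, and l a
    functional with l y0 <> 0, then y |-> l(y) y0 is an endomorphism of the
    restriction of F to the heights t and t + 1. It is 0 outside one vertex, and
    it is a nonzero scalar. *)
Lemma stable_vanish_of_not_mono t : scalar_endomorphisms t -> ~ mono_at t ->
  forall w, height w = t + 1 -> forall y : stable w, y = 0.
Proof.
move=> sc ninj.
have [m [hm [y0 [yk yn]]]] : exists m, height (lft m) = t /\
    exists y : stable (lft m), (forall e : midx m, stable_map (mb e) y = 0) /\ y <> 0.
  apply: contrapT => no; apply: ninj => m hm y yk; apply: contrapT => yn.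
  by apply: no; exists m; split=> //; exists y.
have [l ln] : exists l : dual (stable (lft m)), l y0 <> 0.
  apply: contrapT => no; apply: yn; apply: dual_separates => l.
  by apply: contrapT => ln; apply: no; exists l.
pose phi0 (y : stable (lft m)) : stable (lft m) := (l y : k) *: y0.
pose phi w : stable w -> stable w := match pselect (lft m = w) with
  | left e => eq_rect (lft m) (fun w => stable w -> stable w) phi0 w e | right _ => fun _ => 0 end.
have phi1 : phi (lft m) = phi0.
  by rewrite /phi; case: pselect => // e; rewrite (Prop_irrelevance e erefl).
have phi2 w : lft m <> w -> phi w = fun _ => 0.
  by move=> h; rewrite /phi; case: pselect.
have phil w : linear (phi w).
  have [<-|ne] := pselect (lft m = w); last by rewrite phi2 // => a x y; rewrite scaler0 addr0.
  by rewrite phi1 => a x y; rewrite /phi0 dualP scalerDl scalerA.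
have [w w' g y nw nw'|c cE] := sc phi phil.
  have [->|g0] := pselect (g = 0); first by rewrite !stable_map0 (lin0 (phil _)).
  have [e|ne] := pselect (lft m = w).
    subst w; have [e'|ne'] := pselect (lft m = w').
      by subst w'; have [a ->] := hom_end g; rewrite !stable_map_scalar (linZ (phil _)).
    rewrite (phi2 w') // phi1 /phi0 (linZ (stable_map_linear g)) (stable_kills yk) ?scaler0 //.
    by move=> h; apply: ne'.
  rewrite (phi2 w) // (lin0 (stable_map_linear g)).
  have [e'|ne'] := pselect (lft m = w'); last by rewrite phi2.
  subst w'; case: nw => hw; first by case: ne; rewrite (hom_near hw hm g0).
  by case: g0; apply: (hom_back g hw hm).
have c0 : c != 0.
  apply/eqP => c0; have : phi (lft m) y0 = 0 by rewrite cE ?c0 ?scale0r //; left.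
  by rewrite phi1 => /eqP; rewrite scaler_eq0 => /orP[/eqP//|/eqP].
move=> w hw y; have : phi w y = c *: y by apply: cE; right.
have ne : lft m <> w by move=> e; move: hw; rewrite -e hm; lia.
rewrite phi2 // => /esym/eqP; rewrite scaler_eq0 (negPf c0) => /eqP //.
Qed.

Lemma stable_vanish_step t : (T <= t)%R -> (forall w, height w = t -> forall y : stable w, y = 0) ->
  forall w, height w = t + 1 -> forall y : stable w, y = 0.
Proof.
move=> hT F0 w hw y; have [//|[m wm]] := stable_or_rgt w; subst w.
have [|g ->] := stable_surj y; first by move=> e; move: hw; rewrite e; move: hT; lia.
rewrite big1 // => e _.
have hm : height (mid e) = t by move: hw; rewrite ht_rgt ht_mid; lia.
by rewrite (F0 _ hm (g e)) (lin0 (stable_map_linear _)).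
Qed.

Lemma stable_vanish t : (T <= t)%R -> (forall w, height w = t -> forall y : stable w, y = 0) ->
  forall w, (t <= height w)%R -> forall y : stable w, y = 0.
Proof.
move=> hT F0 w hw; have : exists n : nat, height w = t + n%:Z.
  by exists (absz (height w - t)); lia.
case=> n; elim: n w {hw} => [|n IH] w hw; first by apply: F0; rewrite hw addr0.
apply: (@stable_vanish_step (t + n%:Z)); [by lia|by []|by rewrite hw; lia].
Qed.

(** Integers are used because the recursion for the dimensions has a minus sign. *)
Definition stable_dim (w : D) (n : int) := exists S : finType, has_coords (stable w) S /\ (#|S| : int) = n.

Lemma stable_dim0 w : stable_dim w 0 <-> forall y : stable w, y = 0.
Proof.
split=> [[S [h S0]] y|w0]; first by apply: (coords0 h); case: S0.
exists void; split; last by rewrite card_void.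
exists (fun _ => [ffun s => 0]); split=> [a x y|x y _|c].
- by apply/ffunP => -[].
- by rewrite (w0 x) (w0 y).
- by exists 0; apply/ffunP => -[].
Qed.

Lemma stable_dim_start : ~ (forall y : stable z, y = 0) -> stable_dim z 1.
Proof.
move=> zn.
have span (y : stable z) : exists c : k, y = c *: stable_class (idm z).
  have [f <-] := stable_class_surj y; have [c ->] := hom_end f; exists c.
  exact: (linZ (@stable_class_linear z)).
have un : stable_class (idm z) != 0.
  apply/eqP => u0; apply: zn => y; have [c ->] := span y.
  by rewrite u0 scaler0.
pose c y := projT1 (cid (span y)).
have cE y : y = c y *: stable_class (idm z) by rewrite /c; case: cid.
have cu a b : a *: stable_class (idm z) = b *: stable_class (idm z) -> a = b.
  move=> e; apply/eqP; rewrite -subr_eq0.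
  have : (a - b) *: stable_class (idm z) == 0 by rewrite scalerBl e subrr.
  by rewrite scaler_eq0 (negPf un) orbF.
exists unit; split; last by rewrite card_unit.
exists (fun y => [ffun _ => c y]); split=> [a x y|x y|f].
- apply/ffunP => s; rewrite !ffunE; apply: cu.
  by rewrite -cE {1}(cE x) {1}(cE y) scalerA -scalerDl.
- by move=> /ffunP /(_ tt); rewrite !ffunE => e; rewrite (cE x) (cE y) e.
- exists ((f tt : k) *: stable_class (idm z)); apply/ffunP => -[]; rewrite ffunE.
  by apply: cu; rewrite -cE.
Qed.

(** Additivity of the dimensions, where the mesh sequence is exact on the left. *)
Lemma stable_dim_rgt m a b : mono_at (height (lft m)) -> (T <= height (lft m) + 1)%R ->
  stable_dim (lft m) a -> (forall e : midx m, stable_dim (mid e) (b e)) ->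
  stable_dim (rgt m) (\sum_e b e - a).
Proof.
move=> inj hT [S1 [h1 c1]] hb.
pose S e := projT1 (cid (hb e)).
have SP e : has_coords (stable (mid e)) (S e) /\ (#|S e| : int) = b e.
  by rewrite /S; case: cid.
have [n hn] := finite_dim_coords (stable_fd (rgt m)).
exists 'I_n; split=> //.
pose V : lmodType k := lprod (fun e : midx m => stable (mid e)).
pose i (y : stable (lft m)) : V := fun e => stable_map (mb e) y.
pose p (v : V) : stable (rgt m) := \sum_e stable_map (ma e) (v e).
have := @exact_card k _ V _ _ _ _ i p h1 (coords_prod (fun e => (SP e).1)) hn.
have -> : #|{: {e : midx m & S e}}| = (\sum_e #|S e|)%N.
  by rewrite card_tagged sumnE big_map big_enum.
move=> Hc; have {}Hc : (\sum_e #|S e|)%N = (#|S1| + n)%N.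
  rewrite Hc ?card_ord //.
  - move=> c x y; apply: functional_extensionality_dep => e; exact: stable_map_linear.
  - move=> c x y; rewrite /p scaler_sumr -big_split; apply: eq_bigr => e _.
    exact: stable_map_linear.
  - move=> x y xy; apply/eqP; rewrite -subr_eq0; apply/eqP/(inj m erefl) => e.
    rewrite (linB (stable_map_linear _)); apply/eqP; rewrite subr_eq0; apply/eqP.
    exact: (congr1 (fun v : V => v e) xy).
  - move=> w; have [|g ->] := stable_surj w; last by exists g.
    by move=> e; move: hT; rewrite -e ht_rgt; lia.
  move=> v; split=> [/stable_exact [y yE]|[y <-]]; last exact: stable_mesh.
  by exists y; apply: functional_extensionality_dep => e; rewrite yE.
have <- : \sum_e (#|S e| : int) = \sum_e b e by apply: eq_bigr => e _; rewrite (SP e).2.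
rewrite -c1 card_ord; have -> : \sum_e (#|S e| : int) = ((\sum_e #|S e|)%N : int).
  by rewrite (big_morph Posz PoszD erefl).
by rewrite Hc PoszD addrC addKr.
Qed.

End Stable.

(** * Additive functions on Dynkin quivers *)

Section NeighbourSums.
Variable Q : finquiver.

Definition neighbour_sum (d : Q0 Q -> int) (i : Q0 Q) : int :=
  \sum_(a | ftgt a == i) d (fsrc a) + \sum_(a | fsrc a == i) d (ftgt a).

Lemma sum_fiber (p : Q1 Q -> Q0 Q) (F : Q0 Q -> Q1 Q -> int) :
  \sum_i \sum_(a | p a == i) F i a = \sum_a F (p a) a.
Proof.
rewrite (exchange_big_dep xpredT) //=; apply: eq_bigr => a _.
by rewrite (big_pred1 (p a)) // => i; rewrite eq_sym.
Qed.

(** Both sides are sums over the arrows: adjacency is symmetric. *)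
Lemma neighbour_sum_sym (v d : Q0 Q -> int) :
  \sum_i v i * neighbour_sum d i = \sum_i neighbour_sum v i * d i.
Proof.
have E (v' d' : Q0 Q -> int) : \sum_i v' i * neighbour_sum d' i =
    \sum_a v' (ftgt a) * d' (fsrc a) + \sum_a v' (fsrc a) * d' (ftgt a).
  rewrite -[X in _ = X + _](sum_fiber (@ftgt Q) (fun i a => v' i * d' (fsrc a))).
  rewrite -[X in _ = _ + X](sum_fiber (@fsrc Q) (fun i a => v' i * d' (ftgt a))).
  rewrite -big_split.
  by apply: eq_bigr => i _; rewrite /neighbour_sum mulrDr !mulr_sumr.
rewrite E; under [RHS]eq_bigr do rewrite mulrC.
rewrite E addrC; congr (_ + _); apply: eq_bigr => a _; exact: mulrC.
Qed.

(** The inequality at j is strict. *)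
Definition subadditive (v : Q0 Q -> int) (j : Q0 Q) :=
  [/\ forall i, 0 <= v i, forall i, neighbour_sum v i <= 2 * v i & neighbour_sum v j < 2 * v j].

Definition connected_from (j : Q0 Q) :=
  forall P : Q0 Q -> Prop, P j -> (forall a : Q1 Q, P (fsrc a) <-> P (ftgt a)) -> forall i, P i.

Lemma nonincreasing_const (d : nat -> int) : (forall t, 0 <= d t) ->
  (forall t, d t.+1 <= d t) -> exists T, forall t, (T <= t)%N -> d t = d T.
Proof.
move=> d0 dS.
have ex : exists n, `[< exists t, d t = n%:Z >].
  by exists (absz (d 0%N)); apply/asboolP; exists 0%N; rewrite gez0_abs.
case: (ex_minnP ex) => n /asboolP [T dT] nmin; exists T => t /subnKC <-.
have mono j : d (T + j)%N <= d T.
  by elim: j => [|j IH]; rewrite ?addn0 // addnS; apply: le_trans IH.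
apply/eqP; rewrite eq_le mono dT /=.
have : (n <= absz (d (T + (t - T))))%N.
  by apply: nmin; apply/asboolP; exists (T + (t - T))%N; rewrite gez0_abs.
by have := d0 (T + (t - T))%N; lia.
Qed.

Section Additive.
Variables (v : Q0 Q -> int) (j : Q0 Q).
Hypothesis vsub : subadditive v j.
Hypothesis conn : connected_from j.
Variable D : nat -> Q0 Q -> int.
Hypothesis DS : forall t i, D t.+2 i = neighbour_sum (D t.+1) i - D t i.

(** Let s_t be the sum of the v_i D_t(i). Subadditivity of v gives
    s_(t+2) + s_t <= 2 s_(t+1) - D_(t+1)(j), so s is concave; as it is
    nonnegative, its increments are nonnegative and nonincreasing, hence
    constant for large t. Then D_t(j) = 0 for large t, and the vanishing spreads
    from a vertex to its neighbours by the recursion. *)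
Lemma additive_eventually_zero : (forall t i, 0 <= D t i) ->
  exists N, forall t, (N <= t)%N -> forall i, D t i = 0.
Proof.
move=> D0; have [v0 v2 vj] := vsub.
pose s t := \sum_i v i * D t i; pose e t := s t.+1 - s t.
have eS t : e t.+1 <= e t - D t.+1 j.
  have h : s t.+2 + s t = \sum_i neighbour_sum v i * D t.+1 i.
    rewrite -neighbour_sum_sym -big_split; apply: eq_bigr => i _.
    by rewrite /= DS -mulrDr subrK.
  have h2 : \sum_i neighbour_sum v i * D t.+1 i <= 2 * s t.+1 - D t.+1 j.
    rewrite /s mulr_sumr (bigD1 j) //= [X in _ <= X - _](bigD1 j) //= addrAC.
    apply: lerD.
      have : neighbour_sum v j * D t.+1 j <= (2 * v j - 1) * D t.+1 j.
        by apply: ler_wpM2r => //; move: vj; lia.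
      by rewrite mulrBl mul1r mulrA.
    by apply: ler_sum => i _; rewrite mulrA; apply: ler_wpM2r.
  by move: h h2; rewrite /e; lia.
have s0 t : 0 <= s t by apply: sumr_ge0 => i _; apply: mulr_ge0.
have eS' t : e t.+1 <= e t by have := eS t; have := D0 t.+1 j; lia.
have e0 t : 0 <= e t.
  rewrite leNgt; apply/negP => et.
  have en n : e (t + n)%N <= -1.
    elim: n => [|n IH]; first by rewrite addn0; move: et; lia.
    by rewrite addnS; have := eS' (t + n)%N; lia.
  have sn n : s (t + n)%N <= s t - n%:Z.
    elim: n => [|n IH]; first by rewrite addn0; lia.
    by rewrite addnS; have := en n; rewrite /e; lia.
  by have := sn (absz (s t)).+1; have := s0 (t + (absz (s t)).+1)%N; have := s0 t; lia.
have [T eT] := nonincreasing_const e0 eS'.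
pose Z i := exists N, forall t, (N <= t)%N -> D t i = 0.
have Zj : Z j.
  exists T.+1 => -[|t] // ht; have := eS t; have := D0 t.+1 j.
  by rewrite (eT t.+1) ?(eT t) //; [lia|apply: ltnW].
have Znb i : Z i -> forall a, (ftgt a = i -> Z (fsrc a)) /\ (fsrc a = i -> Z (ftgt a)).
  move=> [N ZN] a.
  have nb0 t : (N < t)%N -> neighbour_sum (D t) i = 0.
    case: t => // t ht; have := DS t i; rewrite (ZN t) ?(ZN t.+2); [|lia|lia].
    by rewrite subr0.
  have p1 t : 0 <= \sum_(a | ftgt a == i) D t (fsrc a) by apply: sumr_ge0.
  have p2 t : 0 <= \sum_(a | fsrc a == i) D t (ftgt a) by apply: sumr_ge0.
  split=> ai; exists N.+1 => t ht; have := nb0 t ht; rewrite /neighbour_sum => h.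
    have /eqP : \sum_(a | ftgt a == i) D t (fsrc a) = 0.
      by have := p1 t; have := p2 t; lia.
    by rewrite psumr_eq0 // => /allP /(_ a); rewrite mem_index_enum ai eqxx => /(_ isT)/eqP.
  have /eqP : \sum_(a | fsrc a == i) D t (ftgt a) = 0.
    by have := p1 t; have := p2 t; lia.
  by rewrite psumr_eq0 // => /allP /(_ a); rewrite mem_index_enum ai eqxx => /(_ isT)/eqP.
have Zall : forall i, Z i.
  apply: conn => // a; split=> Za; first by have [_] := Znb _ Za a; apply.
  by have [] := Znb _ Za a => + _; apply.
pose N i := projT1 (cid (Zall i)).
have NP i t : (N i <= t)%N -> D t i = 0 by rewrite /N; case: cid => n /= h; apply: h.
exists (\max_i N i)%N => t ht i; apply: NP; apply: leq_trans ht.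
exact: leq_bigmax.
Qed.

End Additive.

(** The solution of the recursion with initial values 0 at time 0 and the delta
    function of i0 at time 1; the first component of the pair is the value at
    time t, the second one the value at time t + 1. *)
Definition additive_from (i0 : Q0 Q) (t : nat) : Q0 Q -> int :=
  (iter t (fun p : (Q0 Q -> int) * (Q0 Q -> int) => (p.2, fun i => neighbour_sum p.2 i - p.1 i))
    (fun _ => 0, fun i => (i == i0)%:R)).1.

Lemma additive_fromS i0 t i :
  additive_from i0 t.+2 i = neighbour_sum (additive_from i0 t.+1) i - additive_from i0 t i.
Proof. by []. Qed.

Lemma additive_from_bound (v : Q0 Q -> int) (j i0 : Q0 Q) :
  subadditive v j -> connected_from j ->
  exists N : nat, (exists t i, (t <= N)%N /\ additive_from i0 t i < 0) \/
    forall t, (N <= t)%N -> forall i, additive_from i0 t i = 0.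
Proof.
move=> vs vc; have [[t [i ti]]|no] := pselect (exists t i, additive_from i0 t i < 0).
  by exists t; left; exists t, i.
have [|N NP] := additive_eventually_zero vs vc (@additive_fromS i0).
  by move=> t i; rewrite leNgt; apply/negP => h; apply: no; exists t, i.
by exists N; right.
Qed.

End NeighbourSums.

(** In each diagram, every vertex j > 0 has exactly one neighbour smaller than j.
    This shows at once that the diagram is a tree and that it is connected. *)
Definition ADE_parent (t : ADE) (j : nat) : nat :=
  match t with
  | TypeA n => j.-1
  | TypeD n => if j == n.-1 then (n - 3)%N else j.-1
  | TypeE n => if j == n.-1 then 2 else j.-1
  end.

Lemma ADE_edgeE t i j : ADE_valid t -> (j < ADE_rank t)%N ->
  ADE_edge t i j = (0 < j)%N && (i == ADE_parent t j).
Proof.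
by case: t => n /= hn hj; rewrite /branched_edge; repeat case: eqP; move: hn hj; lia.
Qed.

Lemma ADE_parent_lt t j : ADE_valid t -> (0 < j < ADE_rank t)%N -> (ADE_parent t j < j)%N.
Proof. by case: t => n /= hn hj; repeat case: eqP; move: hn hj; lia. Qed.

Lemma sum_single n (P : pred nat) (w : nat -> nat) c :
  (forall j, P j -> j = c) -> (\sum_(j < n) P j * w j <= P c * w c)%N.
Proof.
move=> Pc; have [cn|cn] := ltnP c n.
  rewrite (bigD1 (Ordinal cn)) //= big1 ?addn0 // => j ne.
  by case E : (P j) => //; case/eqP: ne; apply: val_inj; apply: Pc.
rewrite big1 // => j _; case E : (P j) => //.
by have := ltn_ord j; rewrite (Pc _ E) ltnNge cn.
Qed.

Lemma branched_sum n b i (w : nat -> nat) :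
  (\sum_(j < n) (branched_edge n b i j || branched_edge n b j i) * w j <=
    (i.+1 < n.-1) * w i.+1 + (i == b) * w n.-1 + ((0 < i < n.-1) * w i.-1 + (i == n.-1) * w b))%N.
Proof.
pose P1 j := (j == i.+1) && (j < n.-1)%N; pose P2 j := (i == b) && (j == n.-1).
pose P3 j := (i == j.+1) && (i < n.-1)%N; pose P4 j := (j == b) && (i == n.-1).
apply: (@leq_trans (\sum_(j < n) (P1 j * w j + P2 j * w j + (P3 j * w j + P4 j * w j)))%N).
  apply: leq_sum => j _; rewrite -!mulnDl leq_mul2r /branched_edge.
  rewrite -/(P1 j) -/(P2 j) -/(P3 j) -/(P4 j).
  by case: (P1 j) (P2 j) (P3 j) (P4 j) => [] [] [] []; rewrite ?orbT.
rewrite !big_split /=; apply: leq_add; apply: leq_add.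
- by apply: leq_trans (sum_single n w (c := i.+1) _) _ => [j /andP[/eqP]|]; rewrite /P1 ?eqxx.
- by apply: leq_trans (sum_single n w (c := n.-1) _) _ => [j /andP[_ /eqP]|]; rewrite /P2 ?eqxx ?andbT.
- apply: leq_trans (sum_single n w (c := i.-1) _) _ => [j /andP[/eqP -> //]|].
  by rewrite /P3 leq_mul2r; case: (i) => [|m] //=; rewrite ?eqxx ?leqnn ?orbT.
- by apply: leq_trans (sum_single n w (c := b) _) _ => [j /andP[/eqP]|]; rewrite /P4 ?eqxx.
Qed.

Lemma chain_sum n i (w : nat -> nat) :
  (\sum_(j < n) ((j == i.+1 :> nat) || (i == j.+1)) * w j <= w i.+1 + (0 < i) * w i.-1)%N.
Proof.
pose P1 j := j == i.+1; pose P2 j := i == j.+1.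
apply: (@leq_trans (\sum_(j < n) (P1 j * w j + P2 j * w j))%N).
  apply: leq_sum => j _; rewrite -mulnDl leq_mul2r -/(P1 j) -/(P2 j).
  by case: (P1 j) (P2 j) => [] []; rewrite ?orbT.
rewrite big_split /=; apply: leq_add.
  by apply: leq_trans (sum_single n w (c := i.+1) _) _ => [j /eqP|]; rewrite /P1 ?eqxx ?mul1n.
apply: leq_trans (sum_single n w (c := i.-1) _) _ => [j /eqP -> //|].
by rewrite /P2 leq_mul2r; case: (i) => [|m] //=; rewrite ?eqxx ?leqnn ?orbT.
Qed.

(** For A_n the weights are all 1; for D_n they are 2 on the chain and 1 at the
    two short ends; the inequality is strict at the end 0 of the chain. For E_n
    they are the coefficients of the highest root, and the inequality is strict
    at the vertex which is linked to the additional vertex of the extended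
    diagram. *)
Lemma ADE_weights t : ADE_valid t -> exists (w : nat -> nat) (j : nat),
  [/\ (j < ADE_rank t)%N,
     forall i, (i < ADE_rank t)%N -> (\sum_(j < ADE_rank t) ADE_adj t i j * w j <= 2 * w i)%N &
     (\sum_(i < ADE_rank t) ADE_adj t j i * w i < 2 * w j)%N].
Proof.
have E n (s : seq nat) j : (3 < n)%N ->
    let w i := nth 0%N s i in
    let B i := ((i.+1 < n.-1) * w i.+1 + (i == 2) * w n.-1 +
        ((0 < i < n.-1) * w i.-1 + (i == n.-1) * w 2))%N in
    [&& (j < n)%N, all (fun i => B i <= 2 * w i)%N (iota 0 n) & (B j < 2 * w j)%N] ->
    exists (w : nat -> nat) (j : nat),
  [/\ (j < ADE_rank (TypeE n))%N,
     forall i, (i < ADE_rank (TypeE n))%N ->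
       (\sum_(j < ADE_rank (TypeE n)) ADE_adj (TypeE n) i j * w j <= 2 * w i)%N &
     (\sum_(i < ADE_rank (TypeE n)) ADE_adj (TypeE n) j i * w i < 2 * w j)%N].
  move=> n3 w B /and3P[jn /allP hB hj]; exists w, j; split=> //.
    move=> i hi; apply: leq_trans (branched_sum n 2 i w) _; apply: hB.
    by rewrite mem_iota.
  exact: leq_ltn_trans (branched_sum n 2 j w) hj.
case: t => n /= hn.
- exists (fun _ => 1%N), 0%N; split=> // [i hi|].
    by apply: leq_trans (chain_sum n i (fun _ => 1%N)) _; case: (0 < i)%N.
  exact: leq_ltn_trans (chain_sum n 0 (fun _ => 1%N)) _.
- pose w i := if (i < n - 2)%N then 2 else 1%N.
  exists w, 0%N; split=> [|i hi|]; first by move: hn; lia.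
    apply: leq_trans (branched_sum n (n - 3) i w) _; rewrite /w.
    by repeat case: ifP; repeat case: eqP; move: hn hi; lia.
  apply: leq_ltn_trans (branched_sum n (n - 3) 0 w) _; rewrite /w.
  by repeat case: ifP; repeat case: eqP; move: hn; lia.
case/andP: hn => h6 h8.
have [->|] := eqVneq n 6; first exact: (E 6 [:: 1; 2; 3; 2; 1; 2]%N 5%N).
have [->|] := eqVneq n 7; first by move=> _; exact: (E 7 [:: 2; 3; 4; 3; 2; 1; 2]%N 0%N).
have [->|] := eqVneq n 8; first by move=> _ _; exact: (E 8 [:: 2; 4; 6; 5; 4; 3; 2; 3]%N 6%N).
by move: h6 h8; lia.
Qed.

Section DynkinQuiver.
Variables (Q : finquiver) (t : ADE) (f : 'I_(ADE_rank t) -> Q0 Q) (g : Q0 Q -> 'I_(ADE_rank t)).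
Hypothesis tv : ADE_valid t.
Hypothesis fK : cancel f g.
Hypothesis gK : cancel g f.
Hypothesis fadj : forall i j, #|[set a : Q1 Q | joins a (f i) (f j)]%SET| = ADE_adj t i j :> nat.

Lemma ADE_arrow_adj (a : Q1 Q) : ADE_adj t (g (fsrc a)) (g (ftgt a)).
Proof.
have := fadj (g (fsrc a)) (g (ftgt a)); rewrite !gK.
case: ADE_adj => // /eqP; rewrite cards_eq0 => /eqP e.
by have : a \in [set a0 : Q1 Q | joins a0 (fsrc a) (ftgt a)]%SET;
  [rewrite inE /joins !eqxx|rewrite e inE].
Qed.

Lemma ADE_adjE (i j : 'I_(ADE_rank t)) : ADE_adj t i j =
  ((0 < j)%N && (i == ADE_parent t j :> nat)) || ((0 < i)%N && (j == ADE_parent t i :> nat)).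
Proof. by rewrite /ADE_adj !ADE_edgeE. Qed.

Lemma ADE_arrowP (a : Q1 Q) :
  [/\ (0 < g (ftgt a))%N & g (fsrc a) = ADE_parent t (g (ftgt a)) :> nat] \/
  [/\ (0 < g (fsrc a))%N & g (ftgt a) = ADE_parent t (g (fsrc a)) :> nat].
Proof.
have := ADE_arrow_adj a; rewrite ADE_adjE => /orP[/andP[h /eqP e]|/andP[h /eqP e]].
  by left.
by right.
Qed.

Lemma ADE_no_loop (a : Q1 Q) : fsrc a <> ftgt a.
Proof.
move=> e; have [[h e1]|[h e1]] := ADE_arrowP a.
  by have := @ADE_parent_lt t _ tv (introT andP (conj h (ltn_ord _))); rewrite -e1 e ltnn.
by have := @ADE_parent_lt t _ tv (introT andP (conj h (ltn_ord _))); rewrite -e1 e ltnn.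
Qed.

Lemma ADE_unique_arrow (a b : Q1 Q) :
  joins b (fsrc a) (ftgt a) -> a = b.
Proof.
move=> jb; have := fadj (g (fsrc a)) (g (ftgt a)); rewrite !gK ADE_arrow_adj => /eqP/cards1P [c cE].
have : a \in [set a0 : Q1 Q | joins a0 (fsrc a) (ftgt a)]%SET by rewrite inE /joins !eqxx.
have : b \in [set a0 : Q1 Q | joins a0 (fsrc a) (ftgt a)]%SET by rewrite inE.
by rewrite cE !inE => /eqP -> /eqP ->.
Qed.

(** The level is defined recursively along the tree; the single edge between j
    and its parent decides the sign of the difference. *)
Lemma Dynkin_levels : exists l : Q0 Q -> int, forall a, l (ftgt a) = l (fsrc a) + 1.
Proof.
pose sg (j : nat) : int :=
  if [exists a : Q1 Q, (g (ftgt a) == j :> nat) && (g (fsrc a) == ADE_parent t j :> nat)]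
  then 1 else -1.
have [lev levE] : exists lev : nat -> int,
    forall j, (0 < j < ADE_rank t)%N -> lev j = lev (ADE_parent t j) + sg j.
  suff [lev levE] : exists lev : nat -> int, forall j, (0 < j < ADE_rank t)%N ->
      (j < ADE_rank t)%N -> lev j = lev (ADE_parent t j) + sg j.
    by exists lev => j hj; apply: levE => //; case/andP: hj.
  move: {2}(ADE_rank t); elim=> [|n [lev IH]]; first by exists (fun _ => 0).
  exists (fun j => if j == n then lev (ADE_parent t j) + sg j else lev j) => j hj jn.
  have pj := ADE_parent_lt tv hj.
  have -> : (ADE_parent t j == n) = false by apply/negP => /eqP e; move: pj jn; rewrite e; lia.
  by case: eqP => // ne; apply: IH => //; move: jn ne; lia.
exists (fun x => lev (g x)) => a.
have [[h e]|[h e]] := ADE_arrowP a.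
  rewrite levE ?h ?ltn_ord // -e; congr (_ + _); rewrite /sg.
  by case: existsP => // -[]; exists a; rewrite eqxx -e eqxx.
rewrite [in RHS]levE ?h ?ltn_ord // -e /sg.
case: existsP => [[b /andP[/eqP b1 /eqP b2]]|_]; last by rewrite addrNK.
have sb : ftgt b = fsrc a by apply: (can_inj gK); apply: val_inj.
have tb : fsrc b = ftgt a by apply: (can_inj gK); apply: val_inj; rewrite /= b2 e.
have ab : a = b by apply: ADE_unique_arrow; rewrite /joins sb tb !eqxx orbT.
by case: (@ADE_no_loop a); rewrite -sb -ab.
Qed.

Lemma neighbour_sum_ADE (w : nat -> nat) x :
  neighbour_sum (fun y => (w (g y) : int)) x = ((\sum_(j < ADE_rank t) ADE_adj t (g x) j * w j)%N : int).
Proof.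
have -> : (\sum_(j < ADE_rank t) ADE_adj t (g x) j * w j)%N =
    (\sum_(j < ADE_rank t) \sum_a joins a x (f j) * w j)%N.
  apply: eq_bigr => j _; rewrite -fadj gK -big_distrl /=; congr (_ * _)%N.
  by rewrite -sum1dep_card big_mkcond.
rewrite exchange_big /= (big_morph Posz PoszD erefl) /neighbour_sum.
rewrite [X in X + _]big_mkcond [X in _ + X]big_mkcond -big_split /=.
apply: eq_bigr => a _.
have nl := @ADE_no_loop a.
have E (y : Q0 Q) (c : bool) : (\sum_(j < ADE_rank t) (c && (y == f j)) * w j)%N = (c * w (g y))%N.
  rewrite (bigD1 (g y)) //= gK eqxx andbT big1 ?addn0 // => j ne.
  have -> : (y == f j) = false; last by rewrite andbF.
  by apply/negP => /eqP e; rewrite e fK eqxx in ne.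
transitivity ((((ftgt a == x) * w (g (fsrc a)))%N + ((fsrc a == x) * w (g (ftgt a)))%N)%N : int).
  by case: (ftgt a == x) (fsrc a == x) => [] []; rewrite PoszD ?mul1n ?mul0n.
rewrite -!E -big_split /=; congr Posz; apply: eq_bigr => j _.
rewrite -mulnDl /joins; congr (_ * _)%N.
have [e1|n1] := eqVneq (ftgt a) x; have [e2|n2] := eqVneq (fsrc a) x => //=.
- by case: nl; rewrite e1 e2.
- by rewrite andbT addn0.
- by rewrite andbF orbF.
- by rewrite andbF.
Qed.

Lemma Dynkin_subadditive : exists (v : Q0 Q -> int) (j : Q0 Q),
  subadditive v j /\ connected_from j.
Proof.
have [w [j [jn wle wlt]]] := ADE_weights tv.
exists (fun y => (w (g y) : int)), (f (Ordinal jn)); split.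
  split=> [//|i|]; rewrite neighbour_sum_ADE.
    by have := wle (g i) (ltn_ord _); lia.
  by rewrite fK; have := wlt; rewrite -ltz_nat PoszM; apply.
move=> P Pj Pa.
have step (i : 'I_(ADE_rank t)) (i0 : (0 < i)%N) :
    exists p : 'I_(ADE_rank t), [/\ (p < i)%N & P (f i) <-> P (f p)].
  have pi := @ADE_parent_lt t i tv (introT andP (conj i0 (ltn_ord _))).
  exists (Ordinal (ltn_trans pi (ltn_ord i))); split=> //.
  set p := Ordinal _.
  have : #|[set a : Q1 Q | joins a (f p) (f i)]%SET| = 1%N.
    by rewrite fadj ADE_adjE /= i0 eqxx.
  move=> /eqP/cards1P [a aE].
  have : a \in [set a : Q1 Q | joins a (f p) (f i)]%SET by rewrite aE inE.
  rewrite inE => /orP[/andP[/eqP <- /eqP <-]|/andP[/eqP <- /eqP <-]].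
    by split=> /Pa.
  exact: Pa.
have n0 : (0 < ADE_rank t)%N := leq_ltn_trans (leq0n j) jn.
have down n (i : 'I_(ADE_rank t)) : (i < n)%N -> P (f i) <-> P (f (Ordinal n0)).
  elim: n i => // n IH i hi; have [i0|i0] := posnP i.
    by have -> : i = Ordinal n0 by apply: val_inj.
  have [p [hp ->]] := step i i0; apply: IH; apply: leq_trans hp _; exact: hi.
have P0 := (down _ (Ordinal jn) (leqnn _)).1 Pj.
by move=> i; rewrite -(gK i); apply: (down _ (g i) (leqnn _)).2 P0.
Qed.

End DynkinQuiver.

Lemma connected_DynkinP (Q : finquiver) : connected_Dynkin Q ->
  (exists l : Q0 Q -> int, forall a, l (ftgt a) = l (fsrc a) + 1) /\
  exists (v : Q0 Q -> int) (j : Q0 Q), subadditive v j /\ connected_from j.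
Proof.
move=> [t [tv [f [[g fK gK] fadj]]]]; split.
  exact: (Dynkin_levels tv gK fadj).
exact: (Dynkin_subadditive tv fK gK fadj).
Qed.

(** * Long paths of R_C factor through frozen vertices *)
Section Nilpotency.
Variables (k : fieldType) (Q : finquiver) (C : set (vert (repetition Q))).
Variable l : Q0 Q -> int.
Hypothesis l_arr : forall a : Q1 Q, l (ftgt a) = l (fsrc a) + 1.
Hypothesis adm : admissible k C.
Local Notation ZQ0 := (vert (repetition Q)).
Local Notation ZQf := (repetition (framed Q)).
Local Notation RCC := (RC k C).
Local Notation D := (RC_data k C l).

Lemma RC_graded : graded_mesh_cat D.
Proof.
split.
- exact: RC_left.
- exact: RC_right.
- exact: RC_mesh.
- exact: RC_fd.
- by move=> x y f; apply: RC_hom_neq0.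
- exact: RC_end.
- by move=> m e; apply: vheight_mid.
- by move=> m; rewrite /= vheight_lft; lia.
Qed.

Lemma stable_frozen (z : D) (x : ZQ0) : forall y : stable z (frozen x : D), y = 0.
Proof.
have [a|na] := pselect ((@sigma_inv Q @` C) (frozen x)); first exact: stable_alive.
by apply: stable_killed; apply: RC_killed.
Qed.

Definition on_nonfrozen (d : Q0 Q -> int) (w : vert ZQf) : int :=
  match w.1 with inl i => d i | inr _ => 0 end.

Lemma sum_mid (d : Q0 Q -> int) (x : ZQ0) :
  \sum_(e : arrows_into (nonfrozen x)) on_nonfrozen d (mesh_mid e) = neighbour_sum d x.1.
Proof.
pose F (e : Q1 (framed Q) + Q1 (framed Q)) := on_nonfrozen d (@rsrc (framed Q) (e, x.2)).
transitivity (\sum_(e | @rtgt (framed Q) (e, x.2) == nonfrozen x) F e).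
  rewrite [RHS](reindex_omap (val : arrows_into (nonfrozen x) -> _) insub); last first.
    by move=> e he; rewrite insubT.
  by apply: eq_big => [[e he]|//]; rewrite /= insubT he /= eqxx.
rewrite /F {F}; case: x => i p; rewrite big_sumType !big_sumType /=.
rewrite [X in _ + X + _]big1 => [|a /eqP []//].
rewrite [X in _ + (_ + X)]big1 => [|//]; rewrite !addr0 /neighbour_sum.
congr (_ + _); apply: eq_big => // a.
  by apply/eqP/eqP => [[->]|->].
by apply/eqP/eqP => [[->]|->].
Qed.

Section AtVertex.
Variable z : ZQ0.
Let zD : D := nonfrozen z.
Let T : int := vheight l (nonfrozen z).
Local Notation dm t := (additive_from z.1 t).
Let zT : @height k D zD = T := erefl.
Let hE (w : D) : height w = vheight l w := erefl.

(** As long as the mesh sequences are exact on the left, the dimensions of F are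
    given by additive_from. Time s corresponds to the height T - 1 + s, so that
    at time 0 all spaces vanish and at time 1 only F(z) is nonzero. *)
Lemma stable_dims t : ~ (forall y : stable zD zD, y = 0) ->
  (forall s, (s < t)%N -> mono_at zD (T - 1 + s%:Z)) ->
  scalar_endomorphisms zD (T - 1 + t%:Z) /\
  forall (x : ZQ0) s, (s <= t.+1)%N -> vheight l (nonfrozen x) = T - 1 + s%:Z ->
    stable_dim zD (nonfrozen x : D) (dm s x.1).
Proof.
move=> zn; elim: t => [|t IH] mono.
  split; first by rewrite addr0; apply: (scalar_endomorphisms_base RC_graded).
  move=> x s; rewrite leq_eqVlt ltnS leqn0 => /orP[/eqP ->|/eqP ->] hx.
    rewrite /additive_from /=; have [e|ne] := eqVneq x.1 z.1.
      have -> : x = z; last exact: (stable_dim_start RC_graded).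
      move: hx; rewrite /T /vheight /= e subrK => /addIr.
      case: (x) (z) e => [i p] [j q] /= -> h.
      by congr (_, _); move: h; rewrite !mulr2n; lia.
    apply/stable_dim0; apply: (stable_low RC_graded).
      by rewrite zT hE hx subrK.
    by move=> e; case/eqP: ne; case: e.
  rewrite /additive_from /=; apply/stable_dim0; apply: (stable_low RC_graded).
    by rewrite zT hE hx; lia.
  by move=> e; move: hx; rewrite [nonfrozen x]e -/T; lia.
have [sc dims] := IH (fun s hs => mono s (ltnW hs)).
have mt : mono_at zD (T - 1 + t%:Z) by apply: mono.
split.
  have -> : T - 1 + t.+1%:Z = T - 1 + t%:Z + 1 by rewrite -addrA -natz [in RHS]addrC -natz; lia.
  by apply: (scalar_endomorphisms_step RC_graded) => //; rewrite zT; lia.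
move=> x s; rewrite leq_eqVlt => /orP[/eqP -> hx|]; last exact: dims.
rewrite additive_fromS -sum_mid.
have hl : vheight l (mesh_lft x) = T - 1 + t%:Z by rewrite vheight_lft [vheight l (mesh_rgt x)]hx; lia.
have hl' : @height k D (@lft k D x) = T - 1 + t%:Z := hl.
apply: (@stable_dim_rgt k D RC_graded zD x).
- by rewrite hl'.
- by rewrite hl' zT; lia.
- exact: (dims (x.1, x.2 - 1) t (leqnSn t) hl).
move=> e; have he : vheight l (mesh_mid e) = T - 1 + t.+1%:Z by rewrite vheight_mid // hl; lia.
change (stable_dim zD (mesh_mid e : D) (on_nonfrozen (dm t.+1) (mesh_mid e))).
move: (mesh_mid e) he => [[i|i] p] he; last first.
  exact: (proj2 (stable_dim0 zD _) (@stable_frozen zD (i, p))).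
exact: (dims (i, p) t.+1 (leqnn _) he).
Qed.

(** Not every pair of a vertex of Q and a height comes from a vertex of ZQ, but
    the additive function is 0 at the pairs which do not. *)
Lemma additive_from_vertex t i : dm t i <> 0 ->
  exists p, vheight l (nonfrozen (i, p)) = T - 1 + t%:Z.
Proof.
suff : forall i, (dm t i <> 0 -> exists p, vheight l (nonfrozen (i, p)) = T - 1 + t%:Z) /\
    (dm t.+1 i <> 0 -> exists p, vheight l (nonfrozen (i, p)) = T - 1 + t.+1%:Z).
  by move=> /(_ i) [].
elim: t {i} => [|t IH] i; split=> //.
- rewrite /additive_from /=; case: eqP => // -> _; exists z.2.
  by rewrite subrK /T; case: (z).
- by have [_] := IH i.
rewrite additive_fromS => h.
have [d0|d0] := pselect (dm t i <> 0).
  have [p hp] := (IH i).1 d0; exists (p + 1).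
  by move: hp; rewrite /vheight /= mulrnDl; move: (p *+ 2) => u; lia.
have {}d0 : dm t i = 0 by apply: contrapT.
have [[a [ai da]]|no] := pselect (exists a, ftgt a = i /\ dm t.+1 (fsrc a) <> 0).
  have [p hp] := (IH _).2 da; exists p.
  by move: hp; rewrite /vheight /= -ai l_arr; lia.
have [[a [ai da]]|no'] := pselect (exists a, fsrc a = i /\ dm t.+1 (ftgt a) <> 0).
  have [p hp] := (IH _).2 da; exists (p + 1).
  by move: hp; rewrite /vheight /= -ai l_arr mulrnDl; move: (p *+ 2) => u; lia.
case: h; rewrite d0 subr0 /neighbour_sum !big1 ?addr0 // => a /eqP ai; apply: contrapT => da.
  by apply: no'; exists a.
by apply: no; exists a.
Qed.

(** Either some mesh sequence below the bound is not exact on the left, and then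
    F dies at the next height; or the dimensions agree with additive_from beyond
    N, which excludes negative values, and F is 0 at the height T + N. *)
Lemma stable_vanishes_from N :
  (exists t i, (t <= N)%N /\ dm t i < 0) \/ (forall t, (N <= t)%N -> forall i, dm t i = 0) ->
  forall w : D, (T + N%:Z + 2 <= height w)%R -> forall y : stable zD w, y = 0.
Proof.
move=> hN.
have [z0|zn] := pselect (forall y : stable zD zD, y = 0).
  move=> w hw; apply: (stable_vanish RC_graded (t := T)) => // [w' hw'|].
    have [->|ne] := pselect (w' = zD); first exact: z0.
    by apply: (stable_low RC_graded) => //; rewrite hw'.
  by move: hw; lia.
have [ex|no] := pselect (exists s, `[< (s <= N.+1)%N /\ ~ mono_at zD (T - 1 + s%:Z) >]).
  case: (ex_minnP ex) => s /asboolP [sN ns] smin.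
  have [|sc _] := @stable_dims s zn.
    move=> s' hs'; apply: contrapT => ns'; have : (s <= s')%N.
      by apply: smin; apply/asboolP; split=> //; apply: leq_trans sN; apply: ltnW.
    by rewrite leqNgt hs'.
  have F0 := stable_vanish_of_not_mono RC_graded sc ns.
  move=> w hw; apply: (stable_vanish RC_graded (t := T - 1 + s%:Z + 1)) => //.
    by rewrite zT; lia.
  by move: hw sN; lia.
have [|_ dims] := @stable_dims N.+2 zn.
  move=> s hs; apply: contrapT => ns; apply: no; exists s; apply/asboolP.
  by split.
case: hN => [[t [i [tN ti]]]|d0].
  have [|p hp] := @additive_from_vertex t i; first by move=> e; rewrite e ltxx in ti.
  have [|S [_ cS]] := dims (i, p) t _ hp; first by move: tN; lia.
  by move: ti; rewrite -cS.
move=> w hw; apply: (stable_vanish RC_graded (t := T + N%:Z)) => // [|w' hw'|].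
- by rewrite zT; lia.
- case: w' hw' => [[i|i] p] hw'; last exact: (@stable_frozen zD (i, p)).
  apply/stable_dim0; rewrite -(d0 N.+1 (leqnSn N) i).
  by apply: (dims (i, p)); [lia|move: hw' => /= ->; lia].
by move: hw; lia.
Qed.

End AtVertex.

Hypothesis weights : exists (v : Q0 Q -> int) (j : Q0 Q), subadditive v j /\ connected_from j.

(** The bound in stable_vanishes_from depends only on the vertex of Q below z, so
    the maximum over the finitely many vertices of Q is uniform in z. *)
Lemma RC_nil : exists N : nat, forall (z w : D) (f : hom z w),
  (height z + N%:Z <= height w)%R -> through (@alive k D) f.
Proof.
have [v [j [vs vc]]] := weights.
pose N i := projT1 (cid (additive_from_bound i vs vc)).
have NP i : (exists t i', (t <= N i)%N /\ additive_from i t i' < 0) \/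
    (forall t, (N i <= t)%N -> forall i', additive_from i t i' = 0).
  by rewrite /N; case: cid.
exists (\max_i N i + 2)%N => -[[i|i] p] w f hw.
  apply/stable_class0; apply: (@stable_vanishes_from (i, p) (N i) (NP i)).
  have : (N i <= \max_i N i)%N by apply: leq_bigmax.
  by move: hw; rewrite PoszD /=; move: (vheight l _) (vheight l _) => a b; lia.
have [a|na] := pselect ((@sigma_inv Q @` C) (frozen (i, p))).
  by rewrite -[f]compm1; apply: through_comp.
have i0 : @idm k RCC (frozen (i, p)) = 0 := RC_killed k na.
by rewrite -[f]compm1 [idm _]i0 compm0; apply: through0.
Qed.

End Nilpotency.

Lemma RC_Dynkin_mesh_cat k (Q : finquiver) (C : set (vert (repetition Q))) :
  connected_Dynkin Q -> admissible k C ->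
  exists l : Q0 Q -> int, mesh_cat (RC_data k C l).
Proof.
move=> /connected_DynkinP [[l l_arr] w] adm; exists l.
exact: RC_mesh_cat (RC_nil l_arr adm w).
Qed.

Lemma vrank_bound (Q : finquiver) (l : Q0 Q -> int) : exists B : nat,
  forall x : vert (repetition Q),
  ((x.2 *+ 2 - B%:Z) * (#|Q0 Q|)%:Z <= vrank l (frozen x) < (x.2 *+ 2 + B%:Z) * (#|Q0 Q|)%:Z)%R.
Proof.
exists (2 + \max_i absz (l i))%N => x.
have : (absz (l x.1) <= \max_i absz (l i))%N by apply: leq_bigmax.
rewrite /vrank /vheight /=; have := ltn_ord (enum_rank x.1).
set a := nat_of_ord _; set n := #|_|; move: (\max_i _)%N (x.2 *+ 2) (l x.1) a n => m q c a n.
by move=> an cm; apply/andP; split; nia.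
Qed.

(** Boundedness in the second coordinate, in the height and in the rank amount to
    the same, since the levels take finitely many values. *)
Lemma right_bounded_rank k (Q : finquiver) (C : set (vert (repetition Q))) (l : Q0 Q -> int)
    (M : rmod (SC k C)) : right_bounded M ->
  exists N : int, forall u : SC k C, (N <= vrank l (sval u))%R -> forall x : M u, x = 0.
Proof.
move=> [N MN]; have [B hB] := vrank_bound l.
exists ((N *+ 2 + B%:Z) * (#|Q0 Q|)%:Z) => u hu; apply: MN; move: hu.
have [x ->] : exists x, sval u = frozen x by case: (svalP u) => x _ <-; exists x.
have /andP[_] := hB x.
rewrite leNgt => h1 h2; apply/negP => h3.
have : (x.2 *+ 2 + B%:Z) * (#|Q0 Q|)%:Z <= (N *+ 2 + B%:Z) * (#|Q0 Q|)%:Z.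
  by apply: ler_wpM2r => //; move: h3; rewrite /= !mulr2n; lia.
by move: h1 h2; lia.
Qed.

Lemma left_bounded_rank k (Q : finquiver) (C : set (vert (repetition Q))) (l : Q0 Q -> int)
    (M : rmod (SC k C)) : left_bounded M ->
  exists N : int, forall u : SC k C, (vrank l (sval u) <= N)%R -> forall x : M u, x = 0.
Proof.
move=> [N MN]; have [B hB] := vrank_bound l.
exists ((N *+ 2 - B%:Z) * (#|Q0 Q|)%:Z) => u hu; apply: MN; move: hu.
have [x ->] : exists x, sval u = frozen x by case: (svalP u) => x _ <-; exists x.
have /andP[+ _] := hB x.
rewrite leNgt => h1 h2; apply/negP => h3.
have n0 : (0 < #|Q0 Q|)%N by apply/card_gt0P; exists x.1.
have : (N *+ 2 - B%:Z) * (#|Q0 Q|)%:Z < (x.2 *+ 2 - B%:Z) * (#|Q0 Q|)%:Z.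
  by rewrite ltr_pM2r //; move: h3; rewrite /= !mulr2n; lia.
by move: h1 h2; lia.
Qed.

Theorem lemma5p7 (k : fieldType) (Q : finquiver) (C : set (vert (repetition Q)))
  (hQ : connected_Dynkin Q) (hC : admissible k C) :
  (forall I M : rmod (SC k C),
     finitely_cogenerated I -> injective_module I ->
     pointwise_finite_dim M -> right_bounded M ->
     forall p : nat, (2 <= p)%N -> Ext_vanishes p I M) /\
  (forall M P : rmod (SC k C),
     finitely_generated P -> projective P ->
     pointwise_finite_dim M -> left_bounded M ->
     forall p : nat, (2 <= p)%N -> Ext_vanishes p M P).
Proof.
have [l H] := RC_Dynkin_mesh_cat hQ hC; split.
- move=> I M Icog Iinj Mfd /(right_bounded_rank l) Mb.
  exact: (ext_cogenerated H Icog Iinj Mfd Mb).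
- move=> M P Pg Pp Mfd /(left_bounded_rank l) Mb.
  exact: (ext_generated H Pg Pp Mfd Mb).
Qed.
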